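(* Let $m_1,m_2\in\mathbb{Q}$ be such that $m_1-m_2=P/Q$ with $P,Q\in\mathbb{Z}$, $\gcd(P,Q)=1$ and $Q\geq 2$, and such that $k_0:=6(m_1+m_2)-1$ is an integer. Put $k_1:=\frac{36(m_1-m_2)^2-1}{144}$. Then the differential equation \[(D_{k_0+2}\circ D_{k_0}-k_1E_4)f=0\] has two linearly independent solutions $f_1,f_2$ with rational $q$-expansions, and exactly one of the following is true: (1) at least one of $f_1$ or $f_2$ has unbounded denominators; (2) $Q\leq 5$.
   Context: Here $q=e^{2\pi i\tau}$ with $\tau$ in the upper half-plane. For even $k\geq 2$, $E_k(q)=1+\frac{2}{\zeta(1-k)}\sum_{n\geq1}\sigma_{k-1}(n)q^n$ is the weight $k$ Eisenstein series (so $E_2=1-24\sum_{n\ge1}\sigma_1(n)q^n$, $E_4=1+240\sum_{n\ge1}\sigma_3(n)q^n$). For an integer $k$, $D_k=q\frac{d}{dq}-\frac{k}{12}E_2$. A $q$-expansion $q^h\sum_{n\ge0}a_nq^n$ is rational if all $a_n\in\mathbb{Q}$; it has bounded denominators if there is an integer $N\ge1$ with $Na_n\in\mathbb{Z}$ for all $n$, and unbounded denominators otherwise. *)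

(* Defs.v *)
(* Stdlib reals with Coquelicot's complex numbers. *)
From Stdlib Require Export Reals QArith Qreals ZArith List.
From Coquelicot Require Export Coquelicot.
Set Implicit Arguments.
Open Scope C_scope.

Definition upper (tau : C) : Prop := (0 < Im tau)%R.

Definition Cexp (z : C) : C :=
  (exp (Re z) * cos (Im z), exp (Re z) * sin (Im z))%R.

(* [qpow h tau] is q^h with q = e^(2 pi i tau).  The real power is a function
   of tau, not of q, so that no branch has to be chosen. *)
Definition qpow (h : R) (tau : C) : C :=
  Cexp (RtoC (2 * PI * h) * Ci * tau).

Definition q (tau : C) : C := qpow 1 tau.

(* Coquelicot's total [Series] is real-valued; this is its componentwise
   extension to complex terms. *)
Definition CSeries (a : nat -> C) : C :=
  (Series (fun n => Re (a n)), Series (fun n => Im (a n))).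

Definition sigma (k n : nat) : nat :=
  list_sum (map (fun d => Nat.pow d k)
                (filter (fun d => Nat.eqb (Nat.modulo n d) 0) (seq 1 n))).

(* The constants are 2 / zeta(1-k), i.e. 2 / zeta(-1) = -24 and
   2 / zeta(-3) = 240. *)
Definition E2 (tau : C) : C :=
  1 - 24 * CSeries (fun n => RtoC (INR (sigma 1 (S n))) * q tau ^ S n).

Definition E4 (tau : C) : C :=
  1 + 240 * CSeries (fun n => RtoC (INR (sigma 3 (S n))) * q tau ^ S n).

(* On functions of tau, the derivation q d/dq is (1 / (2 pi i)) d/dtau. *)
Definition theta (f : C -> C) (tau : C) : C :=
  C_derive f tau / (RtoC (2 * PI) * Ci).

Definition D (k : Z) (f : C -> C) (tau : C) : C :=
  theta f tau - RtoC (IZR k / 12) * E2 tau * f tau.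

(* Functions are total on C; only their values on the upper half-plane
   matter.  [C_derive] is a total operator, hence the explicit requirement
   that f be holomorphic there. *)
Definition is_solution (k0 : Z) (k1 : Q) (f : C -> C) : Prop :=
  (forall tau, upper tau -> ex_derive f tau) /\
  (forall tau, upper tau ->
     D (k0 + 2) (D k0 f) tau - RtoC (Q2R k1) * E4 tau * f tau = 0).

Definition lin_indep (f1 f2 : C -> C) : Prop :=
  forall c1 c2 : C,
    (forall tau, upper tau -> c1 * f1 tau + c2 * f2 tau = 0) ->
    c1 = 0 /\ c2 = 0.

(* f = q^h * (sum of a_n q^n) on the upper half-plane, with rational a_n. *)
Definition has_rational_qexp (f : C -> C) (h : R) (a : nat -> Q) : Prop :=
  forall tau, upper tau ->
    exists s : C,
      is_pseries (fun n => RtoC (Q2R (a n))) (q tau) s /\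
      f tau = qpow h tau * s.

Definition bounded_denominators (a : nat -> Q) : Prop :=
  exists N : Z, (1 <= N)%Z /\
    forall n, exists z : Z, (inject_Z N * a n == inject_Z z)%Q.

Definition unbounded_denominators (a : nat -> Q) : Prop :=
  ~ bounded_denominators a.

Definition independent_rational_solutions (k0 : Z) (k1 : Q)
    (f1 f2 : C -> C) (h1 h2 : R) (a1 a2 : nat -> Q) : Prop :=
  is_solution k0 k1 f1 /\ is_solution k0 k1 f2 /\ lin_indep f1 f2 /\
  has_rational_qexp f1 h1 a1 /\ has_rational_qexp f2 h2 a2.

Definition exactly_one (A B : Prop) : Prop := (A \/ B) /\ ~ (A /\ B).

(* Main.v *)
Require Import Defs.
From Stdlib Require Import Psatz FunctionalExtensionality ClassicalEpsilon Znumtheory.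
Import ListNotations.
Open Scope R_scope.

(* A power of the eta function reduces the equation to weight 0, where the solutions are the
   Frobenius series G_r and G_(-r) with exponents 1/12 +- r/2, r = P/Q. Whether both have
   bounded denominators does not change when an integer is added to r, because a differential
   operator of weight 6 leads from r to r + 1.
   For Q = 2, 3, 4 an eta quotient in q^(1/Q), split by the residues of its exponents, gives
   both solutions; for Q = 5 the two Rogers-Ramanujan products do. The identities between
   Eisenstein series of levels 1 to 5 that this needs are instances of Skoruppa's identity,
   a combinatorial statement on the solutions of a x + b y = n.
   If Q does not divide 60, every prime divisor of Q / gcd(60, Q) occurs to arbitrarily high
   powers in the denominators of G_r, by the Frobenius recursion.
   If Q divides 60 and Q >= 6, one can assume 1 < r < 2. Now G_r is t^(1/12 + r/2) times a
   hypergeometric series in 1728 t, t = 1/j, and the action of Dwork's map on the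
   hypergeometric parameters produces a prime between 7 and 23 that occurs to arbitrarily high
   powers in the denominators of G_r or of G_(-r). *)

(** The weight 0 equation is the pull-back along t = 1/j of a hypergeometric equation with exponent
    differences r, 1/3 and 1/2. For Q = 2, 3, 4, 5 its projective monodromy group is finite
    (dihedral, tetrahedral, octahedral, icosahedral); this is where the bound 5 comes from and why Q
    = 5 needs icosahedral formulas. There 2/5 is treated apart from 1/5, since integer shifts and a
    sign do not connect them. The proof uses neither monodromy nor modular transformations: every
    identity between modular forms is one of formal power series, obtained from divisor sums or from
    uniqueness for a differential equation. The number 60 is 36 * 240 / 144, the factor of r^2 when
    [kone r] meets the coefficients 240 sigma_3(n) of E_4; it is all that can cancel against the
    denominator Q. The interval 1 < r < 2 avoids r = 1/6 and r = 5/6, where the hypergeometric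
    series of -r terminates. The search for primes is finite because Dwork's map acts on the
    numerators of the parameters by division by p modulo 120, hence with eventual period dividing
    4. *)

(** * Finite sums *)

Fixpoint bsum (f : nat -> R) (n : nat) : R :=
  match n with O => 0 | S m => bsum f m + f m end.

Lemma bsum_S f n : bsum f (S n) = bsum f n + f n.
Proof. reflexivity. Qed.

Lemma bsum_ext f g n : (forall i, (i < n)%nat -> f i = g i) -> bsum f n = bsum g n.
Proof.
  induction n as [|n IH]; intros H; simpl; [reflexivity|].
  rewrite IH by (intros; apply H; lia). rewrite H by lia. reflexivity.
Qed.

Lemma bsum_plus f g n : bsum (fun i => f i + g i) n = bsum f n + bsum g n.
Proof. induction n; simpl; [ring|rewrite IHn; ring]. Qed.

Lemma bsum_scal c f n : bsum (fun i => c * f i) n = c * bsum f n.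
Proof. induction n; simpl; [ring|rewrite IHn; ring]. Qed.

Lemma bsum_scal_r c f n : bsum (fun i => f i * c) n = bsum f n * c.
Proof. induction n; simpl; [ring|rewrite IHn; ring]. Qed.

Lemma bsum_minus f g n : bsum (fun i => f i - g i) n = bsum f n - bsum g n.
Proof. induction n; simpl; [ring|rewrite IHn; ring]. Qed.

Lemma bsum_0 f n : (forall i, (i < n)%nat -> f i = 0) -> bsum f n = 0.
Proof.
  induction n as [|n IH]; intros H; simpl; [reflexivity|].
  rewrite IH by (intros; apply H; lia). rewrite H by lia. ring.
Qed.

Lemma bsum_S_l f n : bsum f (S n) = f O + bsum (fun i => f (S i)) n.
Proof.
  induction n as [|n IH]; [simpl; ring|].
  change (bsum f (S (S n))) with (bsum f (S n) + f (S n)).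
  rewrite IH. simpl. ring.
Qed.

Lemma bsum_rev f n : bsum f n = bsum (fun i => f (n - 1 - i)%nat) n.
Proof.
  induction n as [|n IH]; [reflexivity|].
  rewrite (bsum_S_l (fun i => f (S n - 1 - i)%nat)).
  simpl bsum at 1. rewrite IH.
  replace (S n - 1 - 0)%nat with n by lia.
  rewrite Rplus_comm. f_equal. apply bsum_ext; intros; f_equal; lia.
Qed.

Lemma bsum_swap (f : nat -> nat -> R) n m :
  bsum (fun i => bsum (f i) m) n = bsum (fun j => bsum (fun i => f i j) n) m.
Proof.
  induction n as [|n IH]; simpl.
  - symmetry; apply bsum_0; reflexivity.
  - rewrite IH, <- bsum_plus. reflexivity.
Qed.

Lemma bsum_single f n k :
  (k < n)%nat -> (forall i, (i < n)%nat -> i <> k -> f i = 0) -> bsum f n = f k.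
Proof.
  induction n as [|n IH]; intros Hk H; [lia|]. simpl.
  destruct (Nat.eq_dec k n) as [->|Hn].
  - rewrite bsum_0; [ring|]. intros; apply H; lia.
  - rewrite IH; [|lia|intros; apply H; lia]. rewrite (H n); [ring|lia|lia].
Qed.

Lemma bsum_add f n m : bsum f (n + m) = bsum f n + bsum (fun i => f (n + i)%nat) m.
Proof.
  induction m as [|m IH].
  - rewrite Nat.add_0_r. simpl. ring.
  - rewrite Nat.add_succ_r. simpl. rewrite IH. ring.
Qed.

Lemma bsum_widen f n m :
  (n <= m)%nat -> (forall i, (n <= i < m)%nat -> f i = 0) -> bsum f m = bsum f n.
Proof.
  intros Hnm H. replace m with (n + (m - n))%nat by lia.
  rewrite bsum_add, (bsum_0 _ (m - n)); [ring|].
  intros; apply H; lia.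
Qed.

Lemma bsum_le f g n : (forall i, (i < n)%nat -> f i <= g i) -> bsum f n <= bsum g n.
Proof.
  induction n as [|n IH]; intros H; simpl; [lra|].
  apply Rplus_le_compat; [apply IH; intros; apply H; lia|apply H; lia].
Qed.

Lemma bsum_Rabs f n : Rabs (bsum f n) <= bsum (fun i => Rabs (f i)) n.
Proof.
  induction n as [|n IH]; simpl; [rewrite Rabs_R0; lra|].
  eapply Rle_trans; [apply Rabs_triang|lra].
Qed.

(** Both sides run over the pairs (j, i) with j + i < n. *)
Lemma bsum_triangle (F : nat -> nat -> R) n :
  bsum (fun k => bsum (fun j => F j (k - j)%nat) (S k)) n
  = bsum (fun j => bsum (fun i => F j i) (n - j)) n.
Proof.
  induction n as [|n IH]; [reflexivity|].
  change (bsum (fun k => bsum (fun j => F j (k - j)%nat) (S k)) n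
          + bsum (fun j => F j (n - j)%nat) (S n)
          = bsum (fun j => bsum (fun i => F j i) (S n - j)) (S n)).
  rewrite IH.
  assert (E : bsum (fun j => bsum (fun i => F j i) (n - j)) n
              = bsum (fun j => bsum (fun i => F j i) (n - j)) (S n)).
  { change (bsum (fun j => bsum (fun i => F j i) (n - j)) (S n)) with
      (bsum (fun j => bsum (fun i => F j i) (n - j)) n + bsum (fun i => F n i) (n - n)).
    rewrite Nat.sub_diag. simpl. ring. }
  rewrite E, <- bsum_plus.
  apply bsum_ext. intros j Hj. replace (S n - j)%nat with (S (n - j)) by lia.
  reflexivity.
Qed.

(** * Formal power series over the reals *)

(** Real coefficients, with rationality and integrality as the predicates [isQ] and [isZ], keep
    [field], [lra] and the convergence proofs available. *)
Definition ps := nat -> R.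
Declare Scope ps_scope.
Delimit Scope ps_scope with ps.
Bind Scope ps_scope with ps.

Definition cst (c : R) : ps := fun n => match n with O => c | _ => 0 end.
Definition padd (a b : ps) : ps := fun n => a n + b n.
Definition popp (a : ps) : ps := fun n => - a n.
Definition psub (a b : ps) : ps := fun n => a n - b n.
Definition pmul (a b : ps) : ps :=
  fun n => bsum (fun k => a k * b (n - k)%nat) (S n).
Definition qc (x : Q) : ps := cst (Q2R x).

Notation "a + b" := (padd a b) : ps_scope.
Notation "a - b" := (psub a b) : ps_scope.
Notation "a * b" := (pmul a b) : ps_scope.
Notation "- a" := (popp a) : ps_scope.

Lemma pmul_comm (a b : ps) : (a * b)%ps = (b * a)%ps.
Proof.
  apply functional_extensionality; intros n. unfold pmul.
  rewrite bsum_rev. apply bsum_ext. intros i Hi.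
  replace (S n - 1 - i)%nat with (n - i)%nat by lia.
  replace (n - (n - i))%nat with i by lia. ring.
Qed.

Lemma pmul_assoc (a b c : ps) : (a * (b * c))%ps = (a * b * c)%ps.
Proof.
  apply functional_extensionality; intros n. unfold pmul.
  transitivity (bsum (fun k => bsum (fun j => a j * (b (k - j)%nat * c (n - j - (k - j))%nat)) (S k)) (S n)).
  - rewrite (bsum_triangle (fun j i => a j * (b i * c (n - j - i)%nat))).
    apply bsum_ext. intros j Hj. rewrite <- bsum_scal.
    replace (S n - j)%nat with (S (n - j)) by lia. reflexivity.
  - apply bsum_ext. intros k Hk. rewrite <- bsum_scal_r.
    apply bsum_ext. intros j Hj.
    replace (n - j - (k - j))%nat with (n - k)%nat by lia. ring.
Qed.

Lemma cst_mul_coef c (a : ps) n : (cst c * a)%ps n = c * a n.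
Proof.
  unfold pmul. rewrite (bsum_single _ _ O); [|lia|].
  - simpl. rewrite Nat.sub_0_r. reflexivity.
  - intros [|i] _ Hi; [lia|simpl; ring].
Qed.

Lemma qc_mul_coef c (a : ps) n : (qc c * a)%ps n = Q2R c * a n.
Proof. apply cst_mul_coef. Qed.

Lemma pmul_1_l (a : ps) : (qc 1 * a)%ps = a.
Proof.
  apply functional_extensionality; intros n.
  rewrite qc_mul_coef. replace (Q2R 1) with 1 by (unfold Q2R; simpl; field). ring.
Qed.

Lemma pmul_add_l (a b c : ps) : ((a + b) * c)%ps = (a * c + b * c)%ps.
Proof.
  apply functional_extensionality; intros n. unfold pmul, padd.
  rewrite <- bsum_plus. apply bsum_ext; intros; ring.
Qed.

Lemma ps_ring : ring_theory (qc 0) (qc 1) padd pmul psub popp (@eq ps).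
Proof.
  constructor.
  - intros x; apply functional_extensionality; intros n.
    unfold padd, qc, cst, Q2R; destruct n; simpl; lra.
  - intros; apply functional_extensionality; intros; unfold padd; ring.
  - intros; apply functional_extensionality; intros; unfold padd; ring.
  - apply pmul_1_l.
  - apply pmul_comm.
  - apply pmul_assoc.
  - apply pmul_add_l.
  - intros; apply functional_extensionality; intros; unfold padd, psub, popp; ring.
  - intros; apply functional_extensionality; intros n.
    unfold padd, popp, qc, cst, Q2R; destruct n; simpl; lra.
Qed.

Lemma cst_add a b : cst (a + b) = (cst a + cst b)%ps.
Proof. apply functional_extensionality; intros [|n]; unfold padd; simpl; ring. Qed.
Lemma cst_sub a b : cst (a - b) = (cst a - cst b)%ps.
Proof. apply functional_extensionality; intros [|n]; unfold psub; simpl; ring. Qed.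
Lemma cst_opp a : cst (- a) = (- cst a)%ps.
Proof. apply functional_extensionality; intros [|n]; unfold popp; simpl; ring. Qed.
Lemma cst_mul a b : cst (a * b) = (cst a * cst b)%ps.
Proof.
  apply functional_extensionality; intros n. rewrite cst_mul_coef.
  destruct n; simpl; ring.
Qed.

(** This lets [ring] on power series compute with the constants [qc x] inside Q, where [Qred] keeps
    the fractions small. Constants [cst c] with a real c remain atoms, so they are converted to [qc]
    before [ring] is called. *)
Lemma ps_morph :
  ring_morph (qc 0) (qc 1) padd pmul psub popp (@eq ps)
    0%Q 1%Q (fun x y => Qred (x + y)) (fun x y => Qred (x * y))
    (fun x y => Qred (x - y)) Qopp Qeq_bool qc.
Proof.
  constructor; try reflexivity; intros x; try intros y; unfold qc.
  - rewrite <- cst_add, <- Q2R_plus. f_equal. apply Qeq_eqR, Qred_correct.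
  - rewrite <- cst_sub, <- Q2R_minus. f_equal. apply Qeq_eqR, Qred_correct.
  - rewrite <- cst_mul, <- Q2R_mult. f_equal. apply Qeq_eqR, Qred_correct.
  - rewrite <- cst_opp, <- Q2R_opp. reflexivity.
  - intros H. f_equal. apply Qeq_eqR, Qeq_bool_eq, H.
Qed.

Ltac ps_cst t :=
  match t with
  | qc ?x => x
  | _ => constr:(InitialRing.NotConstant)
  end.
Add Ring ps_ring_inst : ps_ring (morphism ps_morph, constants [ps_cst]).

Fixpoint ppow (a : ps) (n : nat) : ps :=
  match n with O => qc 1 | S m => (a * ppow a m)%ps end.

Definition dq (a : ps) : ps := fun n => INR n * a n.

Lemma dq_mul (a b : ps) : dq (a * b) = (dq a * b + a * dq b)%ps.
Proof.
  apply functional_extensionality; intros n. unfold dq, pmul, padd.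
  rewrite <- bsum_scal, <- bsum_plus. apply bsum_ext. intros k Hk.
  rewrite minus_INR by lia. ring.
Qed.
Lemma dq_add (a b : ps) : dq (a + b) = (dq a + dq b)%ps.
Proof. apply functional_extensionality; intros n. unfold dq, padd. ring. Qed.
Lemma dq_sub (a b : ps) : dq (a - b) = (dq a - dq b)%ps.
Proof. apply functional_extensionality; intros n. unfold dq, psub. ring. Qed.
Lemma dq_opp (a : ps) : dq (- a) = (- dq a)%ps.
Proof. apply functional_extensionality; intros n. unfold dq, popp. ring. Qed.
Lemma dq_cst c : dq (cst c) = qc 0.
Proof.
  apply functional_extensionality; intros [|n]; unfold dq, qc, cst, Q2R; simpl; ring.
Qed.
Lemma dq_qc c : dq (qc c) = qc 0.
Proof. apply dq_cst. Qed.

Lemma ps_ext (a b : ps) : (forall n, a n = b n) -> a = b.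
Proof. apply functional_extensionality. Qed.

Lemma pmul_coef0 (a b : ps) : (a * b)%ps O = a O * b O.
Proof. unfold pmul. simpl. ring. Qed.

Lemma pmul_coef_low (a b : ps) n :
  (forall k, (k < n)%nat -> b k = 0) -> (a * b)%ps n = a O * b n.
Proof.
  intros H. unfold pmul. rewrite (bsum_single _ _ O); [|lia|].
  - rewrite Nat.sub_0_r. reflexivity.
  - intros i Hi Hi0. rewrite H by lia. ring.
Qed.

Lemma pmul_low0 (a b : ps) n :
  (forall k, (k < n)%nat -> b k = 0) -> forall k, (k < n)%nat -> (a * b)%ps k = 0.
Proof.
  intros H k Hk. unfold pmul. apply bsum_0. intros i Hi. rewrite H by lia. ring.
Qed.

Lemma pmul_ext_low (a a' b b' : ps) n :
  (forall k, (k <= n)%nat -> a k = a' k) -> (forall k, (k <= n)%nat -> b k = b' k) ->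
  (a * b)%ps n = (a' * b')%ps n.
Proof.
  intros Ha Hb. unfold pmul. apply bsum_ext. intros k Hk.
  rewrite Ha, Hb by lia. reflexivity.
Qed.

Definition qX : ps := fun n => match n with 1%nat => 1 | _ => 0 end.

Lemma qX_mul_S (a : ps) n : (qX * a)%ps (S n) = a n.
Proof.
  unfold pmul. rewrite (bsum_single _ _ 1%nat); [|lia|].
  - simpl. rewrite Nat.sub_0_r. ring.
  - intros [|[|i]] Hi Hi1; simpl; try ring. lia.
Qed.
Lemma qX_mul_0 (a : ps) : (qX * a)%ps O = 0.
Proof. rewrite pmul_coef0. simpl. ring. Qed.

Lemma dq_qX : dq qX = qX.
Proof. apply ps_ext; intros [|[|n]]; unfold dq; simpl; try ring. Qed.

(* Solving for the coefficients one at a time: [Phi n] may only look at the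
   coefficients below [n]. *)
Lemma ps_rec (c : R) (Phi : nat -> ps -> R) :
  (forall n a b, (forall k, (k < n)%nat -> a k = b k) -> Phi n a = Phi n b) ->
  exists a : ps, a O = c /\ forall n, (1 <= n)%nat -> a n = Phi n a.
Proof.
  intros HPhi.
  set (A := fix A n : ps := match n with
    | O => fun _ => c
    | S m => fun k => if Nat.eqb k (S m) then Phi (S m) (A m) else A m k end).
  assert (HA : forall n k, (k <= n)%nat -> A n k = A k k).
  { induction n as [|n IH]; intros k Hk.
    - replace k with O by lia. reflexivity.
    - destruct (Nat.eq_dec k (S n)) as [->|Hne]; [reflexivity|].
      simpl. replace (Nat.eqb k (S n)) with false by (symmetry; apply Nat.eqb_neq; lia).
      apply IH. lia. }
  exists (fun n => A n n). split; [reflexivity|].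
  intros n Hn. destruct n as [|n]; [lia|].
  simpl. rewrite Nat.eqb_refl. apply HPhi. intros k Hk. apply HA. lia.
Qed.

Lemma ps_inv (a : ps) : a O <> 0 -> exists b : ps, (a * b)%ps = qc 1.
Proof.
  intros Ha.
  destruct (@ps_rec (/ a O) (fun n b => - bsum (fun k => a (S k) * b (n - S k)%nat) n / a O))
    as [b [b0 Hb]].
  { intros n u v H. do 2 f_equal. apply bsum_ext. intros k Hk. rewrite H by lia. reflexivity. }
  exists b. apply ps_ext. intros [|n].
  - rewrite pmul_coef0, b0. unfold qc, cst, Q2R. simpl. field. exact Ha.
  - unfold pmul. rewrite bsum_S_l. rewrite Nat.sub_0_r, (Hb (S n)) by lia.
    unfold qc, cst. field. exact Ha.
Qed.

Lemma ps_eq_sub (a b : ps) : (a - b)%ps = qc 0 -> a = b.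
Proof.
  intros H. apply ps_ext; intros n.
  apply (f_equal (fun s => s n)) in H. unfold psub, qc, cst, Q2R in H.
  destruct n; simpl in H; lra.
Qed.

Lemma qc_cancel (c : Q) (a b : ps) :
  Q2R c <> 0 -> (qc c * a)%ps = (qc c * b)%ps -> a = b.
Proof.
  intros Hc H. apply ps_ext; intros n.
  apply (f_equal (fun s => s n)) in H. rewrite !qc_mul_coef in H.
  apply Rmult_eq_reg_l in H; assumption.
Qed.

Lemma pmul_cancel (u a b : ps) : u O <> 0 -> (u * a)%ps = (u * b)%ps -> a = b.
Proof.
  intros Hu H. destruct (ps_inv _ Hu) as [v Hv].
  transitivity (u * v * a)%ps; [rewrite Hv; ring|].
  transitivity (v * (u * a))%ps; [ring|]. rewrite H.
  transitivity (u * v * b)%ps; [ring|]. rewrite Hv; ring.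
Qed.

(** * Divisor sums and Skoruppa's identity *)

Definition psum (f : nat -> R) (n : nat) : R := bsum (fun i => f (S i)) n.
(** The Iverson bracket of [b], times [r]. *)
Definition iv (b : bool) (r : R) : R := if b then r else 0.

Lemma psum_ext f g n : (forall i, (1 <= i <= n)%nat -> f i = g i) -> psum f n = psum g n.
Proof. intros H. apply bsum_ext. intros i Hi. apply H. lia. Qed.
Lemma psum_0 f n : (forall i, (1 <= i <= n)%nat -> f i = 0) -> psum f n = 0.
Proof. intros H. apply bsum_0. intros i Hi. apply H. lia. Qed.
Lemma psum_plus f g n : psum (fun i => f i + g i) n = psum f n + psum g n.
Proof. apply bsum_plus. Qed.
Lemma psum_minus f g n : psum (fun i => f i - g i) n = psum f n - psum g n.
Proof. apply bsum_minus. Qed.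
Lemma psum_scal c f n : psum (fun i => c * f i) n = c * psum f n.
Proof. apply bsum_scal. Qed.
Lemma psum_swap (f : nat -> nat -> R) n m :
  psum (fun i => psum (f i) m) n = psum (fun j => psum (fun i => f i j) n) m.
Proof. apply (bsum_swap (fun i j => f (S i) (S j))). Qed.
Lemma psum_widen f n m :
  (n <= m)%nat -> (forall i, (n < i <= m)%nat -> f i = 0) -> psum f m = psum f n.
Proof. intros H1 H2. apply bsum_widen; [exact H1|]. intros i Hi. apply H2. lia. Qed.
Lemma psum_single f n k :
  (1 <= k <= n)%nat -> (forall i, (1 <= i <= n)%nat -> i <> k -> f i = 0) -> psum f n = f k.
Proof.
  intros Hk H. unfold psum. rewrite (bsum_single _ _ (k - 1)%nat); [|lia|].
  - f_equal. lia.
  - intros i Hi Hne. apply H; lia.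
Qed.

(** The substitution x = z + y turns the condition y < x into a free variable; the bijections behind
    Skoruppa's identity are carried out this way. *)
Lemma psum_shift (phi : nat -> R) n y :
  (forall i, (n < i)%nat -> phi i = 0) ->
  psum (fun x => iv (Nat.ltb y x) (phi x)) n = psum (fun z => phi (z + y)%nat) n.
Proof.
  intros Hphi. transitivity (psum (fun x => iv (Nat.ltb y x) (phi x)) (y + n)).
  - symmetry. apply psum_widen; [lia|]. intros i Hi. unfold iv.
    destruct (Nat.ltb y i); [apply Hphi; lia|reflexivity].
  - unfold psum. rewrite bsum_add, bsum_0, Rplus_0_l.
    + apply bsum_ext. intros i Hi. unfold iv.
      replace (Nat.ltb y (S (y + i))) with true by (symmetry; apply Nat.ltb_lt; lia).
      f_equal. lia.
    + intros i Hi. unfold iv.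
      replace (Nat.ltb y (S i)) with false by (symmetry; apply Nat.ltb_ge; lia).
      reflexivity.
Qed.

Lemma psum_trichotomy (f : nat -> nat -> R) n :
  psum (fun x => psum (fun y => f x y) n) n
  = psum (fun y => psum (fun x => iv (Nat.ltb y x) (f x y)) n) n
    + psum (fun x => psum (fun y => iv (Nat.ltb x y) (f x y)) n) n
    + psum (fun x => f x x) n.
Proof.
  rewrite <- (psum_swap (fun x y => iv (Nat.ltb y x) (f x y))).
  rewrite <- !psum_plus. apply psum_ext. intros x Hx.
  replace (f x x) with (psum (fun y => iv (Nat.eqb x y) (f x y)) n).
  - rewrite <- !psum_plus. apply psum_ext. intros y Hy. unfold iv.
    destruct (Nat.ltb_spec y x), (Nat.ltb_spec x y), (Nat.eqb_spec x y); try lia; ring.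
  - rewrite (psum_single _ _ x); [|lia|].
    + unfold iv. rewrite Nat.eqb_refl. reflexivity.
    + intros i Hi Hne. unfold iv. destruct (Nat.eqb_spec x i); [lia|reflexivity].
Qed.

(* [lam f] is the series of sum_{d x = n} f d x, that is, of a sum over the divisors d of n. *)
Definition lam (f : nat -> nat -> R) : ps :=
  fun n => psum (fun d => psum (fun x => iv (Nat.eqb (d * x) n) (f d x)) n) n.

(** The bounds n only make the sum finite: in a solution of a x + b y = n by positive integers all
    four are at most n. *)
Definition quad (T : nat -> nat -> R) : ps := fun n =>
  psum (fun a => psum (fun b => psum (fun x => psum (fun y =>
    iv (Nat.eqb (a * x + b * y) n) (T a b)) n) n) n) n.

Lemma lam_ext f g :
  (forall d x, (1 <= d)%nat -> (1 <= x)%nat -> f d x = g d x) -> lam f = lam g.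
Proof.
  intros H. apply ps_ext. intros n. unfold lam. do 2 (apply psum_ext; intros).
  unfold iv. destruct (Nat.eqb _ _); [apply H; lia|reflexivity].
Qed.

Lemma lam_0 f : lam f O = 0.
Proof. reflexivity. Qed.

Lemma lam_add f g : (lam f + lam g)%ps = lam (fun d x => f d x + g d x).
Proof.
  apply ps_ext. intros n. unfold lam, padd.
  rewrite <- psum_plus. apply psum_ext. intros. rewrite <- psum_plus. apply psum_ext. intros.
  unfold iv. destruct (Nat.eqb _ _); ring.
Qed.

Lemma lam_scal c f : (cst c * lam f)%ps = lam (fun d x => c * f d x).
Proof.
  apply ps_ext. intros n. rewrite cst_mul_coef. unfold lam.
  rewrite <- psum_scal. apply psum_ext. intros. rewrite <- psum_scal. apply psum_ext. intros.
  unfold iv. destruct (Nat.eqb _ _); ring.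
Qed.

Lemma lam_dq f : dq (lam f) = lam (fun d x => INR d * INR x * f d x).
Proof.
  apply ps_ext. intros n. unfold dq, lam.
  rewrite <- psum_scal. apply psum_ext. intros. rewrite <- psum_scal. apply psum_ext. intros.
  unfold iv. destruct (Nat.eqb_spec (i * i0) n); [|ring].
  subst n. rewrite mult_INR. ring.
Qed.

(** Gives the coefficients at k and n - k of a product a common range, so that the sums can be
    exchanged. *)
Lemma lam_widen f n N :
  (n <= N)%nat ->
  lam f n = psum (fun d => psum (fun x =>
              iv (andb (Nat.leb 1 n) (Nat.eqb (d * x) n)) (f d x)) N) N.
Proof.
  intros H. unfold lam.
  rewrite (psum_widen _ n N); [|exact H|].
  - apply psum_ext. intros d Hd. rewrite (psum_widen _ n N); [|exact H|].
    + apply psum_ext. intros x Hx.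
      replace (Nat.leb 1 n) with true by (symmetry; apply Nat.leb_le; lia). reflexivity.
    + intros x Hx. unfold iv. destruct (Nat.eqb_spec (d * x) n); [nia|].
      rewrite Bool.andb_false_r. reflexivity.
  - intros d Hd. apply psum_0. intros x Hx. unfold iv.
    destruct (Nat.eqb_spec (d * x) n); [nia|].
    rewrite Bool.andb_false_r. reflexivity.
Qed.

Lemma iv_mul (b c : bool) r s : iv b r * iv c s = iv (andb b c) (r * s).
Proof. destruct b, c; unfold iv; simpl; ring. Qed.

(** For given a, x, b, y the index k of the convolution is forced to be a x. *)
Lemma lam_mul (f g : nat -> R) :
  (lam (fun d _ => f d) * lam (fun d _ => g d))%ps = quad (fun a b => f a * g b).
Proof.
  apply ps_ext. intros n. unfold pmul.
  transitivity (bsum (fun k => psum (fun a => psum (fun x => psum (fun b => psum (fun y =>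
     iv (andb (andb (Nat.leb 1 k) (Nat.eqb (a * x) k))
              (andb (Nat.leb 1 (n - k)) (Nat.eqb (b * y) (n - k)))) (f a * g b)) n) n) n) n) (S n)).
  { apply bsum_ext. intros k Hk.
    rewrite (lam_widen _ k n), (lam_widen _ (n - k) n) by lia.
    unfold psum. rewrite <- bsum_scal_r. apply bsum_ext. intros a Ha.
    rewrite <- bsum_scal_r. apply bsum_ext. intros x Hx.
    rewrite <- bsum_scal. apply bsum_ext. intros b Hb.
    rewrite <- bsum_scal. apply bsum_ext. intros y Hy.
    apply iv_mul. }
  unfold quad, psum. rewrite bsum_swap. apply bsum_ext. intros a Ha.
  rewrite bsum_swap.
  transitivity (bsum (fun x => bsum (fun b => bsum (fun y =>
     iv (Nat.eqb (S a * S x + S b * S y) n) (f (S a) * g (S b))) n) n) n).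
  2: { rewrite bsum_swap. reflexivity. }
  apply bsum_ext. intros x Hx.
  rewrite bsum_swap. apply bsum_ext. intros b Hb.
  rewrite bsum_swap. apply bsum_ext. intros y Hy.
  destruct (Nat.eqb_spec (S a * S x + S b * S y) n) as [E|E].
  - rewrite (bsum_single _ _ (S a * S x)%nat); [|nia|].
    + rewrite Nat.eqb_refl.
      replace (n - S a * S x)%nat with (S b * S y)%nat by lia.
      rewrite Nat.eqb_refl.
      replace (Nat.leb 1 (S a * S x)) with true by (symmetry; apply Nat.leb_le; nia).
      replace (Nat.leb 1 (S b * S y)) with true by (symmetry; apply Nat.leb_le; nia).
      reflexivity.
    + intros k Hk Hne. unfold iv.
      destruct (Nat.eqb_spec (S a * S x) k); [lia|].
      rewrite Bool.andb_false_r. reflexivity.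
  - apply bsum_0. intros k Hk. unfold iv.
    destruct (Nat.eqb_spec (S a * S x) k); [|rewrite Bool.andb_false_r; reflexivity].
    destruct (Nat.eqb_spec (S b * S y) (n - k)); [|rewrite !Bool.andb_false_r; reflexivity].
    exfalso. lia.
Qed.

Lemma quad_swap T : quad T = quad (fun a b => T b a).
Proof.
  apply ps_ext. intros n. unfold quad.
  rewrite psum_swap. apply psum_ext. intros b Hb. apply psum_ext. intros a Ha.
  rewrite psum_swap. apply psum_ext. intros y Hy. apply psum_ext. intros x Hx.
  rewrite (Nat.add_comm (a * x)). reflexivity.
Qed.

Lemma quad_add T U : (quad T + quad U)%ps = quad (fun a b => T a b + U a b).
Proof.
  apply ps_ext. intros n. unfold quad, padd.
  do 4 (rewrite <- psum_plus; apply psum_ext; intros).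
  unfold iv; destruct (Nat.eqb _ _); ring.
Qed.
Lemma quad_sub T U : (quad T - quad U)%ps = quad (fun a b => T a b - U a b).
Proof.
  apply ps_ext. intros n. unfold quad, psub.
  do 4 (rewrite <- psum_minus; apply psum_ext; intros).
  unfold iv; destruct (Nat.eqb _ _); ring.
Qed.
Lemma quad_scal c T : (cst c * quad T)%ps = quad (fun a b => c * T a b).
Proof.
  apply ps_ext. intros n. rewrite cst_mul_coef. unfold quad.
  do 4 (rewrite <- psum_scal; apply psum_ext; intros).
  unfold iv; destruct (Nat.eqb _ _); ring.
Qed.
Lemma quad_ext T U :
  (forall a b, (1 <= a)%nat -> (1 <= b)%nat -> T a b = U a b) -> quad T = quad U.
Proof.
  intros H. apply ps_ext. intros n. unfold quad.
  do 4 (apply psum_ext; intros). rewrite H by lia. reflexivity.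
Qed.

(** The solutions with x = y: with d = a + b the equation becomes d x = n. *)
Lemma quad_diag_h (h : nat -> nat -> R) n :
  psum (fun a => psum (fun b => psum (fun x => iv (Nat.eqb (a * x + b * x) n) (h a b)) n) n) n
  = lam (fun d _ => psum (fun a => h a (d - a)%nat) (d - 1)) n.
Proof.
  transitivity (psum (fun a => psum (fun d => psum (fun x =>
     iv (Nat.ltb a d) (iv (Nat.eqb (d * x) n) (h a (d - a)%nat))) n) n) n).
  - apply psum_ext. intros a Ha.
    transitivity (psum (fun b => psum (fun x =>
       iv (Nat.eqb ((b + a) * x) n) (h a (b + a - a)%nat)) n) n).
    + apply psum_ext. intros b Hb. apply psum_ext. intros x Hx.
      replace (b + a - a)%nat with b by lia. do 2 f_equal. ring.
    + rewrite <- (psum_shift (fun d => psum (fun x =>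
         iv (Nat.eqb (d * x) n) (h a (d - a)%nat)) n)).
      * apply psum_ext. intros d Hd. unfold iv at 1.
        destruct (Nat.ltb a d); [reflexivity|]. symmetry. apply psum_0. reflexivity.
      * intros d Hd. apply psum_0. intros x Hx. unfold iv.
        destruct (Nat.eqb_spec (d * x) n); [nia|reflexivity].
  - rewrite psum_swap. apply psum_ext. intros d Hd. rewrite psum_swap.
    apply psum_ext. intros x Hx.
    rewrite (psum_widen _ (d - 1) n); [|lia|].
    + unfold iv. destruct (Nat.eqb (d * x) n).
      * apply psum_ext. intros a Ha.
        replace (Nat.ltb a d) with true by (symmetry; apply Nat.ltb_lt; lia). reflexivity.
      * apply psum_0. intros a Ha. destruct (Nat.ltb a d); reflexivity.
    + intros a Ha. unfold iv.
      replace (Nat.ltb a d) with false by (symmetry; apply Nat.ltb_ge; lia). reflexivity.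
Qed.

(** The solutions with a = b: with z = x + y the equation becomes a z = n, and y takes z - 1
    values. *)
Lemma quad_diag_K (K : nat -> nat -> R) n :
  psum (fun a => psum (fun x => psum (fun y => iv (Nat.eqb (a * x + a * y) n) (K a a)) n) n) n
  = lam (fun d x => (INR x - 1) * K d d) n.
Proof.
  apply psum_ext. intros a Ha.
  transitivity (psum (fun y => psum (fun z =>
     iv (Nat.ltb y z) (iv (Nat.eqb (a * z) n) (K a a))) n) n).
  - rewrite psum_swap. apply psum_ext. intros y Hy.
    rewrite (psum_shift (fun z => iv (Nat.eqb (a * z) n) (K a a))).
    + apply psum_ext. intros x Hx. do 2 f_equal. ring.
    + intros z Hz. unfold iv. destruct (Nat.eqb_spec (a * z) n); [nia|reflexivity].
  - rewrite psum_swap. apply psum_ext. intros z Hz. unfold iv at 2 3.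
    destruct (Nat.eqb_spec (a * z) n).
    + rewrite (psum_widen _ (z - 1) n); [|nia|].
      * transitivity (psum (fun _ => K a a) (z - 1)).
        -- apply psum_ext. intros y Hy. unfold iv.
           replace (Nat.ltb y z) with true by (symmetry; apply Nat.ltb_lt; lia). reflexivity.
        -- replace (INR z - 1) with (INR (z - 1)) by (rewrite minus_INR by lia; simpl; ring).
           generalize (z - 1)%nat as m. unfold psum.
           induction m; [simpl; ring|]. rewrite S_INR. simpl bsum. rewrite IHm. ring.
      * intros y Hy. unfold iv.
        replace (Nat.ltb y z) with false by (symmetry; apply Nat.ltb_ge; lia). reflexivity.
    + apply psum_0. intros y Hy. unfold iv. destruct (Nat.ltb y z); reflexivity.
Qed.

(* The solutions of [a x + b y = n] with [x > y] are in bijection with those with [b > a],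
   by [(a, b, x, y) |-> (a, a + b, x - y, y)], and symmetrically; an [h] for which the two
   resulting expressions [K] agree leaves only the diagonal terms. *)
Lemma skoruppa (h K : nat -> nat -> R) :
  (forall a b, (1 <= a)%nat -> (1 <= b)%nat -> K a (a + b)%nat = h a b) ->
  (forall a b, (1 <= a)%nat -> (1 <= b)%nat -> K (a + b)%nat b = h a b) ->
  (quad h - quad K)%ps
  = lam (fun d x => psum (fun a => h a (d - a)%nat) (d - 1) - (INR x - 1) * K d d).
Proof.
  intros HK1 HK2.
  transitivity (lam (fun d _ => psum (fun a => h a (d - a)%nat) (d - 1)%nat)
                + lam (fun d x => (- ((INR x - 1) * K d d))%R))%ps.
  2: { rewrite lam_add. apply lam_ext. intros. ring. }
  apply ps_ext. intros n. unfold psub, padd.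
  (* [P] and [P'] are the parts x > y and x < y of [quad h] after subtracting the smaller variable;
     by [HK1] and [HK2] they are also the parts b > a and a > b of [quad K]. *)
  set (P := psum (fun a => psum (fun b => psum (fun x => psum (fun y =>
        iv (Nat.eqb (a * (x + y) + b * y) n) (h a b)) n) n) n) n).
  set (P' := psum (fun a => psum (fun b => psum (fun x => psum (fun y =>
        iv (Nat.eqb (a * x + b * (x + y)) n) (h a b)) n) n) n) n).
  assert (Hh : quad h n = P + P' + lam (fun d _ => psum (fun a => h a (d - a)%nat) (d - 1)) n).
  { rewrite <- quad_diag_h. unfold quad, P, P'.
    rewrite <- !psum_plus. apply psum_ext. intros a Ha.
    rewrite <- !psum_plus. apply psum_ext. intros b Hb.
    rewrite psum_trichotomy. f_equal. f_equal.
    - rewrite psum_swap with (f := fun x y => iv (Nat.eqb (a * (x + y) + b * y) n) (h a b)).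
      apply psum_ext. intros y Hy.
      rewrite (psum_shift (fun x => iv (Nat.eqb (a * x + b * y) n) (h a b))); [reflexivity|].
      intros x Hx. unfold iv. destruct (Nat.eqb_spec (a * x + b * y) n); [nia|reflexivity].
    - apply psum_ext. intros x Hx.
      rewrite (psum_shift (fun y => iv (Nat.eqb (a * x + b * y) n) (h a b))).
      + apply psum_ext. intros y Hy. rewrite (Nat.add_comm y x). reflexivity.
      + intros y Hy. unfold iv. destruct (Nat.eqb_spec (a * x + b * y) n); [nia|reflexivity]. }
  assert (HK : quad K n = P + P' + lam (fun d x => (INR x - 1) * K d d) n).
  { rewrite <- quad_diag_K. unfold quad.
    rewrite psum_trichotomy with
      (f := fun a b => psum (fun x => psum (fun y => iv (Nat.eqb (a * x + b * y) n) (K a b)) n) n).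
    f_equal. rewrite Rplus_comm. f_equal.
    - apply psum_ext. intros a Ha.
      rewrite (psum_shift (fun b => psum (fun x => psum (fun y =>
         iv (Nat.eqb (a * x + b * y) n) (K a b)) n) n)).
      + apply psum_ext. intros b Hb. apply psum_ext. intros x Hx. apply psum_ext. intros y Hy.
        rewrite <- HK1 by lia. rewrite (Nat.add_comm b a). do 2 f_equal. ring.
      + intros b Hb. do 2 (apply psum_0; intros). unfold iv.
        destruct (Nat.eqb_spec (a * i + b * i0) n); [nia|reflexivity].
    - unfold P'. symmetry. rewrite psum_swap. symmetry. apply psum_ext. intros b Hb.
      rewrite (psum_shift (fun a => psum (fun x => psum (fun y =>
         iv (Nat.eqb (a * x + b * y) n) (K a b)) n) n)).
      + apply psum_ext. intros a Ha. apply psum_ext. intros x Hx. apply psum_ext. intros y Hy.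
        rewrite <- HK2 by lia. do 2 f_equal. ring.
      + intros a Ha. do 2 (apply psum_0; intros). unfold iv.
        destruct (Nat.eqb_spec (a * i + b * i0) n); [nia|reflexivity]. }
  rewrite Hh, HK.
  replace (lam (fun d x => - ((INR x - 1) * K d d)) n)
    with (- lam (fun d x => (INR x - 1) * K d d) n).
  - ring.
  - transitivity ((cst (-1) * lam (fun d x => (INR x - 1) * K d d)%R)%ps n).
    + rewrite cst_mul_coef. ring.
    + rewrite lam_scal. unfold lam. do 2 (apply psum_ext; intros). f_equal. ring.
Qed.

(** By [quad_swap] the sum of T depends only on T a b + T b a, so it is enough that h - K has the
    right symmetrisation. *)
Lemma quad_skoruppa (T h K : nat -> nat -> R) (L : nat -> R) :
  (forall a b, (1 <= a)%nat -> (1 <= b)%nat -> K a (a + b)%nat = h a b) ->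
  (forall a b, (1 <= a)%nat -> (1 <= b)%nat -> K (a + b)%nat b = h a b) ->
  (forall a b, (1 <= a)%nat -> (1 <= b)%nat ->
     T a b + T b a = (h a b - K a b) + (h b a - K b a)) ->
  (forall d, (1 <= d)%nat -> psum (fun a => h a (d - a)%nat) (d - 1) = L d) ->
  quad T = lam (fun d x => L d - (INR x - 1) * K d d).
Proof.
  intros HK1 HK2 HT HL.
  rewrite (lam_ext _ (fun d x => psum (fun a => h a (d - a)%nat) (d - 1) - (INR x - 1) * K d d))
    by (intros; rewrite HL by lia; reflexivity).
  rewrite <- (skoruppa h K HK1 HK2), quad_sub.
  apply (qc_cancel 2); [unfold Q2R; simpl; lra|].
  transitivity (quad T + quad (fun a b => T b a))%ps.
  - rewrite <- quad_swap. ring.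
  - transitivity (quad (fun a b => h a b - K a b)%R + quad (fun a b => h b a - K b a)%R)%ps.
    + rewrite !quad_add. apply quad_ext. exact HT.
    + rewrite <- (quad_swap (fun a b => h a b - K a b)). ring.
Qed.

(** * Products of Eisenstein series *)

(* A quadratic form in (a, b) whose coefficients depend on the residues of a and b mod N. *)
Definition coefs := (Z * Z * Z)%type.
Definition table := list (list coefs).
Definition tget (t : table) (u v : nat) : coefs := nth v (nth u t nil) (0, 0, 0)%Z.
Definition form (c : coefs) (x y : R) : R :=
  let '(c2, c1, c0) := c in IZR c2 * x * x + IZR c1 * x * y + IZR c0 * y * y.

Definition hform (N : nat) (t : table) (a b : nat) : R :=
  form (tget t (a mod N) (b mod N)) (INR a) (INR b).
(** K(a, b) is h(a, b - a), as the first condition of [skoruppa] demands, also for b < a, where the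
    quadratic form is evaluated at a negative argument. The residue of b - a is written with (N - 1)
    a in place of -a because subtraction on nat is truncated. *)
Definition Kform (N : nat) (t : table) (a b : nat) : R :=
  form (tget t (a mod N) ((b + (N - 1) * a) mod N)) (INR a) (INR b - INR a).

Definition below (N : nat) (p : nat -> bool) : bool := forallb p (seq 0 N).

(** The second condition K(a + b, b) = h(a, b) reads h(a + b, -a) = h(a, b), invariance under a
    linear map of order 6. It is compared coefficient by coefficient on each pair of residues. *)
Definition check_rotation (N : nat) (t : table) : bool :=
  below N (fun u => below N (fun v =>
    let '(c2, c1, c0) := tget t u v in
    let '(d2, d1, d0) := tget t ((u + v) mod N) ((v + (N - 1) * (u + v)) mod N) in
    ((d2 - d1 + d0 =? c2) && (2 * d2 - d1 =? c1) && (d2 =? c0))%bool%Z)).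

(** The symmetrisation of h - K is expanded as a quadratic form in a and b: the squares must cancel
    and the mixed coefficient must be that of the symmetrised target. *)
Definition check_target (N : nat) (t : table) (T : nat -> nat -> Z) : bool :=
  below N (fun u => below N (fun v =>
    let '(c2, c1, c0) := tget t u v in
    let '(d2, d1, d0) := tget t v u in
    let '(k2, k1, k0) := tget t u ((v + (N - 1) * u) mod N) in
    let '(l2, l1, l0) := tget t v ((u + (N - 1) * v) mod N) in
    ((c2 - (k2 - k1 + k0) + d0 - l0 =? 0) &&
     (c1 - (k1 - 2 * k0) + d1 - (l1 - 2 * l0) =? T u v + T v u) &&
     (c0 - k0 + d2 - (l2 - l1 + l0) =? 0))%bool%Z)).

Lemma below_spec N p : below N p = true -> forall u, (u < N)%nat -> p u = true.
Proof.
  intros H u Hu. unfold below in H. rewrite forallb_forall in H. apply H.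
  apply in_seq. lia.
Qed.

Lemma mod_lin N c x y : ((x + c * y) mod N = (x mod N + c * (y mod N)) mod N)%nat.
Proof.
  rewrite Nat.Div0.add_mod_idemp_l, <- (Nat.Div0.add_mod_idemp_r x (c * (y mod N))).
  rewrite Nat.Div0.mul_mod_idemp_r, Nat.Div0.add_mod_idemp_r. reflexivity.
Qed.

Lemma hK_left N t a b : (1 <= N)%nat -> Kform N t a (a + b) = hform N t a b.
Proof.
  intros HN. unfold Kform, hform.
  replace (a + b + (N - 1) * a)%nat with (b + a * N)%nat by nia.
  rewrite Nat.Div0.mod_add, plus_INR. f_equal. ring.
Qed.

Lemma hK_right N t a b :
  (1 <= N)%nat -> check_rotation N t = true -> Kform N t (a + b) b = hform N t a b.
Proof.
  intros HN H. unfold Kform, hform.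
  apply below_spec with (u := (a mod N)%nat) in H; [|apply Nat.mod_upper_bound; lia].
  apply below_spec with (u := (b mod N)%nat) in H; [|apply Nat.mod_upper_bound; lia].
  cbv beta in H.
  replace ((a + b) mod N)%nat with ((a mod N + b mod N) mod N)%nat
    by (rewrite <- Nat.Div0.add_mod; reflexivity).
  replace ((b + (N - 1) * (a + b)) mod N)%nat
    with ((b mod N + (N - 1) * (a mod N + b mod N)) mod N)%nat.
  2: { rewrite (mod_lin N (N - 1) b), (mod_lin N (N - 1) (b mod N)), Nat.Div0.mod_mod.
       rewrite <- Nat.Div0.add_mod. reflexivity. }
  destruct (tget t (a mod N) (b mod N)) as [[c2 c1] c0].
  destruct (tget t _ _) as [[d2 d1] d0].
  rewrite !Bool.andb_true_iff, !Z.eqb_eq in H. destruct H as [[<- <-] <-].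
  unfold form. rewrite plus_INR, !plus_IZR, !minus_IZR, mult_IZR. ring.
Qed.

Lemma hK_target N t (T : nat -> nat -> Z) (a b : nat) :
  (1 <= N)%nat -> check_target N t T = true ->
  IZR (T (a mod N)%nat (b mod N)%nat) * INR a * INR b + IZR (T (b mod N)%nat (a mod N)%nat) * INR b * INR a
  = (hform N t a b - Kform N t a b) + (hform N t b a - Kform N t b a).
Proof.
  intros HN H. unfold Kform, hform.
  apply below_spec with (u := (a mod N)%nat) in H; [|apply Nat.mod_upper_bound; lia].
  apply below_spec with (u := (b mod N)%nat) in H; [|apply Nat.mod_upper_bound; lia].
  cbv beta in H.
  rewrite (mod_lin N (N - 1) b a), (mod_lin N (N - 1) a b).
  destruct (tget t (a mod N) (b mod N)) as [[c2 c1] c0].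
  destruct (tget t (b mod N) (a mod N)) as [[d2 d1] d0].
  destruct (tget t (a mod N) _) as [[k2 k1] k0].
  destruct (tget t (b mod N) _) as [[l2 l1] l0].
  rewrite !Bool.andb_true_iff, !Z.eqb_eq in H. destruct H as [[H2 H1] H0].
  apply (f_equal IZR) in H2, H1, H0.
  repeat rewrite ?plus_IZR, ?minus_IZR, ?mult_IZR in H2.
  repeat rewrite ?plus_IZR, ?minus_IZR, ?mult_IZR in H1.
  repeat rewrite ?plus_IZR, ?minus_IZR, ?mult_IZR in H0.
  unfold form.
  assert (IZR (T (a mod N)%nat (b mod N)%nat) * INR a * INR b
          + IZR (T (b mod N)%nat (a mod N)%nat) * INR b * INR a
          = (IZR (T (a mod N)%nat (b mod N)%nat) + IZR (T (b mod N)%nat (a mod N)%nat)) * INR a * INR b)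
    as -> by ring.
  rewrite <- H1.
  assert (X2 : (IZR c2 - (IZR k2 - IZR k1 + IZR k0) + IZR d0 - IZR l0) * INR a * INR a = 0)
    by (rewrite H2; ring).
  assert (X0 : (IZR c0 - IZR k0 + IZR d2 - (IZR l2 - IZR l1 + IZR l0)) * INR b * INR b = 0)
    by (rewrite H0; ring).
  lra.
Qed.

Lemma bsum_quadratic (A B C : R) k :
  bsum (fun j => A + B * INR j + C * INR j * INR j) k
  = A * INR k + B * (INR k * (INR k - 1) / 2) + C * (INR k * (INR k - 1) * (2 * INR k - 1) / 6).
Proof. induction k; [simpl; field|]. rewrite S_INR. simpl bsum. rewrite IHk. field. Qed.

Lemma bsum_blocks (f : nat -> R) N k :
  bsum f (N * k) = bsum (fun j => bsum (fun i => f (N * j + i)%nat) N) k.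
Proof.
  induction k as [|k IH]; [rewrite Nat.mul_0_r; reflexivity|].
  rewrite Nat.mul_succ_r, bsum_add, IH. reflexivity.
Qed.

(* The sum of [hform a (d - a)] over [0 < a < d], for [d = N k + r]: its terms with
   [a = N j + i] are quadratic in [j]. *)
Definition diag_closed (N : nat) (t : table) (r k : nat) : R :=
  let d := INR N * INR k + INR r in
  let g (i : nat) (y : R) := form (tget t i ((r + (N - i)) mod N)) y (d - y) in
  let A := bsum (fun i => g i (INR i)) N in
  let P := bsum (fun i => g i (INR N + INR i)) N in
  let M := bsum (fun i => g i (INR i - INR N)) N in
  A * INR k + (P - M) / 2 * (INR k * (INR k - 1) / 2)
  + ((P + M) / 2 - A) * (INR k * (INR k - 1) * (2 * INR k - 1) / 6)
  + bsum (fun i => g i (INR N * INR k + INR i)) r - g O 0.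

Lemma mod_sub_block N k r j i :
  (1 <= N)%nat -> (i < N)%nat -> (N * j + i <= N * k + r)%nat ->
  ((N * k + r - (N * j + i)) mod N = (r + (N - i)) mod N)%nat.
Proof.
  intros HN Hi Hle.
  assert (E : (N * k + r - (N * j + i) + (S j) * N = r + (N - i) + k * N)%nat) by nia.
  rewrite <- (Nat.Div0.mod_add (N * k + r - (N * j + i)) (S j)), E, Nat.Div0.mod_add.
  reflexivity.
Qed.

Lemma psum_hform N t r k :
  (1 <= N)%nat -> (r < N)%nat -> (1 <= N * k + r)%nat ->
  psum (fun a => hform N t a (N * k + r - a)%nat) (N * k + r - 1) = diag_closed N t r k.
Proof.
  intros HN Hr Hd. set (d := (N * k + r)%nat).
  set (f := fun a => hform N t a (d - a)%nat).
  assert (Hf : psum f (d - 1) = bsum f d - f O).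
  { unfold psum. replace d with (S (d - 1)) at 2 by lia. rewrite bsum_S_l. ring. }
  fold f. rewrite Hf. unfold d at 1. rewrite bsum_add, bsum_blocks.
  set (g := fun (i : nat) (y : R) => form (tget t i ((r + (N - i)) mod N)) y (INR d - y)).
  assert (Hfg : forall j i, (i < N)%nat -> (N * j + i <= d)%nat ->
            f (N * j + i)%nat = g i (INR N * INR j + INR i)).
  { intros j i Hi Hle. unfold f, hform, g.
    rewrite minus_INR by exact Hle. unfold d at 1. rewrite mod_sub_block by assumption.
    rewrite Nat.mul_comm at 1. rewrite Nat.add_comm at 1. rewrite Nat.Div0.mod_add, Nat.mod_small by exact Hi.
    rewrite plus_INR, mult_INR. reflexivity. }
  unfold diag_closed.
  replace (INR N * INR k + INR r) with (INR d) by (unfold d; rewrite plus_INR, mult_INR; reflexivity).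
  fold g.
  set (A := bsum (fun i => g i (INR i)) N).
  set (P := bsum (fun i => g i (INR N + INR i)) N).
  set (M := bsum (fun i => g i (INR i - INR N)) N).
  (* A block sum is quadratic in j, hence determined by its values [A], [P], [M] at j = 0, 1, -1. *)
  rewrite (bsum_ext (fun j => bsum (fun i => f (N * j + i)%nat) N)
             (fun j => A + (P - M) / 2 * INR j + ((P + M) / 2 - A) * INR j * INR j)).
  - rewrite bsum_quadratic. f_equal; [f_equal|].
    + apply bsum_ext. intros i Hi. apply Hfg; unfold d; lia.
    + change (f O) with (f (0 + 0)%nat). replace (0 + 0)%nat with (N * 0 + 0)%nat by lia.
      rewrite Hfg by lia. transitivity (g O 0); [f_equal; simpl; ring|reflexivity].
  - intros j Hj. rewrite (bsum_ext _ (fun i => g i (INR N * INR j + INR i))).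
    2: { intros i Hi. apply Hfg; [exact Hi|]. unfold d. nia. }
    unfold A, P, M.
    transitivity (bsum (fun i => g i (INR i)
        + (g i (INR N + INR i) - g i (INR i - INR N)) * (/ 2 * INR j)
        + (g i (INR N + INR i) + g i (INR i - INR N)) * (/ 2 * INR j * INR j)
        - g i (INR i) * (INR j * INR j)) N).
    + apply bsum_ext. intros i Hi. unfold g, form.
      destruct (tget t i ((r + (N - i)) mod N)) as [[c2 c1] c0]. field.
    + rewrite bsum_minus, !bsum_plus, !bsum_scal_r, bsum_minus, bsum_plus. field.
Qed.

Definition tq (N : nat) (T : nat -> nat -> Z) (a b : nat) : R :=
  IZR (T (a mod N)%nat (b mod N)%nat) * INR a * INR b.

(** The correction contains only the first coefficient of the form because K(d, d) = h(d, 0). *)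
Lemma quad_level (N : nat) (t : table) (T : nat -> nat -> Z) (L : nat -> R) :
  (1 <= N)%nat -> check_rotation N t = true -> check_target N t T = true ->
  (forall r k, (r < N)%nat -> (1 <= N * k + r)%nat -> diag_closed N t r k = L (N * k + r)%nat) ->
  quad (tq N T)
  = lam (fun d x => L d - (INR x - 1) * (IZR (fst (fst (tget t (d mod N) 0))) * INR d * INR d)).
Proof.
  intros HN H1 H2 HL.
  rewrite (quad_skoruppa _ (hform N t) (Kform N t) L).
  - apply lam_ext. intros d x Hd Hx. f_equal. f_equal.
    unfold Kform. replace (d + (N - 1) * d)%nat with (d * N)%nat by nia.
    rewrite Nat.Div0.mod_mul. destruct (tget t (d mod N) 0) as [[c2 c1] c0]. unfold form. simpl. ring.
  - intros; apply hK_left; assumption.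
  - intros; apply hK_right; assumption.
  - intros; apply hK_target; assumption.
  - intros d Hd. rewrite (Nat.div_mod_eq d N) in Hd |- *.
    assert (d mod N < N)%nat by (apply Nat.mod_upper_bound; lia).
    rewrite psum_hform by assumption. apply HL; assumption.
Qed.

(** Each table is a solution of the linear system that [check_rotation] and [check_target] express
    for the product it serves; [vm_compute] verifies it there. *)
Definition table2 : table :=
  [[(0, 0, 0); (1, 1, 0)];
   [(0, -1, 0); (0, 1, 1)]]%Z.
Definition table3 : table :=
  [[(0, 0, 0); (2, 2, 0); (2, 2, 0)];
   [(0, -2, 0); (1, 1, 1); (0, 2, 2)];
   [(0, -2, 0); (0, 2, 2); (1, 1, 1)]]%Z.
Definition table4 : table :=
  [[(0, 0, 0); (3, 3, 0); (4, 4, 0); (3, 3, 0)];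
   [(0, -3, 0); (0, 5, 3); (-2, -5, 0); (0, 3, 3)];
   [(0, -4, 0); (3, 1, -2); (0, 4, 4); (3, 1, -2)];
   [(0, -3, 0); (0, 3, 3); (-2, -5, 0); (0, 5, 3)]]%Z.
Definition table5a : table :=
  [[(0, 0, 0); (12, 17, 5); (-12, -17, -5); (-12, -17, -5); (12, 17, 5)];
   [(5, -7, 0); (0, 18, 12); (0, 18, 6); (-6, -18, 0); (0, 7, 12)];
   [(-5, 7, 0); (6, -6, -12); (-12, -18, 0); (0, -7, -12); (12, 6, -6)];
   [(-5, 7, 0); (12, 6, -6); (0, -7, -12); (-12, -18, 0); (6, -6, -12)];
   [(5, -7, 0); (0, 7, 12); (-6, -18, 0); (0, 18, 6); (0, 18, 12)]]%Z.
Definition table5b : table :=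
  [[(0, 0, 0); (4, 4, 0); (4, 4, 0); (4, 4, 0); (4, 4, 0)];
   [(0, -4, 0); (0, 2, 4); (0, -2, 2); (2, -2, 0); (0, 4, 4)];
   [(0, -4, 0); (2, 6, 4); (4, 2, 0); (0, 4, 4); (4, 6, 2)];
   [(0, -4, 0); (4, 6, 2); (0, 4, 4); (4, 2, 0); (2, 6, 4)];
   [(0, -4, 0); (0, 4, 4); (2, -2, 0); (0, -2, 2); (0, 2, 4)]]%Z.

(** * Eisenstein series of level 1 and Ramanujan's differential equations *)

Definition sig (k : nat) : ps := lam (fun d _ => INR d ^ k).
Definition eis2 : ps := (qc 1 - qc 24 * sig 1)%ps.
Definition eis4 : ps := (qc 1 + qc 240 * sig 3)%ps.
Definition eis6 : ps := (qc 1 - qc 504 * sig 5)%ps.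

Lemma lam_sub f g : (lam f - lam g)%ps = lam (fun d x => f d x - g d x).
Proof.
  transitivity (lam f + cst (-1) * lam g)%ps.
  - apply ps_ext. intros n. unfold psub, padd. rewrite cst_mul_coef. ring.
  - rewrite lam_scal, lam_add. apply lam_ext. intros. ring.
Qed.

(** Faulhaber's formulas up to degree 6, the degree of h in [sig1_sig5]. *)
Lemma bsum_power6 (c0 c1 c2 c3 c4 c5 c6 : R) n :
  bsum (fun i => c0 + c1 * INR i + c2 * INR i ^ 2 + c3 * INR i ^ 3 + c4 * INR i ^ 4
                 + c5 * INR i ^ 5 + c6 * INR i ^ 6) n
  = let x := INR n in
    c0 * x + c1 * (x ^ 2 / 2 - x / 2) + c2 * (x ^ 3 / 3 - x ^ 2 / 2 + x / 6)
    + c3 * (x ^ 4 / 4 - x ^ 3 / 2 + x ^ 2 / 4)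
    + c4 * (x ^ 5 / 5 - x ^ 4 / 2 + x ^ 3 / 3 - x / 30)
    + c5 * (x ^ 6 / 6 - x ^ 5 / 2 + 5 * x ^ 4 / 12 - x ^ 2 / 12)
    + c6 * (x ^ 7 / 7 - x ^ 6 / 2 + x ^ 5 / 2 - x ^ 3 / 6 + x / 42).
Proof. cbv zeta. induction n; [simpl; field|]. rewrite bsum_S, IHn, S_INR. field. Qed.

Lemma psum_power6 (h : nat -> R) (c0 c1 c2 c3 c4 c5 c6 : R) d :
  (1 <= d)%nat ->
  (forall a, (a <= d)%nat -> h a =
     c0 + c1 * INR a + c2 * INR a ^ 2 + c3 * INR a ^ 3 + c4 * INR a ^ 4
     + c5 * INR a ^ 5 + c6 * INR a ^ 6) ->
  psum h (d - 1)
  = let x := INR d in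
    c0 * (x - 1) + c1 * (x ^ 2 / 2 - x / 2) + c2 * (x ^ 3 / 3 - x ^ 2 / 2 + x / 6)
    + c3 * (x ^ 4 / 4 - x ^ 3 / 2 + x ^ 2 / 4)
    + c4 * (x ^ 5 / 5 - x ^ 4 / 2 + x ^ 3 / 3 - x / 30)
    + c5 * (x ^ 6 / 6 - x ^ 5 / 2 + 5 * x ^ 4 / 12 - x ^ 2 / 12)
    + c6 * (x ^ 7 / 7 - x ^ 6 / 2 + x ^ 5 / 2 - x ^ 3 / 6 + x / 42).
Proof.
  intros Hd Hh.
  transitivity (bsum h d - h O).
  { destruct d as [|m]; [lia|]. rewrite bsum_S_l.
    replace (S m - 1)%nat with m by lia. unfold psum. ring. }
  rewrite Hh by lia.
  rewrite (bsum_ext h (fun i => c0 + c1 * INR i + c2 * INR i ^ 2 + c3 * INR i ^ 3 + c4 * INR i ^ 4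
                 + c5 * INR i ^ 5 + c6 * INR i ^ 6)) by (intros; apply Hh; lia).
  rewrite bsum_power6. cbv zeta. simpl. ring.
Qed.

Ltac q2r := unfold Q2R; cbn [Qnum Qden].
Ltac to_lam :=
  unfold qc; repeat (rewrite lam_dq || rewrite lam_scal || rewrite lam_add || rewrite lam_sub).

(** The form a^2 + a b + b^2 is invariant under (a, b) -> (a + b, -a), so half of it is an
    admissible h, and then h - K = a b. The terms in d^2 combine with x - 1 into the derivative of
    [sig 1]. *)
Lemma sig1_sig1 : (sig 1 * sig 1 =
  qc (5#12) * sig 3 + qc (1#12) * sig 1 - qc (1#2) * dq (sig 1))%ps.
Proof.
  unfold sig. rewrite lam_mul.
  rewrite (quad_skoruppa _
    (fun a b => (INR a ^ 2 + INR a * INR b + INR b ^ 2) / 2)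
    (fun a b => (INR a ^ 2 - INR a * INR b + INR b ^ 2) / 2)
    (fun d => 5 / 12 * INR d ^ 3 + INR d / 12 - INR d ^ 2 / 2)).
  - to_lam. apply lam_ext. intros. q2r. field.
  - intros. rewrite plus_INR. field.
  - intros. rewrite plus_INR. field.
  - intros. field.
  - intros d Hd. rewrite (psum_power6 _ (INR d ^ 2 / 2) (- INR d / 2) (1 / 2) 0 0 0 0).
    + cbv zeta. field.
    + exact Hd.
    + intros a Ha. rewrite minus_INR by exact Ha. field.
Qed.

(** The square of the same invariant form gives h - K = (a^3 b + a b^3) / 2. *)
Lemma sig1_sig3 : (sig 1 * sig 3 =
  qc (7#80) * sig 5 + qc (1#24) * sig 3 - qc (1#240) * sig 1 - qc (1#8) * dq (sig 3))%ps.
Proof.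
  unfold sig. rewrite lam_mul.
  rewrite (quad_skoruppa _
    (fun a b => (INR a ^ 2 + INR a * INR b + INR b ^ 2) ^ 2 / 8)
    (fun a b => (INR a ^ 2 - INR a * INR b + INR b ^ 2) ^ 2 / 8)
    (fun d => 7 / 80 * INR d ^ 5 + INR d ^ 3 / 24 - INR d / 240 - INR d ^ 4 / 8)).
  - to_lam. apply lam_ext. intros. q2r. field.
  - intros. rewrite plus_INR. field.
  - intros. rewrite plus_INR. field.
  - intros. field.
  - intros d Hd. rewrite (psum_power6 _ (INR d ^ 4 / 8) (- 2 * INR d ^ 3 / 8) (3 * INR d ^ 2 / 8)
       (- 2 * INR d / 8) (1 / 8) 0 0).
    + cbv zeta. field.
    + exact Hd.
    + intros a Ha. rewrite minus_INR by exact Ha. field.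
Qed.

(** In degree 6 both (a^2 + a b + b^2)^3 and (a b (a + b))^2 are invariant. The multiples 21 and
    -747/2 give h - K = 126 (a^5 b + a b^5) - 1200 a^3 b^3, and the terms d^7 cancel in the diagonal
    sum, so that no sigma_7 appears. This is the combination needed in [ramanujan6]. *)
Lemma sig1_sig5 : (qc 252 * (sig 1 * sig 5) - qc 1200 * (sig 3 * sig 3) =
  qc (21#2) * sig 5 + qc 10 * sig 3 + qc (1#2) * sig 1 - qc 21 * dq (sig 5))%ps.
Proof.
  unfold sig. rewrite !lam_mul. unfold qc at 1 2. rewrite !quad_scal, quad_sub.
  rewrite (quad_skoruppa _
    (fun a b => 21 * (INR a ^ 2 + INR a * INR b + INR b ^ 2) ^ 3
                - 747 / 2 * (INR a * INR b * (INR a + INR b)) ^ 2)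
    (fun a b => 21 * (INR a ^ 2 - INR a * INR b + INR b ^ 2) ^ 3
                - 747 / 2 * (INR a * INR b * (INR a - INR b)) ^ 2)
    (fun d => 21 / 2 * INR d ^ 5 + 10 * INR d ^ 3 + INR d / 2 - 21 * INR d ^ 6)).
  - to_lam. apply lam_ext. intros. q2r. field.
  - intros. rewrite plus_INR. field.
  - intros. rewrite plus_INR. field.
  - intros. q2r. field.
  - intros d Hd. rewrite (psum_power6 _ (21 * INR d ^ 6) (- 63 * INR d ^ 5)
       (126 * INR d ^ 4 - 747 / 2 * INR d ^ 4) (- 147 * INR d ^ 3 + 747 * INR d ^ 3)
       (126 * INR d ^ 2 - 747 / 2 * INR d ^ 2) (- 63 * INR d) 21).
    + cbv zeta. field.
    + exact Hd.
    + intros a Ha. rewrite minus_INR by exact Ha. field.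
Qed.

Ltac dq_simpl := repeat rewrite ?dq_add, ?dq_sub, ?dq_opp, ?dq_mul, ?dq_qc, ?dq_cst.

Theorem ramanujan2 : dq eis2 = (qc (1#12) * (eis2 * eis2 - eis4))%ps.
Proof.
  unfold eis2, eis4. dq_simpl.
  transitivity (qc (1#12) * (qc (-48) * sig 1 + qc 576 * (sig 1 * sig 1) - qc 240 * sig 3))%ps; [|ring].
  rewrite sig1_sig1. ring.
Qed.

Theorem ramanujan4 : dq eis4 = (qc (1#3) * (eis2 * eis4 - eis6))%ps.
Proof.
  unfold eis2, eis4, eis6. dq_simpl.
  transitivity (qc (1#3) * (qc (-24) * sig 1 + qc 240 * sig 3 - qc 5760 * (sig 1 * sig 3)
                + qc 504 * sig 5))%ps; [|ring].
  rewrite sig1_sig3. ring.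
Qed.

Theorem ramanujan6 : dq eis6 = (qc (1#2) * (eis2 * eis6 - eis4 * eis4))%ps.
Proof.
  unfold eis2, eis4, eis6. dq_simpl.
  transitivity (qc (1#2) * (qc 48 * (qc 252 * (sig 1 * sig 5) - qc 1200 * (sig 3 * sig 3))
     - qc 24 * sig 1 - qc 504 * sig 5 - qc 480 * sig 3))%ps; [|ring].
  rewrite sig1_sig5. ring.
Qed.

(* [vps N a] is a(q^N). *)
Definition vps (N : nat) (a : ps) : ps :=
  fun n => iv (Nat.eqb (n mod N) 0) (a (n / N)%nat).

Lemma vps_mult N (a : ps) k : (1 <= N)%nat -> vps N a (N * k)%nat = a k.
Proof.
  intros HN. unfold vps. rewrite Nat.mul_comm, Nat.Div0.mod_mul, Nat.div_mul by lia. reflexivity.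
Qed.
Lemma vps_other N (a : ps) n : (n mod N <> 0)%nat -> vps N a n = 0.
Proof. intros H. unfold vps. apply Nat.eqb_neq in H. rewrite H. reflexivity. Qed.

Lemma mod_cases N n : (1 <= N)%nat -> (n mod N <> 0)%nat \/ exists k, n = (N * k)%nat.
Proof.
  intros HN. destruct (Nat.eq_dec (n mod N) 0) as [H|H]; [right|left; exact H].
  exists (n / N)%nat. rewrite (Nat.div_mod_eq n N) at 1. lia.
Qed.

Lemma vps_add N a b : vps N (a + b) = (vps N a + vps N b)%ps.
Proof. apply ps_ext. intros n. unfold vps, padd, iv. destruct (Nat.eqb _ _); ring. Qed.
Lemma vps_sub N a b : vps N (a - b) = (vps N a - vps N b)%ps.
Proof. apply ps_ext. intros n. unfold vps, psub, iv. destruct (Nat.eqb _ _); ring. Qed.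
Lemma vps_cst N c : (1 <= N)%nat -> vps N (cst c) = cst c.
Proof.
  intros HN. apply ps_ext. intros n. destruct (mod_cases N n HN) as [H|[k ->]].
  - rewrite vps_other by exact H. destruct n; [rewrite Nat.Div0.mod_0_l in H; lia|reflexivity].
  - rewrite vps_mult by exact HN. destruct k; [rewrite Nat.mul_0_r; reflexivity|].
    replace (N * S k)%nat with (S (N * S k - 1)) by lia. reflexivity.
Qed.
Lemma vps_qc N c : (1 <= N)%nat -> vps N (qc c) = qc c.
Proof. apply vps_cst. Qed.
Lemma vps_dq N a : (1 <= N)%nat -> dq (vps N a) = (cst (INR N) * vps N (dq a))%ps.
Proof.
  intros HN. apply ps_ext. intros n. rewrite cst_mul_coef. unfold dq.
  destruct (mod_cases N n HN) as [H|[k ->]].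
  - rewrite !vps_other by exact H. ring.
  - rewrite !vps_mult by exact HN. rewrite mult_INR. ring.
Qed.

Lemma bsum_multiples N (f : nat -> R) m :
  (1 <= N)%nat -> (forall i, (i mod N <> 0)%nat -> f i = 0) ->
  bsum f (S (N * m)) = bsum (fun j => f (N * j)%nat) (S m).
Proof.
  intros HN Hf.
  rewrite (bsum_S f), (bsum_S (fun j => f (N * j)%nat)), bsum_blocks. f_equal.
  apply bsum_ext. intros j Hj. rewrite (bsum_single _ _ O); [|lia|].
  - rewrite Nat.add_0_r. reflexivity.
  - intros i Hi Hne. apply Hf.
    rewrite Nat.add_comm, Nat.mul_comm, Nat.Div0.mod_add, Nat.mod_small; lia.
Qed.

Lemma vps_mul N a b : (1 <= N)%nat -> vps N (a * b) = (vps N a * vps N b)%ps.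
Proof.
  intros HN. apply ps_ext. intros n. unfold pmul at 2.
  destruct (mod_cases N n HN) as [H|[m ->]].
  - rewrite vps_other by exact H. symmetry. apply bsum_0. intros k Hk.
    destruct (mod_cases N k HN) as [Hk0|[j ->]]; [rewrite vps_other by exact Hk0; ring|].
    rewrite (vps_other N b); [ring|].
    intros E. apply H. replace n with (n - N * j + j * N)%nat by nia.
    rewrite Nat.Div0.mod_add. exact E.
  - rewrite vps_mult by exact HN. rewrite bsum_multiples; [|exact HN|].
    + unfold pmul. apply bsum_ext. intros j Hj.
      replace (N * m - N * j)%nat with (N * (m - j))%nat by nia.
      rewrite !vps_mult by exact HN. reflexivity.
    + intros i Hi. rewrite vps_other by exact Hi. ring.
Qed.

Lemma psum_multiples N (f : nat -> R) m :
  (1 <= N)%nat -> (forall i, (i mod N <> 0)%nat -> f i = 0) ->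
  psum f (N * m) = psum (fun j => f (N * j)%nat) m.
Proof.
  intros HN Hf.
  pose proof (bsum_multiples N f m HN Hf) as H. rewrite !bsum_S_l in H.
  rewrite Nat.mul_0_r in H. apply Rplus_eq_reg_l in H. exact H.
Qed.

Lemma vps_lam N (f : nat -> R) :
  (1 <= N)%nat ->
  vps N (lam (fun d _ => f d)) = lam (fun d _ => iv (Nat.eqb (d mod N) 0) (f (d / N)%nat)).
Proof.
  intros HN. apply ps_ext. intros n. destruct (mod_cases N n HN) as [H|[m ->]].
  - rewrite vps_other by exact H. symmetry. apply psum_0. intros d Hd. apply psum_0. intros x Hx.
    unfold iv. destruct (Nat.eqb_spec (d * x) n) as [E|]; [|reflexivity].
    destruct (mod_cases N d HN) as [Hd0|[j ->]].
    + apply Nat.eqb_neq in Hd0. rewrite Hd0. reflexivity.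
    + exfalso. apply H. rewrite <- E. replace (N * j * x)%nat with (j * x * N)%nat by ring.
      apply Nat.Div0.mod_mul.
  - rewrite vps_mult by exact HN. unfold lam. rewrite psum_multiples; [|exact HN|].
    + apply psum_ext. intros j Hj.
      rewrite (psum_widen _ m (N * m)); [|nia|].
      * apply psum_ext. intros x Hx.
        rewrite (Nat.mul_comm N j), Nat.Div0.mod_mul, Nat.div_mul by lia.
        rewrite (Nat.mul_comm N m).
        replace (j * N * x)%nat with (j * x * N)%nat by ring.
        replace (Nat.eqb (j * x * N) (m * N)) with (Nat.eqb (j * x) m).
        -- reflexivity.
        -- destruct (Nat.eqb_spec (j * x) m), (Nat.eqb_spec (j * x * N) (m * N)) as [E|E];
             try reflexivity; exfalso; [subst; auto|apply Nat.mul_cancel_r in E; lia].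
      * intros x Hx. unfold iv. destruct (Nat.eqb_spec (N * j * x) (N * m)) as [E|]; [|reflexivity].
        exfalso. rewrite <- Nat.mul_assoc in E. apply Nat.mul_cancel_l in E; nia.
    + intros i Hi. apply psum_0. intros x Hx. apply Nat.eqb_neq in Hi. rewrite Hi.
      unfold iv. destruct (Nat.eqb (i * x) _); reflexivity.
Qed.

(** * Products of weight 2 Eisenstein series of levels 2 to 5 *)

Definition sigN (N k : nat) : ps := lam (fun d _ => iv (Nat.eqb (d mod N) 0) ((INR d / INR N) ^ k)).

Lemma vps_sig N k : (1 <= N)%nat -> vps N (sig k) = sigN N k.
Proof.
  intros HN. unfold sig. rewrite vps_lam by exact HN. apply lam_ext. intros d x Hd Hx.
  destruct (mod_cases N d HN) as [H|[j ->]].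
  - apply Nat.eqb_neq in H. rewrite H. reflexivity.
  - rewrite Nat.mul_comm, Nat.Div0.mod_mul, Nat.div_mul by lia.
    unfold iv. rewrite Nat.eqb_refl, mult_INR. do 2 f_equal. field. apply not_0_INR; lia.
Qed.

Definition sigw (N : nat) (w : nat -> Z) : ps := lam (fun d _ => IZR (w (d mod N)%nat) * INR d).

Lemma sigw_mul N w w' : (sigw N w * sigw N w')%ps = quad (tq N (fun u v => w u * w' v)%Z).
Proof.
  unfold sigw. rewrite lam_mul. apply quad_ext. intros. unfold tq. rewrite mult_IZR. ring.
Qed.
Lemma tq_scal N z T : (qc (inject_Z z) * quad (tq N T))%ps = quad (tq N (fun u v => z * T u v)%Z).
Proof.
  unfold qc. rewrite quad_scal. apply quad_ext. intros. unfold tq, Q2R, inject_Z. simpl.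
  rewrite mult_IZR. field.
Qed.
Lemma tq_add N T U : (quad (tq N T) + quad (tq N U))%ps = quad (tq N (fun u v => T u v + U u v)%Z).
Proof.
  rewrite quad_add. apply quad_ext. intros. unfold tq. rewrite plus_IZR. ring.
Qed.

Definition unit_w (u : nat) : Z := if Nat.eqb u 0 then 0 else 1.
Definition two_w (u : nat) : Z := if Nat.eqb u 2 then 1 else 0.
(** The Legendre symbol modulo 5. *)
Definition chi5 (u : nat) : Z := nth u [0; 1; -1; -1; 1]%Z 0%Z.

Ltac by_residue r :=
  repeat (destruct r as [|r]; [|try (exfalso; lia)]).

Ltac residues :=
  repeat match goal with
  | |- context [((?N * ?k + ?r) mod ?N)%nat] =>
      rewrite (Nat.add_comm (N * k) r), (Nat.mul_comm N k), (Nat.Div0.mod_add r k N),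
              (Nat.mod_small r N) by lia
  end.

Ltac case_mod d N :=
  let H := fresh in
  assert (H : (d mod N < N)%nat) by (apply Nat.mod_upper_bound; lia);
  let r := fresh "r" in
  revert H; generalize (d mod N)%nat; intros r H; by_residue r.

Definition one_w (u : nat) : Z := 1%Z.
Definition odd_w (u : nat) : Z := Z.of_nat (u mod 2).

Lemma sigw_one N : sigw N one_w = sig 1.
Proof. apply lam_ext. intros. unfold one_w. ring. Qed.

Ltac eval_w := simpl; unfold form, iv, unit_w, two_w, one_w, odd_w, chi5; simpl.
Ltac level_lam d N :=
  unfold sig, sigN, sigw; to_lam; apply lam_ext; intros d ? _ _; q2r; case_mod d N; eval_w; field.
Ltac level_diag :=
  let r := fresh "r" in let k := fresh "k" in
  intros r k ? ?; by_residue r; residues; unfold diag_closed; rewrite plus_INR, mult_INR; eval_w; field.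

(** The factor 2 introduced at the start, like 3 and 8 at levels 3 and 4, makes the entries of the
    table integers. *)
Lemma level2_product :
  (sigw 2 unit_w * sigw 2 unit_w
   = qc (1#12) * sig 3 + qc (1#3) * sigN 2 3 - qc (1#12) * sigw 2 unit_w)%ps.
Proof.
  apply (qc_cancel (inject_Z 2)); [q2r; simpl; lra|].
  rewrite sigw_mul at 1. rewrite tq_scal.
  rewrite (quad_level 2 table2 _
    (fun d => INR d ^ 3 / 6 + 2 / 3 * iv (Nat.eqb (d mod 2) 0) ((INR d / INR 2) ^ 3)
              - IZR (unit_w (d mod 2)) * INR d / 6));
    [level_lam d 2%nat | lia | vm_compute; reflexivity | vm_compute; reflexivity | level_diag].
Qed.

Lemma level3_product :
  (sigw 3 unit_w * sigw 3 unit_w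
   = qc (1#6) * sig 3 + qc (3#2) * sigN 3 3 - qc (1#6) * sigw 3 unit_w)%ps.
Proof.
  apply (qc_cancel (inject_Z 3)); [q2r; simpl; lra|].
  rewrite sigw_mul at 1. rewrite tq_scal.
  rewrite (quad_level 3 table3 _
    (fun d => INR d ^ 3 / 2 + 9 / 2 * iv (Nat.eqb (d mod 3) 0) ((INR d / INR 3) ^ 3)
              - IZR (unit_w (d mod 3)) * INR d / 2));
    [level_lam d 3%nat | lia | vm_compute; reflexivity | vm_compute; reflexivity | level_diag].
Qed.

Lemma level4_product :
  (sigw 4 two_w * sigw 4 two_w - sigw 4 odd_w * sigw 4 two_w + sigw 4 odd_w * sigw 4 odd_w
   = qc (5#4) * sigN 2 3 - qc (1#8) * sigw 4 two_w)%ps.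
Proof.
  apply (qc_cancel (inject_Z 8)); [q2r; simpl; lra|].
  transitivity (qc (inject_Z 8) * (sigw 4 two_w * sigw 4 two_w)
    + qc (inject_Z (-8)) * (sigw 4 odd_w * sigw 4 two_w)
    + qc (inject_Z 8) * (sigw 4 odd_w * sigw 4 odd_w))%ps; [unfold inject_Z; ring|].
  rewrite !sigw_mul, !tq_scal, !tq_add.
  rewrite (quad_level 4 table4 _
    (fun d => 10 * iv (Nat.eqb (d mod 2) 0) ((INR d / INR 2) ^ 3)
              - IZR (two_w (d mod 4)) * INR d)).
  - unfold sig, sigN, sigw; to_lam; apply lam_ext; intros d ? _ _; q2r.
    replace (d mod 2)%nat with ((d mod 4) mod 2)%nat.
    + case_mod d 4%nat; eval_w; field.
    + rewrite (Nat.div_mod_eq d 4) at 2.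
      replace (4 * (d / 4) + d mod 4)%nat with (d mod 4 + 2 * (d / 4) * 2)%nat by lia.
      rewrite Nat.Div0.mod_add. reflexivity.
  - lia.
  - vm_compute; reflexivity.
  - vm_compute; reflexivity.
  - intros r k Hr Hd.
    replace ((4 * k + r) mod 2)%nat with (r mod 2)%nat.
    + by_residue r; residues; unfold diag_closed; rewrite plus_INR, mult_INR; eval_w; field.
    + replace (4 * k + r)%nat with (r + 2 * k * 2)%nat by lia.
      rewrite Nat.Div0.mod_add. reflexivity.
Qed.

(** This is the formula [dq_L5] written with divisor sums. The term -5 chi5(d) d^2 of the diagonal
    sum completes the factor x - 1 of the correction to x, which yields the derivative. *)
Lemma level5_product_chi :
  (qc 20 * (sigw 5 chi5 * sig 1) + qc 5 * (sigw 5 chi5 * sigw 5 unit_w)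
   = qc 4 * sig 1 + sigw 5 unit_w - qc 5 * dq (sigw 5 chi5))%ps.
Proof.
  rewrite <- (sigw_one 5) at 1.
  transitivity (qc (inject_Z 20) * (sigw 5 chi5 * sigw 5 one_w)
    + qc (inject_Z 5) * (sigw 5 chi5 * sigw 5 unit_w))%ps; [unfold inject_Z; ring|].
  rewrite !sigw_mul, !tq_scal, !tq_add.
  rewrite (quad_level 5 table5a _
    (fun d => 4 * INR d + IZR (unit_w (d mod 5)) * INR d
              - 5 * IZR (chi5 (d mod 5)) * INR d * INR d));
    [level_lam d 5%nat | lia | vm_compute; reflexivity | vm_compute; reflexivity | level_diag].
Qed.

Lemma level5_product :
  (sigw 5 chi5 * sigw 5 chi5 + qc 5 * (sigw 5 unit_w * sigw 5 unit_w)
   = qc (2#5) * sigw 5 chi5 - qc (5#3) * sigw 5 unit_w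
     + qc (19#15) * sig 3 + qc (125#3) * sigN 5 3)%ps.
Proof.
  transitivity (quad (tq 5 (fun u v => chi5 u * chi5 v)%Z)
    + qc (inject_Z 5) * (sigw 5 unit_w * sigw 5 unit_w))%ps; [rewrite <- sigw_mul; unfold inject_Z; ring|].
  rewrite !sigw_mul, !tq_scal, !tq_add.
  rewrite (quad_level 5 table5b _
    (fun d => 2 / 5 * IZR (chi5 (d mod 5)) * INR d - 5 / 3 * IZR (unit_w (d mod 5)) * INR d
              + 19 / 15 * INR d ^ 3
              + 125 / 3 * iv (Nat.eqb (d mod 5) 0) ((INR d / INR 5) ^ 3)));
    [level_lam d 5%nat | lia | vm_compute; reflexivity | vm_compute; reflexivity | level_diag].
Qed.

(** * Integrality and eta products *)

Definition isZ (x : R) : Prop := exists z : Z, x = IZR z.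
Definition zps (a : ps) : Prop := forall n, isZ (a n).
Definition bdd (a : ps) : Prop :=
  exists N : Z, N <> 0%Z /\ forall n, isZ (IZR N * a n).

Lemma isZ_IZR z : isZ (IZR z).
Proof. exists z. reflexivity. Qed.
Lemma isZ_INR n : isZ (INR n).
Proof. exists (Z.of_nat n). apply INR_IZR_INZ. Qed.
Lemma isZ_add x y : isZ x -> isZ y -> isZ (x + y).
Proof. intros [a ->] [b ->]. exists (a + b)%Z. rewrite plus_IZR. reflexivity. Qed.
Lemma isZ_sub x y : isZ x -> isZ y -> isZ (x - y).
Proof. intros [a ->] [b ->]. exists (a - b)%Z. rewrite minus_IZR. reflexivity. Qed.
Lemma isZ_mul x y : isZ x -> isZ y -> isZ (x * y).
Proof. intros [a ->] [b ->]. exists (a * b)%Z. rewrite mult_IZR. reflexivity. Qed.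
Lemma isZ_pow x n : isZ x -> isZ (x ^ n).
Proof. intros Hx. induction n; simpl; [apply (isZ_IZR 1)|apply isZ_mul; assumption]. Qed.
Lemma isZ_bsum f n : (forall i, (i < n)%nat -> isZ (f i)) -> isZ (bsum f n).
Proof.
  induction n as [|n IH]; intros H; simpl; [apply (isZ_IZR 0)|].
  apply isZ_add; [apply IH; intros; apply H; lia|apply H; lia].
Qed.
Lemma isZ_psum f n : (forall i, isZ (f i)) -> isZ (psum f n).
Proof. intros H. apply isZ_bsum. intros; apply H. Qed.

Lemma zps_add a b : zps a -> zps b -> zps (a + b)%ps.
Proof. intros Ha Hb n. apply isZ_add; auto. Qed.
Lemma zps_sub a b : zps a -> zps b -> zps (a - b)%ps.
Proof. intros Ha Hb n. apply isZ_sub; auto. Qed.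
Lemma zps_mul a b : zps a -> zps b -> zps (a * b)%ps.
Proof. intros Ha Hb n. apply isZ_bsum. intros; apply isZ_mul; auto. Qed.
Lemma zps_qc (z : Z) : zps (qc (inject_Z z)).
Proof.
  intros [|n]; [exists z|exists 0%Z; reflexivity].
  unfold qc, cst, Q2R, inject_Z. simpl. field.
Qed.
Lemma zps_ppow a n : zps a -> zps (ppow a n).
Proof. intros Ha. induction n; simpl; [apply (zps_qc 1)|apply zps_mul; assumption]. Qed.
Lemma zps_vps N a : zps a -> zps (vps N a).
Proof. intros Ha n. unfold vps, iv. destruct (Nat.eqb _ _); [apply Ha|apply (isZ_IZR 0)]. Qed.
Lemma zps_lam f : (forall d x, isZ (f d x)) -> zps (lam f).
Proof.
  intros H n. apply isZ_psum. intros d. apply isZ_psum. intros x.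
  unfold iv. destruct (Nat.eqb _ _); [apply H|apply (isZ_IZR 0)].
Qed.
Lemma zps_sig k : zps (sig k).
Proof. apply zps_lam. intros. apply isZ_pow, isZ_INR. Qed.
Lemma zps_eis2 : zps eis2.
Proof. apply zps_sub; [apply (zps_qc 1)|apply zps_mul; [apply (zps_qc 24)|apply zps_sig]]. Qed.
Lemma zps_eis4 : zps eis4.
Proof. apply zps_add; [apply (zps_qc 1)|apply zps_mul; [apply (zps_qc 240)|apply zps_sig]]. Qed.
Lemma zps_eis6 : zps eis6.
Proof. apply zps_sub; [apply (zps_qc 1)|apply zps_mul; [apply (zps_qc 504)|apply zps_sig]]. Qed.

Lemma zps_bdd a : zps a -> bdd a.
Proof. intros H. exists 1%Z. split; [lia|]. intros n. rewrite Rmult_1_l. apply H. Qed.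
Lemma bdd_mul a b : bdd a -> bdd b -> bdd (a * b)%ps.
Proof.
  intros [N [HN Ha]] [M [HM Hb]]. exists (N * M)%Z. split; [lia|]. intros n.
  unfold pmul. rewrite <- bsum_scal. apply isZ_bsum. intros k Hk.
  replace (IZR (N * M) * (a k * b (n - k)%nat)) with ((IZR N * a k) * (IZR M * b (n - k)%nat))
    by (rewrite mult_IZR; ring).
  apply isZ_mul; auto.
Qed.
Lemma bdd_add a b : bdd a -> bdd b -> bdd (a + b)%ps.
Proof.
  intros [N [HN Ha]] [M [HM Hb]]. exists (N * M)%Z. split; [lia|]. intros n. unfold padd.
  replace (IZR (N * M) * (a n + b n)) with (IZR M * (IZR N * a n) + IZR N * (IZR M * b n))
    by (rewrite mult_IZR; ring).
  apply isZ_add; apply isZ_mul; auto using isZ_IZR.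
Qed.
Lemma bdd_sub a b : bdd a -> bdd b -> bdd (a - b)%ps.
Proof.
  intros [N [HN Ha]] [M [HM Hb]]. exists (N * M)%Z. split; [lia|]. intros n. unfold psub.
  replace (IZR (N * M) * (a n - b n)) with (IZR M * (IZR N * a n) - IZR N * (IZR M * b n))
    by (rewrite mult_IZR; ring).
  apply isZ_sub; apply isZ_mul; auto using isZ_IZR.
Qed.
Lemma bdd_dq a : bdd a -> bdd (dq a).
Proof.
  intros [N [HN Ha]]. exists N. split; [exact HN|]. intros n. unfold dq.
  replace (IZR N * (INR n * a n)) with (INR n * (IZR N * a n)) by ring.
  apply isZ_mul; [apply isZ_INR|apply Ha].
Qed.
Definition isQ (x : R) : Prop := exists N z : Z, N <> 0%Z /\ IZR N * x = IZR z.
Lemma bdd_cst x : isQ x -> bdd (cst x).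
Proof.
  intros [N [z [HN H]]]. exists N. split; [exact HN|]. intros [|n]; simpl.
  - exists z. exact H.
  - rewrite Rmult_0_r. apply (isZ_IZR 0).
Qed.
Lemma isQ_Q2R x : isQ (Q2R x).
Proof.
  exists (Zpos (Qden x)), (Qnum x). split; [lia|]. unfold Q2R. field.
  apply not_0_IZR. lia.
Qed.
Lemma isQ_eq x : isQ x <-> exists y : Q, x = Q2R y.
Proof.
  split; [|intros [y ->]; apply isQ_Q2R].
  intros [N [z [HN H]]]. exists (inject_Z z / inject_Z N)%Q.
  rewrite Q2R_div.
  - unfold Q2R. simpl. rewrite <- H. field. apply not_0_IZR. exact HN.
  - unfold Qeq, inject_Z. simpl. lia.
Qed.
Lemma isQ_add x y : isQ x -> isQ y -> isQ (x + y).
Proof. rewrite !isQ_eq. intros [a ->] [b ->]. exists (a + b)%Q. symmetry. apply Q2R_plus. Qed.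
Lemma isQ_sub x y : isQ x -> isQ y -> isQ (x - y).
Proof. rewrite !isQ_eq. intros [a ->] [b ->]. exists (a - b)%Q. symmetry. apply Q2R_minus. Qed.
Lemma isQ_mul x y : isQ x -> isQ y -> isQ (x * y).
Proof. rewrite !isQ_eq. intros [a ->] [b ->]. exists (a * b)%Q. symmetry. apply Q2R_mult. Qed.
Lemma isQ_inv x : isQ x -> isQ (/ x).
Proof.
  rewrite !isQ_eq. intros [a ->]. destruct (Qeq_dec a 0) as [E|E].
  - exists 0%Q. apply Qeq_eqR in E. rewrite E. unfold Q2R. simpl. rewrite Rmult_0_l, Rinv_0. reflexivity.
  - exists (/ a)%Q. symmetry. apply Q2R_inv. exact E.
Qed.
Lemma isQ_IZR z : isQ (IZR z).
Proof. exists 1%Z, z. split; [lia|]. ring. Qed.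
Lemma isQ_div x y : isQ x -> isQ y -> isQ (x / y).
Proof. intros. apply isQ_mul; [assumption|apply isQ_inv; assumption]. Qed.

(** * Eta products as formal power series, through congruences modulo q^m *)

Definition agree (m : nat) (a b : ps) : Prop := forall k, (k < m)%nat -> a k = b k.
Lemma agree_mul_one m a b : agree m b (qc 1) -> agree m (a * b) a.
Proof.
  intros H k Hk. rewrite (pmul_ext_low a a b (qc 1)); [|reflexivity|intros; apply H; lia].
  replace (a * qc 1)%ps with a by ring. reflexivity.
Qed.

Definition ones : ps := fun _ => 1.
Lemma ones_inv : (ones * (qc 1 - qX))%ps = qc 1.
Proof.
  transitivity (ones - qX * ones)%ps; [ring|]. apply ps_ext. intros [|n]; unfold psub.
  - rewrite qX_mul_0. unfold ones, qc, cst, Q2R. simpl. field.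
  - rewrite qX_mul_S. unfold ones, qc, cst. ring.
Qed.
Lemma dq_ones : dq ones = (qX * ones * ones)%ps.
Proof.
  assert (H : dq (ones * (qc 1 - qX))%ps = qc 0) by (rewrite ones_inv; apply dq_qc).
  rewrite dq_mul, dq_sub, dq_qc, dq_qX in H.
  apply ps_eq_sub.
  transitivity (ones * (dq ones * (qc 1 - qX) + ones * (qc 0 - qX))
     + (qc 1 - ones * (qc 1 - qX)) * dq ones)%ps; [ring|].
  rewrite H, ones_inv. ring.
Qed.

Lemma vps_agree_one m a : (1 <= m)%nat -> a O = 1 -> agree m (vps m a) (qc 1).
Proof.
  intros Hm Ha k Hk. destruct k.
  - unfold vps. rewrite Nat.Div0.mod_0_l, Nat.Div0.div_0_l. simpl. rewrite Ha.
    unfold qc, cst, Q2R. simpl. field.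
  - apply vps_other. rewrite Nat.mod_small; lia.
Qed.

(* (1 - q^m)^c *)
Lemma eta_factor (m : nat) (c : Z) :
  (1 <= m)%nat ->
  exists U : ps, zps U /\ agree m U (qc 1) /\
    dq U = (- (cst (INR m * IZR c) * vps m (qX * ones) * U))%ps.
Proof.
  intros Hm.
  (* Nonnegative powers of a base V; used for 1 - q^m with s = 1 and for its inverse, the geometric
     series, with s = -1. *)
  assert (Hpow : forall (V : ps) (s : R), zps V -> agree m V (qc 1) ->
     dq V = (- (cst (INR m * s) * vps m (qX * ones) * V))%ps ->
     forall n, exists U, zps U /\ agree m U (qc 1) /\
       dq U = (- (cst (INR m * (s * INR n)) * vps m (qX * ones) * U))%ps).
  { intros V s HV Hag HdV. induction n as [|n [U [HU [HUa HdU]]]].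
    - exists (qc 1). split; [apply (zps_qc 1)|]. split; [intros k _; reflexivity|].
      rewrite dq_qc. simpl. rewrite !Rmult_0_r. fold (qc 0).
      replace (cst 0) with (qc 0) by (unfold qc, Q2R; simpl; f_equal; field). ring.
    - exists (V * U)%ps. split; [apply zps_mul; assumption|]. split.
      + intros k Hk. rewrite (agree_mul_one m V U) by assumption. apply Hag, Hk.
      + rewrite dq_mul, HdV, HdU, S_INR.
        replace (INR m * (s * (INR n + 1))) with (INR m * s + INR m * (s * INR n)) by ring.
        rewrite cst_add. ring. }
  assert (Hz1 : zps ones) by (intros n; apply (isZ_IZR 1)).
  assert (HzX : zps qX) by (intros [|[|n]]; [apply (isZ_IZR 0)|apply (isZ_IZR 1)|apply (isZ_IZR 0)]).
  destruct (Z_le_gt_dec 0 c) as [Hc|Hc].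
  - destruct (Hpow (vps m (qc 1 - qX)) 1) with (n := Z.to_nat c) as [U [H1 [H2 H3]]].
    + apply zps_vps, zps_sub; [apply (zps_qc 1)|exact HzX].
    + apply vps_agree_one; [exact Hm|]. unfold psub, qc, cst, Q2R. simpl. field.
    + rewrite vps_dq by exact Hm. rewrite dq_sub, dq_qc, dq_qX, Rmult_1_r.
      replace (qc 0 - qX)%ps with (- (qX * (ones * (qc 1 - qX))))%ps by (rewrite ones_inv; ring).
      replace (- (qX * (ones * (qc 1 - qX))))%ps with (qc (-1) * ((qX * ones) * (qc 1 - qX)))%ps by ring.
      rewrite !vps_mul by exact Hm. rewrite vps_qc by exact Hm. ring.
    + exists U. split; [exact H1|]. split; [exact H2|]. rewrite H3. do 4 f_equal.
      rewrite (INR_IZR_INZ (Z.to_nat c)), Z2Nat.id by exact Hc. ring.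
  - destruct (Hpow (vps m ones) (-1)) with (n := Z.to_nat (- c)) as [U [H1 [H2 H3]]].
    + apply zps_vps, Hz1.
    + apply vps_agree_one; [exact Hm|reflexivity].
    + rewrite vps_dq by exact Hm. rewrite dq_ones.
      rewrite (vps_mul m (qX * ones)) by exact Hm.
      rewrite cst_mul. replace (cst (-1)) with (qc (-1)) by (unfold qc, Q2R; simpl; f_equal; field). ring.
    + exists U. split; [exact H1|]. split; [exact H2|]. rewrite H3. do 4 f_equal.
      rewrite (INR_IZR_INZ (Z.to_nat (- c))), Z2Nat.id by lia. rewrite opp_IZR. ring.
Qed.

Lemma lam_divisor (f : nat -> R) n :
  lam (fun d _ => f d) n = psum (fun d => iv (Nat.eqb (n mod d) 0) (f d)) n.
Proof.
  apply psum_ext. intros d Hd. destruct (mod_cases d n) as [H|[k ->]]; [lia| |].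
  - apply Nat.eqb_neq in H as H'. rewrite H'. apply psum_0. intros x Hx. unfold iv.
    destruct (Nat.eqb_spec (d * x) n) as [E|]; [|reflexivity].
    exfalso. apply H. rewrite <- E, Nat.mul_comm. apply Nat.Div0.mod_mul.
  - rewrite (Nat.mul_comm d k), Nat.Div0.mod_mul. unfold iv at 2. simpl.
    rewrite (psum_single _ _ k); [|nia|].
    + unfold iv. rewrite (Nat.mul_comm d k), Nat.eqb_refl. reflexivity.
    + intros i Hi Hne. unfold iv. destruct (Nat.eqb_spec (d * i) (k * d)); [nia|reflexivity].
Qed.

(* prod_n (1 - q^n)^(c n) *)
Lemma eta_product (c : nat -> Z) :
  exists psi : ps, zps psi /\ psi O = 1 /\
    dq psi = (- (lam (fun d _ => INR d * IZR (c d))%R * psi))%ps.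
Proof.
  assert (HU : forall m, { U : ps | (1 <= m)%nat -> zps U /\ agree m U (qc 1) /\
    dq U = (- (cst (INR m * IZR (c m)) * vps m (qX * ones) * U))%ps }).
  { intros m. apply constructive_indefinite_description.
    destruct (le_lt_dec 1 m) as [Hm|Hm].
    - destruct (eta_factor m (c m) Hm) as [U H]. exists U. intros _. exact H.
    - exists (qc 0). intros; lia. }
  set (U := fun m => proj1_sig (HU m)).
  assert (HUs : forall m, (1 <= m)%nat -> zps (U m) /\ agree m (U m) (qc 1) /\
    dq (U m) = (- (cst (INR m * IZR (c m)) * vps m (qX * ones) * U m))%ps).
  { intros m. exact (proj2_sig (HU m)). }
  set (W := fix W N := match N with O => qc 1 | S m => (W m * U (S m))%ps end).
  set (L := fix L N := match N with O => qc 0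
       | S m => (L m + cst (INR (S m) * IZR (c (S m))) * vps (S m) (qX * ones))%ps end).
  assert (HWz : forall N, zps (W N)).
  { induction N; [apply (zps_qc 1)|]. apply zps_mul; [exact IHN|]. apply HUs. lia. }
  assert (HWd : forall N, dq (W N) = (- (L N * W N))%ps).
  { induction N; [simpl; rewrite dq_qc; ring|].
    change (W (S N)) with (W N * U (S N))%ps.
    change (L (S N)) with (L N + cst (INR (S N) * IZR (c (S N))) * vps (S N) (qX * ones))%ps.
    rewrite dq_mul, IHN. destruct (HUs (S N)) as [_ [_ ->]]; [lia|]. ring. }
  assert (HWs : forall N k, (k <= N)%nat -> W N k = W k k).
  { induction N; intros k Hk; [replace k with O by lia; reflexivity|].
    destruct (Nat.eq_dec k (S N)) as [->|Hne]; [reflexivity|].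
    rewrite <- IHN by lia. simpl. apply (agree_mul_one (S N)); [|lia].
    apply HUs. lia. }
  assert (HL : forall N n, (n <= N)%nat -> L N n = lam (fun d _ => INR d * IZR (c d)) n).
  { intros N n Hn. rewrite lam_divisor.
    transitivity (psum (fun d => iv (Nat.leb 1 n) (iv (Nat.eqb (n mod d) 0) (INR d * IZR (c d)))) N).
    - clear Hn. induction N as [|N IH].
      + unfold psum; simpl. unfold qc, cst, Q2R. destruct n; simpl; ring.
      + change (L (S N)) with (L N + cst (INR (S N) * IZR (c (S N))) * vps (S N) (qX * ones))%ps.
        unfold padd. rewrite IH, cst_mul_coef. unfold psum. rewrite bsum_S. f_equal.
        unfold vps. destruct n as [|n].
        * rewrite Nat.Div0.mod_0_l, Nat.Div0.div_0_l. simpl iv. rewrite qX_mul_0. ring.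
        * simpl Nat.leb. unfold iv. destruct (Nat.eqb_spec (S n mod S N) 0) as [E|E]; [|ring].
          apply Nat.Div0.mod_divides in E. destruct E as [k E].
          rewrite E, (Nat.mul_comm (S N)), Nat.div_mul by lia.
          destruct k; [lia|]. rewrite qX_mul_S. unfold ones. ring.
    - destruct n as [|n].
      + apply psum_0. reflexivity.
      + rewrite (psum_widen _ (S n) N); [reflexivity|exact Hn|].
        intros d Hd. simpl. rewrite Nat.mod_small by lia. reflexivity. }
  (* The factors after the n-th leave the coefficient of q^n unchanged, so the infinite product is
     the diagonal of the partial products. *)
  exists (fun n => W n n). split; [intros n; apply HWz|]. split.
  - simpl. unfold qc, cst, Q2R. simpl. field.
  - apply ps_ext. intros n. unfold dq at 1.
    transitivity (dq (W n) n); [reflexivity|]. rewrite HWd. unfold popp. f_equal.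
    apply pmul_ext_low; intros k Hk; [apply HL; exact Hk|apply HWs; exact Hk].
Qed.

(** * The differential equation on q-expansions *)

(* q d/dq on q^alpha a *)
Definition dqe (al : R) (a : ps) : ps := (dq a + cst al * a)%ps.
Definition Dk (k al : R) (a : ps) : ps := (dqe al a - cst (k / 12) * eis2 * a)%ps.
Definition ode (k kap al : R) (a : ps) : Prop :=
  Dk (k + 2) al (Dk k al a) = (cst kap * eis4 * a)%ps.

(** The constant k_1 of the theorem, for r = m_1 - m_2. *)
Definition kone (r : R) : R := (36 * r ^ 2 - 1) / 144.

Lemma eis2_0 : eis2 O = 1.
Proof.
  unfold eis2, psub. rewrite qc_mul_coef. unfold sig. rewrite lam_0.
  unfold qc, cst, Q2R. simpl. field.
Qed.
Lemma eis4_0 : eis4 O = 1.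
Proof.
  unfold eis4, padd. rewrite qc_mul_coef. unfold sig. rewrite lam_0.
  unfold qc, cst, Q2R. simpl. field.
Qed.
Lemma eis6_0 : eis6 O = 1.
Proof.
  unfold eis6, psub. rewrite qc_mul_coef. unfold sig. rewrite lam_0.
  unfold qc, cst, Q2R. simpl. field.
Qed.

Lemma dqe_coef al a n : dqe al a n = (INR n + al) * a n.
Proof. unfold dqe, padd. rewrite cst_mul_coef. unfold dq. ring. Qed.

Lemma pmul_split (a b : ps) n :
  (a * b)%ps n = a O * b n + bsum (fun j => a (S j) * b (n - S j)%nat) n.
Proof. unfold pmul. rewrite bsum_S_l, Nat.sub_0_r. reflexivity. Qed.

(** The Frobenius recursion: the constant terms of E_2 and E_4 give the indicial polynomial on the
    left, their other coefficients the sum on the right. *)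
Lemma ode0_coef kap al a :
  ode 0 kap al a <->
  forall n, ((INR n + al) ^ 2 - (INR n + al) / 6 - kap) * a n
    = bsum (fun j => (eis2 (S j) / 6 * (INR (n - S j) + al) + kap * eis4 (S j)) * a (n - S j)%nat) n.
Proof.
  assert (H : forall n, Dk (0 + 2) al (Dk 0 al a) n - (cst kap * eis4 * a)%ps n
     = ((INR n + al) ^ 2 - (INR n + al) / 6 - kap) * a n
       - bsum (fun j => (eis2 (S j) / 6 * (INR (n - S j) + al) + kap * eis4 (S j)) * a (n - S j)%nat) n).
  { intros n. unfold Dk.
    replace (cst (0 / 12)) with (qc 0) by (unfold qc, Q2R; simpl; f_equal; field).
    replace (dqe al a - qc 0 * eis2 * a)%ps with (dqe al a) by ring.
    unfold psub. rewrite <- !pmul_assoc, !cst_mul_coef, !dqe_coef.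
    rewrite (pmul_split eis2), (pmul_split eis4), eis2_0, eis4_0, !dqe_coef.
    rewrite (bsum_ext (fun j => eis2 (S j) * dqe al a (n - S j)%nat)
      (fun j => eis2 (S j) * (INR (n - S j) + al) * a (n - S j)%nat)).
    2: { intros j Hj. rewrite dqe_coef. ring. }
    rewrite (bsum_ext (fun j => (eis2 (S j) / 6 * (INR (n - S j) + al) + kap * eis4 (S j)) * a (n - S j)%nat)
      (fun j => / 6 * (eis2 (S j) * (INR (n - S j) + al) * a (n - S j)%nat)
                + kap * (eis4 (S j) * a (n - S j)%nat))).
    2: { intros j Hj. field. }
    rewrite bsum_plus, !bsum_scal. field. }
  split.
  - intros E n. specialize (H n). unfold ode in E. rewrite E in H. lra.
  - intros E. apply ps_ext. intros n. specialize (H n). rewrite E in H. lra.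
Qed.

(** No resonance: the other exponent 1/12 - r/2 does not exceed 1/12 + r/2 by a positive integer. *)
Definition indicial (r : R) : Prop := forall n, (1 <= n)%nat -> INR n + r <> 0.

Lemma indicial_value r n :
  (INR n + (/ 12 + r / 2)) ^ 2 - (INR n + (/ 12 + r / 2)) / 6 - kone r = INR n * (INR n + r).
Proof. unfold kone. field. Qed.

Lemma frobenius_exists r :
  indicial r -> exists G : ps, G O = 1 /\ ode 0 (kone r) (/ 12 + r / 2) G.
Proof.
  intros Hr.
  destruct (@ps_rec 1 (fun n a => bsum (fun j => (eis2 (S j) / 6 * (INR (n - S j) + (/ 12 + r / 2))
      + kone r * eis4 (S j)) * a (n - S j)%nat) n / (INR n * (INR n + r)))) as [G [G0 HG]].
  { intros n a b H. f_equal. apply bsum_ext. intros j Hj. rewrite H by lia. reflexivity. }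
  exists G. split; [exact G0|]. apply ode0_coef. intros n. rewrite indicial_value.
  destruct n as [|n]; [simpl; ring|]. rewrite (HG (S n)) by lia. field.
  split; [apply Hr; lia|apply not_0_INR; lia].
Qed.

Lemma frobenius_unique r G H :
  indicial r -> ode 0 (kone r) (/ 12 + r / 2) G -> ode 0 (kone r) (/ 12 + r / 2) H ->
  G O <> 0 -> forall n, H n = H O / G O * G n.
Proof.
  intros Hr HG HH G0. rewrite ode0_coef in HG, HH.
  induction n as [n IH] using (well_founded_induction lt_wf).
  destruct n as [|n]; [field; exact G0|].
  specialize (HG (S n)). specialize (HH (S n)). rewrite indicial_value in HG, HH.
  assert (Hne : INR (S n) * (INR (S n) + r) <> 0).
  { apply Rmult_integral_contrapositive_currified; [apply not_0_INR; lia|apply Hr; lia]. }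
  apply (Rmult_eq_reg_l (INR (S n) * (INR (S n) + r))); [|exact Hne].
  rewrite HH. rewrite (bsum_ext _ (fun j => H O / G O * ((eis2 (S j) / 6 * (INR (S n - S j) + (/ 12 + r / 2))
     + kone r * eis4 (S j)) * G (S n - S j)%nat))).
  - rewrite bsum_scal, <- HG. ring.
  - intros j Hj. rewrite (IH (S n - S j)%nat) by lia. ring.
Qed.

(* Some, equivalently every, nonzero solution with exponent 1/12 + r/2 has bounded denominators. *)
Definition bsol (r : R) : Prop :=
  exists G : ps, G O = 1 /\ bdd G /\ ode 0 (kone r) (/ 12 + r / 2) G.

Lemma ode_scal k kap al c G : ode k kap al G -> ode k kap al (cst c * G).
Proof.
  unfold ode, Dk, dqe. intros H.
  transitivity (cst c * (cst kap * eis4 * G))%ps; [|ring]. rewrite <- H.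
  dq_simpl. ring.
Qed.

Lemma bsol_intro r G : G O <> 0 -> isQ (G O) -> bdd G -> ode 0 (kone r) (/ 12 + r / 2) G -> bsol r.
Proof.
  intros G0 HQ Hb HG. exists (cst (/ G O) * G)%ps. split.
  - rewrite cst_mul_coef. field. exact G0.
  - split; [apply bdd_mul; [apply bdd_cst, isQ_inv, HQ|exact Hb]|apply ode_scal, HG].
Qed.

(** Without resonance the solution of the given exponent is unique up to a scalar, and here the
    scalar is rational. *)
Lemma bsol_elim r G :
  indicial r -> bsol r -> isQ (G O) -> ode 0 (kone r) (/ 12 + r / 2) G -> bdd G.
Proof.
  intros Hr [H [H0 [Hb HH]]] HQ HG.
  assert (E : G = (cst (G O) * H)%ps).
  { apply ps_ext. intros n. rewrite cst_mul_coef.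
    rewrite (frobenius_unique r H G Hr HH HG) by lra. rewrite H0. field. }
  rewrite E. apply bdd_mul; [apply bdd_cst, HQ|exact Hb].
Qed.

(** [phi] stands for eta^s without its factor q^(s/24). As D_(s/2) annihilates eta^s, D_(k + s/2)
    sends f eta^s to (D_k f) eta^s; the equation keeps its constant and changes only weight and
    exponent. *)
Lemma weight_shift k kap al (s : R) (f phi : ps) :
  ode k kap al f -> dq phi = (cst (s / 24) * (eis2 - qc 1) * phi)%ps ->
  ode (k + s / 2) kap (al + s / 24) (f * phi).
Proof.
  unfold ode, Dk, dqe. intros H Hphi.
  transitivity (cst kap * eis4 * f * phi)%ps; [|ring]. rewrite <- H.
  replace (cst ((k + s / 2) / 12)) with (cst (k / 12) + cst (s / 24))%ps
    by (rewrite <- cst_add; f_equal; field).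
  replace (cst ((k + s / 2 + 2) / 12)) with (cst (k / 12) + cst (s / 24) + qc (1#6))%ps
    by (unfold qc; rewrite <- !cst_add; f_equal; unfold Q2R; simpl; field).
  replace (cst ((k + 2) / 12)) with (cst (k / 12) + qc (1#6))%ps
    by (unfold qc; rewrite <- !cst_add; f_equal; unfold Q2R; simpl; field).
  rewrite (cst_add al). dq_simpl. rewrite Hphi. dq_simpl. rewrite Hphi. ring.
Qed.

Lemma eta_power (s : Z) :
  exists phi : ps, zps phi /\ phi O = 1 /\ dq phi = (cst (IZR s / 24) * (eis2 - qc 1) * phi)%ps.
Proof.
  destruct (eta_product (fun _ => s)) as [phi [H1 [H2 H3]]].
  exists phi. split; [exact H1|]. split; [exact H2|]. rewrite H3.
  replace (lam (fun d _ => INR d * IZR s)) with (cst (IZR s) * sig 1)%ps.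
  - unfold eis2. replace (cst (IZR s / 24)) with (cst (IZR s) * qc (1#24))%ps.
    + ring.
    + unfold qc. rewrite <- cst_mul. f_equal. unfold Q2R. simpl. field.
  - unfold sig. rewrite lam_scal. apply lam_ext. intros. ring.
Qed.

Lemma bsol_of_weight r k al (s : Z) (f : ps) :
  k = - IZR s / 2 -> al = / 12 + r / 2 - IZR s / 24 ->
  f O <> 0 -> isQ (f O) -> bdd f -> ode k (kone r) al f -> bsol r.
Proof.
  intros -> -> f0 HQ Hb Hf. destruct (eta_power s) as [phi [H1 [H2 H3]]].
  apply (bsol_intro r (f * phi)%ps).
  - rewrite pmul_coef0, H2. lra.
  - rewrite pmul_coef0, H2, Rmult_1_r. exact HQ.
  - apply bdd_mul; [exact Hb|apply zps_bdd, H1].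
  - replace 0 with (- IZR s / 2 + IZR s / 2) by field.
    replace (/ 12 + r / 2) with (/ 12 + r / 2 - IZR s / 24 + IZR s / 24) by ring.
    apply weight_shift; assumption.
Qed.

(* A series in x = q^(1/N), split according to the residue of the exponent of x mod N. *)
Definition comp (N j : nat) (f : ps) : ps := fun n => f (N * n + j)%nat.

Lemma comp_vps_mul N j (a f : ps) :
  (j < N)%nat -> comp N j (vps N a * f) = (a * comp N j f)%ps.
Proof.
  intros Hj. apply ps_ext. intros n. unfold comp, pmul.
  replace (S (N * n + j))%nat with (S (N * n) + j)%nat by lia.
  rewrite bsum_add, (bsum_0 _ j), Rplus_0_r.
  - rewrite bsum_multiples; [|lia|].
    + apply bsum_ext. intros k Hk. rewrite vps_mult by lia. do 2 f_equal. nia.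
    + intros i Hi. rewrite vps_other by exact Hi. ring.
  - intros i Hi. rewrite vps_other; [ring|].
    replace (S (N * n) + i)%nat with (S i + n * N)%nat by lia.
    rewrite Nat.Div0.mod_add, Nat.mod_small; lia.
Qed.

(** D_k on series in x = q^(1/N): q d/dq is x d/dx divided by N, and E_2(q) is E_2 at x^N. *)
Definition Dxq (N : nat) (k : R) (f : ps) : ps :=
  (cst (/ INR N) * dq f - cst (k / 12) * (vps N eis2 * f))%ps.

Lemma comp_sub N j a b : comp N j (a - b) = (comp N j a - comp N j b)%ps.
Proof. reflexivity. Qed.
Lemma comp_cst N j c a : comp N j (cst c * a) = (cst c * comp N j a)%ps.
Proof. apply ps_ext. intros n. unfold comp. rewrite !cst_mul_coef. reflexivity. Qed.

(** The operator has coefficients in x^N = q, so it preserves the residue of the exponent; the j-th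
    component carries the exponent j/N in q. *)
Lemma comp_Dxq N j k f : (j < N)%nat -> comp N j (Dxq N k f) = Dk k (INR j / INR N) (comp N j f).
Proof.
  intros Hj. unfold Dxq, Dk. rewrite comp_sub, !comp_cst, comp_vps_mul by exact Hj.
  rewrite pmul_assoc. f_equal. apply ps_ext. intros n.
  rewrite cst_mul_coef, dqe_coef. unfold comp, dq. rewrite plus_INR, mult_INR. field.
  apply not_0_INR. lia.
Qed.

Lemma comp_ode N j k kap f :
  (j < N)%nat -> Dxq N (k + 2) (Dxq N k f) = (cst kap * (vps N eis4 * f))%ps ->
  ode k kap (INR j / INR N) (comp N j f).
Proof.
  intros Hj H. unfold ode. rewrite <- !comp_Dxq by exact Hj. rewrite H.
  rewrite comp_cst, comp_vps_mul by exact Hj. ring.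
Qed.

Lemma zps_comp N j f : zps f -> zps (comp N j f).
Proof. intros H n. apply H. Qed.
Lemma isQ_isZ x : isZ x -> isQ x.
Proof. intros [z ->]. apply isQ_IZR. Qed.

(* The two components of a product in x = q^(1/N) satisfying the equation are its two solutions. *)
Lemma bsol_pair_of_comp N j r k (s : Z) (f : ps) :
  (j < N)%nat -> zps f -> f O <> 0 -> f j <> 0 ->
  k = - IZR s / 2 -> 0 = / 12 - r / 2 - IZR s / 24 -> INR j / INR N = r ->
  Dxq N (k + 2) (Dxq N k f) = (cst (kone r) * (vps N eis4 * f))%ps ->
  bsol r /\ bsol (- r).
Proof.
  intros Hj Hz f0 fj Hk Ha Hr H. split.
  - apply (bsol_of_weight r k (INR j / INR N) s (comp N j f)); try assumption.
    + lra.
    + unfold comp. rewrite Nat.mul_0_r. exact fj.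
    + apply isQ_isZ, zps_comp, Hz.
    + apply zps_bdd, zps_comp, Hz.
    + apply comp_ode; assumption.
  - apply (bsol_of_weight (- r) k (INR 0 / INR N) s (comp N 0 f)); try assumption.
    + simpl. unfold Rdiv. lra.
    + unfold comp. rewrite Nat.mul_0_r. exact f0.
    + apply isQ_isZ, zps_comp, Hz.
    + apply zps_bdd, zps_comp, Hz.
    + replace (kone (- r)) with (kone r) by (unfold kone; field).
      apply comp_ode; [lia|exact H].
Qed.

(** * Bounded solutions for small denominators *)

Lemma cst_Q x (y : Q) : x = Q2R y -> cst x = qc y.
Proof. intros ->. reflexivity. Qed.

Lemma vps_eis4 N : (1 <= N)%nat -> vps N eis4 = (qc 1 + qc 240 * sigN N 3)%ps.
Proof.
  intros HN. unfold eis4. rewrite vps_add, vps_mul, !vps_qc, vps_sig by exact HN. reflexivity.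
Qed.
Lemma vps_eis2 N : (1 <= N)%nat -> vps N eis2 = (qc 1 - qc 24 * sigN N 1)%ps.
Proof.
  intros HN. unfold eis2. rewrite vps_sub, vps_mul, !vps_qc, vps_sig by exact HN. reflexivity.
Qed.

Lemma sigw_unit N : (1 <= N)%nat -> sigw N unit_w = (sig 1 - cst (INR N) * sigN N 1)%ps.
Proof.
  intros HN. unfold sig, sigN, sigw. rewrite lam_scal, lam_sub. apply lam_ext. intros d x _ _.
  unfold unit_w. destruct (Nat.eqb (d mod N) 0); unfold iv; simpl; field; apply not_0_INR; lia.
Qed.

Lemma vps_vps N M a : (1 <= N)%nat -> (1 <= M)%nat -> vps N (vps M a) = vps (N * M) a.
Proof.
  intros HN HM. apply ps_ext. intros n.
  destruct (mod_cases (N * M) n) as [H|[k ->]]; [lia| |].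
  - rewrite (vps_other (N * M)) by exact H.
    destruct (mod_cases N n HN) as [HN'|[k ->]]; [apply vps_other, HN'|].
    rewrite vps_mult by exact HN. apply vps_other. intros E. apply H.
    apply Nat.Div0.mod_divides in E. destruct E as [c ->].
    replace (N * (M * c))%nat with (c * (N * M))%nat by ring. apply Nat.Div0.mod_mul.
  - rewrite vps_mult by lia. rewrite <- Nat.mul_assoc, !vps_mult by lia. reflexivity.
Qed.

(** 2 E_2(2 tau) - E_2(tau), which is modular of weight 2 and level 2. *)
Notation F2 := (qc 2 * vps 2 eis2 - eis2)%ps.

Lemma level2_eis : eis4 = (qc 5 * F2 * F2 - qc 4 * vps 2 eis4)%ps.
Proof.
  rewrite vps_eis4, vps_eis2 by lia.
  pose proof level2_product as H. rewrite (sigw_unit 2) in H by lia.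
  rewrite (cst_Q (INR 2) 2) in H by (q2r; simpl; field).
  set (Y := (sig 1 - qc 2 * sigN 2 1)%ps) in H.
  transitivity (qc 5 * (qc 1 + qc 48 * Y + qc 576 * (Y * Y)) - qc 4 * (qc 1 + qc 240 * sigN 2 3))%ps.
  - rewrite H. unfold eis4. ring.
  - unfold Y, eis2. ring.
Qed.

Lemma level3_eis :
  (qc 9 * vps 3 eis4 = qc (5#2) * (qc 3 * vps 3 eis2 - eis2) * (qc 3 * vps 3 eis2 - eis2) - eis4)%ps.
Proof.
  rewrite vps_eis4, vps_eis2 by lia.
  pose proof level3_product as H. rewrite (sigw_unit 3) in H by lia.
  rewrite (cst_Q (INR 3) 3) in H by (q2r; simpl; field).
  set (Y := (sig 1 - qc 3 * sigN 3 1)%ps) in H.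
  transitivity (qc 10 * (qc 1 + qc 24 * Y + qc 144 * (Y * Y)) - eis4)%ps.
  - rewrite H. unfold eis4. ring.
  - unfold Y, eis2. ring.
Qed.

Lemma mod4_mod2 u : ((u mod 4) mod 2 = u mod 2)%nat.
Proof.
  rewrite (Nat.div_mod_eq u 4) at 2.
  replace (4 * (u / 4) + u mod 4)%nat with (u mod 4 + 2 * (u / 4) * 2)%nat by lia.
  rewrite Nat.Div0.mod_add. reflexivity.
Qed.

(** Together with [level2_eis] and its image under q -> q^2, this expresses E_4 at x, x^2 and x^4
    through E_2 at these points, as the case r = 1/4 requires. *)
Lemma level4_eis :
  vps 2 eis4 = (qc (1#3) * (qc 4 * vps 2 F2 * vps 2 F2 - qc 2 * F2 * vps 2 F2 + F2 * F2))%ps.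
Proof.
  assert (E1 : F2 = (qc 1 + qc 24 * sigw 4 odd_w)%ps).
  { replace (sigw 4 odd_w) with (sigw 2 unit_w).
    - rewrite (sigw_unit 2), vps_eis2 by lia.
      rewrite (cst_Q (INR 2) 2) by (q2r; simpl; field). unfold eis2. ring.
    - apply lam_ext. intros d x _ _. f_equal.
      rewrite <- mod4_mod2. case_mod d 4%nat; reflexivity. }
  assert (E2 : vps 2 F2 = (qc 1 + qc 12 * sigw 4 two_w)%ps).
  { rewrite E1, vps_add, vps_mul, !vps_qc by lia.
    replace (vps 2 (sigw 4 odd_w)) with (qc (1#2) * sigw 4 two_w)%ps; [ring|].
    unfold sigw. rewrite vps_lam by lia. unfold qc. rewrite lam_scal. apply lam_ext. intros d x _ _.
    assert (Hd : exists j r, (d = 4 * j + r /\ r < 4)%nat).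
    { exists (d / 4)%nat, (d mod 4)%nat. split; [apply Nat.div_mod_eq|apply Nat.mod_upper_bound; lia]. }
    destruct Hd as [j [r [-> Hr]]]. unfold odd_w. rewrite mod4_mod2.
    replace ((4 * j + r) mod 2)%nat with (r mod 2)%nat
      by (replace (4 * j + r)%nat with (r + 2 * j * 2)%nat by lia; rewrite Nat.Div0.mod_add; reflexivity).
    replace ((4 * j + r) / 2)%nat with (r / 2 + 2 * j)%nat
      by (replace (4 * j + r)%nat with (r + 2 * j * 2)%nat by lia; rewrite Nat.div_add by lia; reflexivity).
    replace ((r / 2 + 2 * j) mod 2)%nat with ((r / 2) mod 2)%nat
      by (rewrite (Nat.mul_comm 2 j), Nat.Div0.mod_add; reflexivity).
    residues. rewrite !plus_INR, !mult_INR. q2r.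
    by_residue r; eval_w; field. }
  rewrite E2, E1, vps_eis4 by lia.
  pose proof level4_product as H.
  transitivity (qc (1#3) * (qc 3 + qc 72 * sigw 4 two_w + qc 576 *
    (sigw 4 two_w * sigw 4 two_w - sigw 4 odd_w * sigw 4 two_w + sigw 4 odd_w * sigw 4 odd_w)))%ps; [|ring].
  rewrite H. ring.
Qed.

(** Shows that the component of residue 1 of an eta quotient does not start with 0. *)
Lemma eta_product_1 (c : nat -> Z) psi :
  psi O = 1 -> dq psi = (- (lam (fun d _ => INR d * IZR (c d))%R * psi))%ps ->
  psi 1%nat = - IZR (c 1%nat).
Proof.
  intros H0 H. apply (f_equal (fun s => s 1%nat)) in H. unfold dq in H at 1.
  unfold popp, pmul in H. simpl in H. rewrite H0 in H.
  unfold lam, psum in H. simpl in H. lra.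
Qed.

(** The exponents of the product of (1 - x^d)^a / (1 - x^(N d))^b over d. *)
Definition level_w (a b : Z) (N d : nat) : Z := (a - (if Nat.eqb (d mod N) 0 then b else 0))%Z.

Lemma level_w_lam (a b : Z) (N : nat) :
  (1 <= N)%nat ->
  lam (fun d _ => INR d * IZR (level_w a b N d))%R
  = (cst (IZR a) * sig 1 - cst (IZR b * INR N) * sigN N 1)%ps.
Proof.
  intros HN. unfold sig, sigN. rewrite !lam_scal, lam_sub. apply lam_ext. intros d x _ _.
  unfold level_w. destruct (Nat.eqb (d mod N) 0); unfold iv; rewrite minus_IZR; field; apply not_0_INR; lia.
Qed.

Ltac num_cst :=
  repeat match goal with
  | |- context [cst ?x] =>
    match x with
    | / INR 2 => rewrite (cst_Q x (1#2)) by (q2r; simpl; field)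
    | / INR 3 => rewrite (cst_Q x (1#3)) by (q2r; simpl; field)
    | / INR 4 => rewrite (cst_Q x (1#4)) by (q2r; simpl; field)
    | INR 2 => rewrite (cst_Q x 2) by (q2r; simpl; field)
    | INR 3 => rewrite (cst_Q x 3) by (q2r; simpl; field)
    | INR 4 => rewrite (cst_Q x 4) by (q2r; simpl; field)
    end
  end.

Lemma vps_ramanujan2 N :
  (1 <= N)%nat ->
  dq (vps N eis2) = (cst (INR N) * (qc (1#12) * (vps N eis2 * vps N eis2 - vps N eis4)))%ps.
Proof.
  intros HN. rewrite vps_dq, ramanujan2, vps_mul, vps_sub, vps_mul, vps_qc by exact HN. reflexivity.
Qed.

(** The quotient is eta(tau/2)^8 / eta(tau)^4, of weight 2; its powers of q from the two eta factors
    cancel. Multiplication by eta^(-4) leads to weight 0. *)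
Lemma bsol_half : bsol (1/2) /\ bsol (- (1/2)).
Proof.
  destruct (eta_product (level_w 8 4 2)) as [f [Hz [f0 Hf]]].
  apply (bsol_pair_of_comp 2 1 (1/2) 2 (-4) f); try (simpl; lra).
  - lia.
  - exact Hz.
  - rewrite (eta_product_1 _ f f0 Hf). vm_compute level_w. lra.
  - rewrite level_w_lam in Hf by lia.
    assert (Hd : dq f = (qc (1#3) * (eis2 - vps 2 eis2) * f)%ps).
    { rewrite Hf, vps_eis2 by lia. unfold eis2.
      rewrite (cst_Q 8 8), (cst_Q (4 * INR 2) 8) by (q2r; simpl; field). ring. }
    unfold Dxq. rewrite (cst_Q (kone (1/2)) (1#18)) by (unfold kone; q2r; field).
    rewrite (cst_Q (2 / 12) (1#6)), (cst_Q ((2 + 2) / 12) (1#3)) by (q2r; field). num_cst.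
    dq_simpl. rewrite Hd. dq_simpl. rewrite Hd, vps_ramanujan2 by lia.
    pose proof level2_eis as H1. set (A := vps 2 eis4) in *.
    rewrite ramanujan2, H1. num_cst. ring.
Qed.

(** The quotient is eta(tau/3)^3 / eta(tau), of weight 1. *)
Lemma bsol_third : bsol (1/3) /\ bsol (- (1/3)).
Proof.
  destruct (eta_product (level_w 3 1 3)) as [f [Hz [f0 Hf]]].
  apply (bsol_pair_of_comp 3 1 (1/3) 1 (-2) f); try (simpl; lra).
  - lia.
  - exact Hz.
  - rewrite (eta_product_1 _ f f0 Hf). vm_compute level_w. lra.
  - rewrite level_w_lam in Hf by lia.
    assert (Hd : dq f = (qc (1#8) * (eis2 - vps 3 eis2) * f)%ps).
    { rewrite Hf, vps_eis2 by lia. unfold eis2.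
      rewrite (cst_Q 3 3), (cst_Q (1 * INR 3) 3) by (q2r; simpl; field). ring. }
    unfold Dxq. rewrite (cst_Q (kone (1/3)) (1#48)) by (unfold kone; q2r; field).
    rewrite (cst_Q (1 / 12) (1#12)), (cst_Q ((1 + 2) / 12) (1#4)) by (q2r; field). num_cst.
    dq_simpl. rewrite Hd. dq_simpl. rewrite Hd, vps_ramanujan2 by lia. num_cst.
    pose proof level3_eis as H1. set (A := vps 3 eis4) in *.
    replace A with (qc (1#9) * (qc 9 * A))%ps by ring. rewrite H1, ramanujan2. ring.
Qed.

(** The quotient is eta(tau/4)^2 / eta(tau/2), of weight 1/2, the theta series of (-1)^n x^(n^2)
    with x = q^(1/4); squares are 0 or 1 modulo 4. *)
Lemma bsol_quarter : bsol (1/4) /\ bsol (- (1/4)).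
Proof.
  destruct (eta_product (level_w 2 1 2)) as [f [Hz [f0 Hf]]].
  apply (bsol_pair_of_comp 4 1 (1/4) (1/2) (-1) f); try (simpl; lra).
  - lia.
  - exact Hz.
  - rewrite (eta_product_1 _ f f0 Hf). vm_compute level_w. lra.
  - rewrite level_w_lam in Hf by lia.
    assert (Hd : dq f = (qc (1#12) * (eis2 - vps 2 eis2) * f)%ps).
    { rewrite Hf, vps_eis2 by lia. unfold eis2.
      rewrite (cst_Q 2 2), (cst_Q (1 * INR 2) 2) by (q2r; simpl; field). ring. }
    assert (H4 : vps 4 eis4 = (qc (1#4) * (qc 5 * vps 2 F2 * vps 2 F2 - vps 2 eis4))%ps).
    { pose proof (f_equal (vps 2) level2_eis) as H.
      rewrite vps_sub, !vps_mul, !vps_qc, vps_vps in H by lia. simpl in H. rewrite H. ring. }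
    assert (E2 : vps 2 F2 = (qc 2 * vps 4 eis2 - vps 2 eis2)%ps).
    { rewrite vps_sub, vps_mul, vps_qc, vps_vps by lia. reflexivity. }
    pose proof level4_eis as H2. rewrite E2 in H2, H4. rewrite H2 in H4.
    pose proof level2_eis as H1.
    unfold Dxq. rewrite (cst_Q (kone (1/4)) (5#576)) by (unfold kone; q2r; field).
    rewrite (cst_Q (1/2/12) (1#24)), (cst_Q ((1/2 + 2) / 12) (5#24)) by (q2r; field). num_cst.
    dq_simpl. rewrite Hd. dq_simpl. rewrite Hd, !vps_ramanujan2 by lia.
    set (A := vps 2 eis4) in *. set (B := vps 4 eis4) in *.
    rewrite ramanujan2, H4, H1, H2. num_cst. ring.
Qed.

(** * Level five *)

(** The weight 2 Eisenstein series eta(tau)^5 / eta(5 tau) with character chi5; [dq_L5] gives the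
    logarithmic derivative of this quotient. *)
Definition L5 : ps := (qc 1 - qc 5 * sigw 5 chi5)%ps.
Definition F5 : ps := (qc 1 + qc 6 * sigw 5 unit_w)%ps.

Lemma dq_L5 : dq L5 = (qc (1#6) * (eis2 - F5) * L5)%ps.
Proof.
  unfold L5, F5, eis2. dq_simpl.
  pose proof level5_product_chi as H.
  transitivity (qc (1#6) * (qc 6 * (qc (1#5) * (qc 20 * (sigw 5 chi5 * sig 1) + qc 5 * (sigw 5 chi5 * sigw 5 unit_w)))
     * qc 5 - qc 24 * sig 1 - qc 6 * sigw 5 unit_w))%ps; [rewrite H; ring|ring].
Qed.

Lemma level5_eis : (qc 144 * L5 * L5 + qc 500 * F5 * F5 = qc 19 * eis4 + qc 625 * vps 5 eis4)%ps.
Proof.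
  rewrite vps_eis4 by lia. unfold L5, F5, eis4.
  transitivity (qc 3600 * (sigw 5 chi5 * sigw 5 chi5 + qc 5 * (sigw 5 unit_w * sigw 5 unit_w))
    + qc 644 - qc 1440 * sigw 5 chi5 + qc 6000 * sigw 5 unit_w)%ps; [ring|].
  rewrite level5_product. ring.
Qed.

Lemma F5_eis2 : F5 = (qc (1#4) * (qc 5 * vps 5 eis2 - eis2))%ps.
Proof.
  unfold F5. rewrite (sigw_unit 5), vps_eis2 by lia. unfold eis2.
  rewrite (cst_Q (INR 5) 5) by (q2r; simpl; field). ring.
Qed.

(** E_4(5 tau) is eliminated by [level5_eis], so that differentiating F5 and L5 introduces nothing
    beyond E_2, E_4, F5 and L5. *)
Lemma dq_F5 : dq F5 = (qc (1#6) * eis2 * F5 + qc (1#300) * (qc 11 * eis4 - qc 25 * F5 * F5 - qc 36 * L5 * L5))%ps.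
Proof.
  pose proof level5_eis as H. set (A := vps 5 eis4) in *.
  assert (HA : A = (qc (1#625) * (qc 144 * L5 * L5 + qc 500 * F5 * F5 - qc 19 * eis4))%ps)
    by (rewrite H; ring).
  assert (HV : vps 5 eis2 = (qc (1#5) * (qc 4 * F5 + eis2))%ps) by (rewrite F5_eis2; ring).
  rewrite F5_eis2 at 1. dq_simpl. rewrite vps_ramanujan2 by lia. fold A.
  rewrite HA, HV, ramanujan2. rewrite (cst_Q (INR 5) 5) by (q2r; simpl; field). ring.
Qed.

(* prod (1 - q^n)^(-c n), c n = a for n = 1, 4 mod 5 and c n = b for n = 2, 3 mod 5 *)
Lemma level5_eta (a b : Z) :
  exists Z : ps, zps Z /\ Z O = 1 /\
    dq Z = ((cst (IZR a) * (qc (1#12) * F5 - qc (1#10) * L5 + qc (1#60))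
             + cst (IZR b) * (qc (1#12) * F5 + qc (1#10) * L5 - qc (11#60))) * Z)%ps.
Proof.
  destruct (eta_product (fun n => nth (n mod 5) [0; -a; -b; -b; -a]%Z 0%Z)) as [Z [H1 [H2 H3]]].
  exists Z. split; [exact H1|]. split; [exact H2|]. rewrite H3.
  transitivity (cst (-1) * lam (fun d _ => (INR d * IZR (nth (d mod 5) [0; -a; -b; -b; -a]%Z 0%Z))%R) * Z)%ps.
  { rewrite (cst_Q (-1) (-1)) by (q2r; simpl; field). ring. }
  f_equal. unfold F5, L5.
  transitivity (cst (IZR a) * qc (1#2) * (sigw 5 unit_w + sigw 5 chi5)
    + cst (IZR b) * qc (1#2) * (sigw 5 unit_w - sigw 5 chi5))%ps; [|ring].
  unfold sigw, qc. rewrite <- !cst_mul. rewrite lam_add, lam_sub, !lam_scal, lam_add.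
  apply lam_ext. intros d x _ _. unfold Q2R, inject_Z. simpl Qnum. simpl Qden.
  case_mod d 5%nat; unfold unit_w, chi5; simpl; rewrite ?opp_IZR; field.
Qed.

(** For the logarithmic derivative w of a solution, the weight 0 equation becomes a Riccati
    equation. *)
Lemma ode0_intro kap al G w v :
  dqe al G = (w * G)%ps -> dq w = v ->
  (v + w * w - qc (1#6) * eis2 * w = cst kap * eis4)%ps -> ode 0 kap al G.
Proof.
  intros H1 H2 H3. unfold ode, Dk.
  rewrite (cst_Q (0 / 12) 0), (cst_Q ((0 + 2) / 12) (1#6)) by (q2r; field).
  replace (dqe al G - qc 0 * eis2 * G)%ps with (w * G)%ps by (rewrite H1; ring).
  transitivity (dq w * G + w * dqe al G - qc (1#6) * eis2 * (w * G))%ps.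
  - unfold dqe. rewrite dq_mul. ring.
  - rewrite H1, H2, <- H3. ring.
Qed.

Ltac cst_ints :=
  repeat match goal with
  | |- context [cst (IZR ?z)] => rewrite (cst_Q (IZR z) (inject_Z z)) by (unfold Q2R, inject_Z; simpl; field)
  end; unfold inject_Z.

(** [Y] and [X] are the Rogers-Ramanujan products H and G, whose exponents 11/60 and -1/60 are 1/12
    + 1/10 and 1/12 - 1/10. *)
Lemma bsol_fifth : bsol (1/5) /\ bsol (- (1/5)).
Proof.
  split.
  - destruct (level5_eta 0 1) as [Y [HZ [Y0 HY]]].
    apply (bsol_intro _ Y); [lra|rewrite Y0; apply (isQ_IZR 1)|apply zps_bdd, HZ|].
    eapply (ode0_intro _ _ Y (qc (1#12) * F5 + qc (1#10) * L5)%ps).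
    + unfold dqe. rewrite HY, (cst_Q (/ 12 + 1 / 5 / 2) (11#60)) by (q2r; field). cst_ints. ring.
    + dq_simpl. rewrite dq_F5, dq_L5. reflexivity.
    + rewrite (cst_Q (kone (1/5)) (11#3600)) by (unfold kone; q2r; field). ring.
  - destruct (level5_eta 1 0) as [X [HZ [X0 HX]]].
    apply (bsol_intro _ X); [lra|rewrite X0; apply (isQ_IZR 1)|apply zps_bdd, HZ|].
    eapply (ode0_intro _ _ X (qc (1#12) * F5 - qc (1#10) * L5)%ps).
    + unfold dqe. rewrite HX, (cst_Q (/ 12 + - (1 / 5) / 2) (-1#60)) by (q2r; field). cst_ints. ring.
    + dq_simpl. rewrite dq_F5, dq_L5. reflexivity.
    + rewrite (cst_Q (kone (- (1/5))) (11#3600)) by (unfold kone; q2r; field). ring.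
Qed.

(* The icosahedral parametrisation: [s] is the fifth power of the Rogers-Ramanujan
   continued fraction, and F5, E4 and E6 are polynomials in [M = L5 / (1 - 11 s - s^2)] and [s]. *)
Lemma icosahedral :
  exists s M : ps,
    zps s /\ s O = 0 /\ s 1%nat = 1 /\ dq s = (L5 * s)%ps /\
    L5 = (M * (qc 1 - qc 11 * s - s * s))%ps /\
    F5 = (M * (qc 1 + s * s))%ps /\
    eis4 = (M * M * (qc 1 + qc 228 * s + qc 494 * s * s - qc 228 * s * s * s + s * s * s * s))%ps.
Proof.
  (* [level5_eta] uses negated exponents: -5 and 5 put (1 - q^n)^5 at n = 1, 4 modulo 5 over (1 -
     q^n)^5 at n = 2, 3 modulo 5. *)
  destruct (level5_eta (-5) 5) as [psi [HZ [psi0 Hpsi]]].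
  set (s := (qX * psi)%ps).
  assert (Hs : dq s = (L5 * s)%ps).
  { unfold s. rewrite dq_mul, dq_qX, Hpsi. cst_ints. ring. }
  assert (s0 : s O = 0) by apply qX_mul_0.
  assert (s1 : s 1%nat = 1) by (unfold s; rewrite qX_mul_S; exact psi0).
  assert (Hzs : zps s).
  { apply zps_mul; [intros [|[|n]]; [exists 0%Z|exists 1%Z|exists 0%Z]; reflexivity|exact HZ]. }
  set (w := (qc 1 - qc 11 * s - s * s)%ps).
  assert (w0 : w O = 1).
  { unfold w, psub. rewrite qc_mul_coef, pmul_coef0, s0. unfold qc, cst, Q2R. simpl. field. }
  destruct (ps_inv w) as [v Hv]; [lra|].
  set (M := (L5 * v)%ps).
  assert (HL : L5 = (M * w)%ps) by (transitivity (L5 * (w * v))%ps; [rewrite Hv; ring|unfold M; ring]).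
  assert (HM : dq M = (qc (1#6) * (eis2 - F5) * M + M * M * s * (qc 11 + qc 2 * s))%ps).
  { apply (pmul_cancel w); [lra|].
    transitivity (dq (M * w) - M * dq w)%ps; [rewrite dq_mul; ring|].
    rewrite <- HL, dq_L5. unfold w at 1. dq_simpl. rewrite Hs, HL. unfold w. ring. }
  (* Up to sign and normalisation, [H] and [T] are Klein's icosahedral forms of degrees 20 and 30.
     [Phi], [Psi] and [Om] are the errors in the expected formulas for F5, E_4 and E_6; they satisfy
     a closed differential system. *)
  set (H := (qc 1 + qc 228 * s + qc 494 * s * s - qc 228 * s * s * s + s * s * s * s)%ps).
  set (T := (qc 1 - qc 522 * s - qc 10005 * s * s - qc 10005 * s * s * s * s
             + qc 522 * s * s * s * s * s + s * s * s * s * s * s)%ps).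
  set (Phi := (F5 - M * (qc 1 + s * s))%ps).
  set (Psi := (eis4 - M * M * H)%ps).
  set (Om := (eis6 - M * M * M * T)%ps).
  assert (dPhi : dq Phi = (qc (1#6) * (eis2 * Phi) + qc (11#300) * Psi - qc (1#12) * (Phi * Phi))%ps).
  { unfold Phi, Psi. dq_simpl. rewrite dq_F5, HM, Hs, HL. unfold w, H. ring. }
  assert (dPsi : dq Psi = (qc (1#3) * (eis2 * Psi) - qc (1#3) * Om + qc (1#3) * (M * M * H * Phi))%ps).
  { unfold Phi, Psi, Om, H, T. dq_simpl. rewrite ramanujan4, HM, Hs, HL. unfold w. ring. }
  assert (dOm : dq Om = (qc (1#2) * (eis2 * Om) - qc (1#2) * ((eis4 + M * M * H) * Psi)
                         + qc (1#2) * (M * M * M * T * Phi))%ps).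
  { unfold Phi, Psi, Om, H, T. dq_simpl. rewrite ramanujan6, HM, Hs, HL. unfold w. ring. }
  assert (L50 : L5 O = 1).
  { unfold L5, psub. rewrite qc_mul_coef. unfold sigw. rewrite lam_0. unfold qc, cst, Q2R. simpl. field. }
  assert (L51 : L5 1%nat = -5).
  { unfold L5, psub. rewrite qc_mul_coef. unfold sigw, lam, psum, qc, cst, Q2R, chi5. simpl. field. }
  assert (F50 : F5 O = 1).
  { unfold F5, padd. rewrite qc_mul_coef. unfold sigw. rewrite lam_0. unfold qc, cst, Q2R. simpl. field. }
  assert (F51 : F5 1%nat = 6).
  { unfold F5, padd. rewrite qc_mul_coef. unfold sigw, lam, psum, qc, cst, Q2R, unit_w. simpl. field. }
  assert (M0 : M O = 1).
  { apply (f_equal (fun a => a O)) in HL. rewrite pmul_coef0, L50, w0 in HL. lra. }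
  assert (w1 : w 1%nat = -11).
  { unfold w, psub. rewrite qc_mul_coef, s1. unfold pmul. simpl. rewrite s0, s1.
    unfold qc, cst, Q2R. simpl. field. }
  assert (M1 : M 1%nat = 6).
  { apply (f_equal (fun a => a 1%nat)) in HL. rewrite L51 in HL. unfold pmul in HL. simpl in HL.
    rewrite M0, w0, w1 in HL. lra. }
  assert (H0 : H O = 1).
  { unfold H, padd, psub. rewrite !pmul_coef0, s0. unfold qc, cst, Q2R. simpl. field. }
  assert (T0 : T O = 1).
  { unfold T, padd, psub. rewrite !pmul_coef0, s0. unfold qc, cst, Q2R. simpl. field. }
  assert (Phi0 : Phi O = 0).
  { unfold Phi, psub. rewrite !pmul_coef0. unfold padd. rewrite !pmul_coef0, s0, M0, F50.
    unfold qc, cst, Q2R. simpl. field. }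
  assert (Phi1 : Phi 1%nat = 0).
  { unfold Phi, psub. rewrite F51. unfold pmul, padd. simpl. rewrite M0, M1, s0, s1.
    unfold qc, cst, Q2R. simpl. field. }
  assert (Psi0 : Psi O = 0).
  { unfold Psi, psub. rewrite !pmul_coef0, M0, H0, eis4_0. ring. }
  assert (Om0 : Om O = 0).
  { unfold Om, psub. rewrite !pmul_coef0, M0, T0, eis6_0. ring. }
  (* At order x = n the system is linear in the three n-th coefficients, with determinant (x -
     1)(x^2 - 1/25). Beyond the constant terms only n = 1 needs a separate input, namely [Phi1]. *)
  assert (Z : forall n, Phi n = 0 /\ Psi n = 0 /\ Om n = 0).
  { induction n as [n IH] using (well_founded_induction lt_wf).
    destruct n as [|n]; [auto|].
    assert (L1 : forall k, (k < S n)%nat -> Phi k = 0) by (intros; apply IH; assumption).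
    assert (L2 : forall k, (k < S n)%nat -> Psi k = 0) by (intros; apply IH; assumption).
    assert (L3 : forall k, (k < S n)%nat -> Om k = 0) by (intros; apply IH; assumption).
    apply (f_equal (fun a => a (S n))) in dPhi, dPsi, dOm.
    unfold padd, psub, dq in dPhi, dPsi, dOm. rewrite !qc_mul_coef in dPhi, dPsi, dOm.
    rewrite (pmul_coef_low eis2), (pmul_coef_low Phi), Phi0, eis2_0 in dPhi by assumption.
    rewrite (pmul_coef_low eis2), (pmul_coef_low (M * M * H)%ps), eis2_0, !pmul_coef0, M0, H0 in dPsi by assumption.
    rewrite (pmul_coef_low eis2), (pmul_coef_low (M * M * M * T)%ps), eis2_0 in dOm by assumption.
    rewrite pmul_coef_low in dOm by assumption.
    rewrite !pmul_coef0, M0, T0, eis4_0 in dOm. rewrite ?H0 in dOm.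
    unfold Q2R in dPhi, dPsi, dOm. simpl Qnum in *. simpl Qden in *.
    destruct n as [|n].
    - rewrite Phi1 in *. simpl in dPhi, dPsi, dOm. split; [reflexivity|]. split; lra.
    - assert (Hn : 2 <= INR (S (S n))) by (rewrite !S_INR; pose proof (pos_INR n); lra).
      set (x := INR (S (S n))) in *. set (p := Phi (S (S n))) in *. set (y := Psi (S (S n))) in *.
      set (o := Om (S (S n))) in *.
      assert (E1 : (x - 1) * ((x + / 6) * y - p / 3) = 0) by nra.
      assert (E2 : (x + / 6) * y = p / 3).
      { apply Rmult_integral in E1. destruct E1; lra. }
      assert (E3 : (x * x - / 25) * p = 0) by nra.
      assert (p = 0) by (apply Rmult_integral in E3; destruct E3; [nra|assumption]).
      assert (y = 0) by (assert ((x + / 6) * y = 0) as E4 by lra; apply Rmult_integral in E4; destruct E4; lra).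
      split; [assumption|]. split; [assumption|]. nra. }
  exists s, M. repeat split; try assumption.
  - apply ps_eq_sub. apply ps_ext. intros n. destruct (Z n) as [E _]. fold Phi. rewrite E.
    unfold qc, cst, Q2R. destruct n; simpl; ring.
  - apply ps_eq_sub. apply ps_ext. intros n. destruct (Z n) as [_ [E _]]. fold H. fold Psi. rewrite E.
    unfold qc, cst, Q2R. destruct n; simpl; ring.
Qed.

(** In terms of the Rogers-Ramanujan products G, H, including their powers of q, one has s =
    (H/G)^5, and the two solutions are H^7 - 7 G^5 H^2 and G^7 + 7 G^2 H^5. *)
Lemma bsol_two_fifths : bsol (2/5) /\ bsol (- (2/5)).
Proof.
  destruct icosahedral as [s [M [Hzs [s0 [s1 [Hs [HL [HF HE]]]]]]]].
  assert (dF := dq_F5). assert (dL := dq_L5).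
  split.
  - destruct (level5_eta 5 2) as [Z [HZ [Z0 HdZ]]].
    apply (bsol_intro _ (Z * (s - qc 7))%ps).
    + rewrite pmul_coef0, Z0. unfold psub. rewrite s0. unfold qc, cst, Q2R. simpl. lra.
    + apply isQ_isZ, zps_mul; [exact HZ|]. apply zps_sub; [exact Hzs|apply (zps_qc 7)].
    + apply zps_bdd, zps_mul; [exact HZ|]. apply zps_sub; [exact Hzs|apply (zps_qc 7)].
    + unfold ode, Dk, dqe.
      rewrite (cst_Q (0 / 12) 0), (cst_Q ((0 + 2) / 12) (1#6)), (cst_Q (/ 12 + 2 / 5 / 2) (17#60)) by (q2r; field).
      rewrite (cst_Q (kone (2/5)) (119#3600)) by (unfold kone; q2r; field).
      dq_simpl. rewrite HdZ, Hs. dq_simpl. rewrite HdZ, Hs, dF, dL, HE, HL, HF. cst_ints. ring.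
  - destruct (level5_eta 7 0) as [Z [HZ [Z0 HdZ]]].
    apply (bsol_intro _ (Z * (qc 1 + qc 7 * s))%ps).
    + rewrite pmul_coef0, Z0. unfold padd. rewrite qc_mul_coef, s0. unfold qc, cst, Q2R. simpl. lra.
    + apply isQ_isZ, zps_mul; [exact HZ|]. apply zps_add; [apply (zps_qc 1)|apply zps_mul; [apply (zps_qc 7)|exact Hzs]].
    + apply zps_bdd, zps_mul; [exact HZ|]. apply zps_add; [apply (zps_qc 1)|apply zps_mul; [apply (zps_qc 7)|exact Hzs]].
    + unfold ode, Dk, dqe.
      rewrite (cst_Q (0 / 12) 0), (cst_Q ((0 + 2) / 12) (1#6)), (cst_Q (/ 12 + - (2 / 5) / 2) (-7#60)) by (q2r; field).
      rewrite (cst_Q (kone (- (2/5))) (119#3600)) by (unfold kone; q2r; field).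
      dq_simpl. rewrite HdZ, Hs. dq_simpl. rewrite HdZ, Hs, dF, dL, HE, HL, HF. cst_ints. ring.
Qed.

(** * Shifting the exponent difference by an integer *)

(* The operator (1/12 + r/2) E6 - E4 q d/dq leads from r in weight 0 to r + 1 in weight 6. *)
Lemma shift_ode r be G :
  ode 0 (kone r) be G ->
  ode 6 (kone (r + 1)) be (cst (/ 12 + r / 2) * eis6 * G - eis4 * dqe be G).
Proof.
  set (al := / 12 + r / 2). intros H. unfold ode, Dk in *.
  rewrite (cst_Q (0 / 12) 0), (cst_Q ((0 + 2) / 12) (1#6)) in H by (q2r; field).
  rewrite (cst_Q (6 / 12) (1#2)), (cst_Q ((6 + 2) / 12) (2#3)) by (q2r; field).
  replace (kone (r + 1)) with (al * al + 5 / 6 * al + / 6) by (unfold kone, al; field).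
  replace (kone r) with (al * al - / 6 * al) in H by (unfold kone, al; field).
  rewrite !cst_add, !cst_mul.
  rewrite cst_sub, !cst_mul in H.
  rewrite (cst_Q (/ 6) (1#6)) in H by (q2r; field).
  rewrite (cst_Q (/ 6) (1#6)), (cst_Q (5 / 6) (5#6)) by (q2r; field).
  set (y := dqe be G) in *.
  assert (Hy : dq G = (y - cst be * G)%ps) by (unfold y, dqe; ring).
  assert (Hy1 : dq y = (qc (1#6) * eis2 * y + (cst al * cst al - qc (1#6) * cst al) * eis4 * G - cst be * y)%ps).
  { rewrite <- H. replace (y - qc 0 * eis2 * G)%ps with y by ring. unfold dqe. ring. }
  clearbody y. clear H. unfold dqe.
  dq_simpl. rewrite Hy, Hy1, ramanujan4, ramanujan6.
  dq_simpl. rewrite Hy, Hy1, ramanujan2, ramanujan4, ramanujan6. ring.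
Qed.

Lemma eis_coef1 : eis2 1%nat = -24 /\ eis4 1%nat = 240 /\ eis6 1%nat = -504.
Proof.
  unfold eis2, eis4, eis6, padd, psub. rewrite !qc_mul_coef.
  unfold sig, lam, psum, qc, cst, Q2R. simpl. repeat split; field.
Qed.

Lemma ode_qX k kap al K : ode k kap al (qX * K) -> ode k kap (al + 1) K.
Proof.
  unfold ode, Dk. intros H.
  assert (E : forall a, dqe al (qX * a) = (qX * dqe (al + 1) a)%ps).
  { intros a. unfold dqe. rewrite dq_mul, dq_qX, cst_add, (cst_Q 1 1) by (q2r; field). ring. }
  assert (E2 : (qX * (dqe (al + 1) (dqe (al + 1) K - cst (k / 12) * eis2 * K)
        - cst ((k + 2) / 12) * eis2 * (dqe (al + 1) K - cst (k / 12) * eis2 * K)))%ps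
     = (qX * (cst kap * eis4 * K))%ps).
  { transitivity (cst kap * eis4 * (qX * K))%ps; [|ring]. rewrite <- H, E.
    replace (qX * dqe (al + 1) K - cst (k / 12) * eis2 * (qX * K))%ps
      with (qX * (dqe (al + 1) K - cst (k / 12) * eis2 * K))%ps by ring.
    rewrite E. ring. }
  apply ps_ext. intros n. apply (f_equal (fun a => a (S n))) in E2. rewrite !qX_mul_S in E2. exact E2.
Qed.

Lemma qX_div (H : ps) : H O = 0 -> H = (qX * (fun n => H (S n)))%ps.
Proof. intros H0. apply ps_ext. intros [|n]; [rewrite qX_mul_0; exact H0|rewrite qX_mul_S; reflexivity]. Qed.

Lemma bdd_tail H : bdd H -> bdd (fun n => H (S n)).
Proof. intros [N [HN Hb]]. exists N. split; [exact HN|]. intros n. apply Hb. Qed.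

Lemma isQ_exponent r : isQ r -> isQ (/ 12 + r / 2).
Proof.
  intros Hr. apply isQ_add; [apply isQ_inv, (isQ_IZR 12)|apply isQ_div; [exact Hr|apply (isQ_IZR 2)]].
Qed.

Lemma bdd_dqe be G : isQ be -> bdd G -> bdd (dqe be G).
Proof.
  intros Hb HG. apply bdd_add; [apply bdd_dq, HG|apply bdd_mul; [apply bdd_cst, Hb|exact HG]].
Qed.

Lemma bdd_shift r be G :
  isQ r -> isQ be -> bdd G -> bdd (cst (/ 12 + r / 2) * eis6 * G - eis4 * dqe be G).
Proof.
  intros Hr Hbe HG. apply bdd_sub.
  - apply bdd_mul; [|exact HG].
    apply bdd_mul; [apply bdd_cst, isQ_exponent, Hr|apply zps_bdd, zps_eis6].
  - apply bdd_mul; [apply zps_bdd, zps_eis4|apply bdd_dqe; assumption].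
Qed.

Lemma shift_coef0 r be G :
  (cst (/ 12 + r / 2) * eis6 * G - eis4 * dqe be G)%ps O = (/ 12 + r / 2 - be) * G O.
Proof.
  unfold psub. rewrite !pmul_coef0, eis6_0, eis4_0, dqe_coef. simpl. ring.
Qed.

(** The operator annihilates the leading coefficient of G, so the result starts one power of q
    later; division by eta^12 lowers the exponent by 1/2 and returns to weight 0. The new leading
    coefficient contains (6r + 1)(6r + 5), hence the hypotheses. *)
Lemma bsol_shift_up r :
  isQ r -> 1 + r <> 0 -> 6 * r + 1 <> 0 -> 6 * r + 5 <> 0 -> bsol r -> bsol (r + 1).
Proof.
  intros Hr H1 H2 H3 [G [G0 [Hb HG]]].
  assert (HQ := isQ_exponent r Hr).
  pose proof (shift_ode r _ G HG) as HH. pose proof (bdd_shift r _ G Hr HQ Hb) as HB.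
  pose proof (shift_coef0 r (/ 12 + r / 2) G) as H0. rewrite Rminus_diag, Rmult_0_l in H0.
  assert (Hc : (cst (/ 12 + r / 2) * eis6 * G - eis4 * dqe (/ 12 + r / 2) G)%ps 1%nat
               = - 12 * (6 * r + 1) * (6 * r + 5) / (1 + r)).
  { destruct eis_coef1 as [e2 [e4 e6]].
    rewrite ode0_coef in HG. specialize (HG 1%nat). rewrite indicial_value in HG. simpl in HG.
    rewrite e2, e4, G0 in HG.
    assert (G1 : G 1%nat = (60 * r ^ 2 - 2 * r - 2) / (1 + r)).
    { apply (Rmult_eq_reg_l (1 + r)); [|exact H1].
      replace ((1 + r) * ((60 * r ^ 2 - 2 * r - 2) / (1 + r))) with (60 * r ^ 2 - 2 * r - 2) by (field; exact H1).
      unfold kone in HG. lra. }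
    unfold psub. rewrite <- pmul_assoc, cst_mul_coef. unfold pmul. simpl.
    rewrite !dqe_coef. simpl. rewrite e4, e6, eis4_0, eis6_0, G0, G1. field. exact H1. }
  set (H := (cst (/ 12 + r / 2) * eis6 * G - eis4 * dqe (/ 12 + r / 2) G)%ps) in *.
  apply (bsol_of_weight (r + 1) 6 (/ 12 + r / 2 + 1) (-12) (fun n => H (S n))).
  - lra.
  - lra.
  - rewrite Hc. unfold Rdiv. apply Rmult_integral_contrapositive_currified; [|apply Rinv_neq_0_compat, H1].
    repeat apply Rmult_integral_contrapositive_currified; lra.
  - rewrite Hc. apply isQ_div; [|apply isQ_add; [apply (isQ_IZR 1)|exact Hr]].
    repeat apply isQ_mul; try apply isQ_add; try apply isQ_mul; try exact Hr;
      try apply (isQ_IZR (-12)); try apply (isQ_IZR 6); try apply (isQ_IZR 1); apply (isQ_IZR 5).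
  - apply bdd_tail, HB.
  - apply ode_qX. rewrite <- qX_div by exact H0. exact HH.
Qed.

(** The same operator applied to the solution of the other exponent multiplies the leading
    coefficient by r, and no power of q is lost. *)
Lemma bsol_shift_down r : isQ r -> r <> 0 -> bsol (- r) -> bsol (- (r + 1)).
Proof.
  intros Hr H1 [G [G0 [Hb HG]]].
  assert (HQ := isQ_exponent (- r)).
  assert (Hr' : isQ (- r)) by (replace (- r) with ((-1) * r) by ring; apply isQ_mul; [apply (isQ_IZR (-1))|exact Hr]).
  specialize (HQ Hr').
  replace (kone (- r)) with (kone r) in HG by (unfold kone; field).
  pose proof (shift_ode r _ G HG) as HH. pose proof (bdd_shift r _ G Hr HQ Hb) as HB.
  pose proof (shift_coef0 r (/ 12 + - r / 2) G) as H0. rewrite G0 in H0.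
  set (H := (cst (/ 12 + r / 2) * eis6 * G - eis4 * dqe (/ 12 + - r / 2) G)%ps) in *.
  apply (bsol_of_weight (- (r + 1)) 6 (/ 12 + - r / 2) (-12) H).
  - lra.
  - lra.
  - rewrite H0. lra.
  - rewrite H0. replace ((/ 12 + r / 2 - (/ 12 + - r / 2)) * 1) with r by field. exact Hr.
  - exact HB.
  - replace (kone (- (r + 1))) with (kone (r + 1)) by (unfold kone; field). exact HH.
Qed.

Definition bpair (r : R) : Prop := bsol r /\ bsol (- r).

Lemma bpair_opp r : bpair r -> bpair (- r).
Proof. intros [H1 H2]. split; [exact H2|]. rewrite Ropp_involutive. exact H1. Qed.

Lemma bpair_shift r :
  isQ r -> r <> 0 -> 1 + r <> 0 -> 6 * r + 1 <> 0 -> 6 * r + 5 <> 0 -> bpair r -> bpair (r + 1).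
Proof.
  intros Hr H0 H1 H2 H3 [Hp Hm]. split; [apply bsol_shift_up|apply bsol_shift_down]; assumption.
Qed.

Definition ratio (P Qd : Z) : R := IZR P / IZR Qd.

Lemma isQ_ratio P Qd : isQ (ratio P Qd).
Proof. apply isQ_div; apply isQ_IZR. Qed.

Lemma ratio_add P Qd n : (0 < Qd)%Z -> ratio P Qd + IZR n = ratio (P + n * Qd) Qd.
Proof.
  intros H. unfold ratio. rewrite plus_IZR, mult_IZR. field. apply not_0_IZR. lia.
Qed.

Lemma ratio_opp P Qd : - ratio P Qd = ratio (- P) Qd.
Proof. unfold ratio. rewrite opp_IZR. unfold Rdiv. ring. Qed.

Lemma ratio_lin_neq (a b P Qd : Z) :
  (0 < Qd)%Z -> (a * P + b * Qd)%Z <> 0%Z -> IZR a * ratio P Qd + IZR b <> 0.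
Proof.
  intros HQ H E. apply H. apply eq_IZR. rewrite plus_IZR, !mult_IZR.
  assert (HQ' : IZR Qd <> 0) by (apply not_0_IZR; lia).
  transitivity ((IZR a * ratio P Qd + IZR b) * IZR Qd); [unfold ratio; field; exact HQ'|].
  rewrite E. ring.
Qed.

Lemma bpair_shift_ratio P Qd :
  (0 < Qd)%Z -> P <> 0%Z -> (P + Qd <> 0)%Z -> (6 * P + Qd <> 0)%Z -> (6 * P + 5 * Qd <> 0)%Z ->
  bpair (ratio P Qd) -> bpair (ratio (P + Qd) Qd).
Proof.
  intros HQ H0 H1 H2 H3 H. replace (P + Qd)%Z with (P + 1 * Qd)%Z by ring.
  rewrite <- ratio_add by exact HQ. apply bpair_shift; [apply isQ_ratio|..|exact H].
  - intros E. apply (ratio_lin_neq 1 0 P Qd HQ); [lia|]. rewrite E. ring.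
  - intros E. apply (ratio_lin_neq 1 1 P Qd HQ); [lia|]. lra.
  - intros E. apply (ratio_lin_neq 6 1 P Qd HQ); [lia|]. lra.
  - intros E. apply (ratio_lin_neq 6 5 P Qd HQ); [lia|]. lra.
Qed.

Lemma bpair_shift_nat P Qd (n : nat) :
  (0 < Qd)%Z ->
  (forall k, let P' := (P + k * Qd)%Z in P' <> 0 /\ 6 * P' + Qd <> 0 /\ 6 * P' + 5 * Qd <> 0)%Z ->
  bpair (ratio P Qd) -> bpair (ratio (P + Z.of_nat n * Qd) Qd).
Proof.
  intros HQ Hk H. induction n as [|n IH].
  - replace (P + Z.of_nat 0 * Qd)%Z with P by lia. exact H.
  - replace (P + Z.of_nat (S n) * Qd)%Z with (P + Z.of_nat n * Qd + Qd)%Z by lia.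
    destruct (Hk (Z.of_nat n)) as [A [B C]]. destruct (Hk (Z.of_nat n + 1)%Z) as [A' _].
    apply bpair_shift_ratio; try assumption. lia.
Qed.

Lemma bpair_small P Qd : (2 <= Qd <= 5)%Z -> Z.gcd P Qd = 1%Z -> bpair (ratio P Qd).
Proof.
  intros HQ.
  assert (Hbase : forall P, (- Qd < 2 * P <= Qd)%Z -> Z.gcd P Qd = 1%Z -> bpair (ratio P Qd)).
  { intros P0 HP Hg.
    assert (HQ' : (Qd = 2 \/ Qd = 3 \/ Qd = 4 \/ Qd = 5)%Z) by lia.
    assert (HP' : (P0 = -2 \/ P0 = -1 \/ P0 = 0 \/ P0 = 1 \/ P0 = 2)%Z) by lia.
    assert (B : forall r, bsol r /\ bsol (- r) -> bpair r) by (intros; assumption).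
    destruct HQ' as [-> | [-> | [-> | ->]]];
    destruct HP' as [-> | [-> | [-> | [-> | ->]]]]; simpl in Hg; try lia; try discriminate;
    unfold ratio;
    try (replace (-1 / 2) with (- (1/2)) by field);
    try (replace (-1 / 3) with (- (1/3)) by field);
    try (replace (-1 / 4) with (- (1/4)) by field);
    try (replace (-1 / 5) with (- (1/5)) by field);
    try (replace (-2 / 5) with (- (2/5)) by field);
    try apply bpair_opp;
    (exact bsol_half || exact bsol_third || exact bsol_quarter || exact bsol_fifth || exact bsol_two_fifths). }
  assert (Hpos : forall P, (0 < P)%Z -> Z.gcd P Qd = 1%Z -> bpair (ratio P Qd)).
  { intros P0 HP Hg.
    (* The offset [c] centres the remainder: [R0] lies in (-Qd/2, Qd/2], the range of [Hbase]. *)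
    set (c := ((Qd - 1) / 2)%Z). set (R0 := ((P0 + c) mod Qd - c)%Z). set (n := ((P0 + c) / Qd)%Z).
    assert (Hc : (2 * c = Qd - 1 \/ 2 * c = Qd - 2)%Z).
    { unfold c. pose proof (Z.div_mod (Qd - 1) 2). pose proof (Z.mod_pos_bound (Qd - 1) 2). lia. }
    assert (Hm : (0 <= (P0 + c) mod Qd < Qd)%Z) by (apply Z.mod_pos_bound; lia).
    assert (E : (P0 = R0 + n * Qd)%Z).
    { unfold R0, n. pose proof (Z.div_mod (P0 + c) Qd). lia. }
    assert (Hn : (0 <= n)%Z) by (apply Z.div_pos; lia).
    rewrite E. replace n with (Z.of_nat (Z.to_nat n)) by lia.
    apply bpair_shift_nat; [lia| |].
    - intros k P'.
      assert (Hg' : Z.gcd P' Qd = 1%Z).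
      { unfold P'. rewrite Z.gcd_comm, Z.gcd_add_mult_diag_r, Z.gcd_comm.
        rewrite <- Hg, E. rewrite (Z.gcd_comm (R0 + n * Qd)), Z.gcd_add_mult_diag_r. apply Z.gcd_comm. }
      clearbody P'. repeat split.
      + intros ->. rewrite Z.gcd_0_l in Hg'. lia.
      + lia.
      + assert (Qd = 2 \/ Qd = 3 \/ Qd = 4 \/ Qd = 5)%Z by lia. lia.
    - apply Hbase; [unfold R0; lia|].
      rewrite <- Hg, E. rewrite (Z.gcd_comm (R0 + n * Qd)), Z.gcd_add_mult_diag_r. apply Z.gcd_comm. }
  intros Hg. destruct (Z.lt_trichotomy P 0) as [H|[->|H]].
  - rewrite <- (Z.opp_involutive P), <- ratio_opp. apply bpair_opp, Hpos; [lia|].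
    rewrite Z.gcd_opp_l. exact Hg.
  - rewrite Z.gcd_0_l in Hg. lia.
  - apply Hpos; assumption.
Qed.

Lemma indicial_ratio P Qd : (2 <= Qd)%Z -> Z.gcd P Qd = 1%Z -> indicial (ratio P Qd).
Proof.
  intros HQ Hg n Hn E.
  apply (ratio_lin_neq 1 (Z.of_nat n) P Qd); [lia| |rewrite <- INR_IZR_INZ; lra].
  intros H. assert (P = (- Z.of_nat n) * Qd)%Z by lia. subst P.
  rewrite Z.gcd_comm, <- (Z.mul_1_l Qd) in Hg at 1.
  rewrite Z.gcd_mul_mono_r, Z.gcd_1_l in Hg. lia.
Qed.

(** * Primes dividing the denominator *)

Lemma prime_divisor_exists (D : Z) : (1 < D)%Z -> exists p, prime p /\ (p | D)%Z.
Proof.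
  intros HD. assert (H0 : (0 <= D)%Z) by lia. revert HD. pattern D.
  apply Zlt_0_ind; [|exact H0]. clear D H0. intros D IH _ HD.
  destruct (prime_dec D) as [Hp|Hp]; [exists D; split; [exact Hp|apply Z.divide_refl]|].
  destruct (not_prime_divide D HD Hp) as [n [Hn Hd]].
  destruct (IH n) as [p [Hp1 Hp2]]; [lia|lia|].
  exists p. split; [exact Hp1|]. eapply Z.divide_trans; eassumption.
Qed.

Lemma pow_divide_all (p N : Z) : (2 <= p)%Z -> N <> 0%Z -> (forall n : nat, (p ^ Z.of_nat n | N)%Z) -> False.
Proof.
  intros Hp HN H. specialize (H (Z.to_nat (Z.abs N))).
  rewrite Z2Nat.id in H by lia.
  apply Z.divide_abs_r in H. apply Z.divide_pos_le in H; [|lia].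
  pose proof (Z.pow_gt_lin_r p (Z.abs N)). lia.
Qed.

Lemma prime_pow_rel (p z N : Z) (n : nat) :
  prime p -> ~ (p | z)%Z -> (p ^ Z.of_nat n | N * z)%Z -> (p ^ Z.of_nat n | N)%Z.
Proof.
  intros Hp Hz H. apply (Gauss _ z); [rewrite Z.mul_comm; exact H|].
  assert (Hr : rel_prime z p) by (apply rel_prime_sym, prime_rel_prime; assumption).
  apply rel_prime_sym. clear H. induction n as [|n IH].
  - apply rel_prime_sym, rel_prime_1.
  - rewrite Nat2Z.inj_succ, Z.pow_succ_r by lia. apply rel_prime_mult; assumption.
Qed.

Fixpoint rising (g : nat -> Z) (n : nat) : Z :=
  match n with O => 1%Z | S m => (rising g m * g m)%Z end.

Lemma rising_add g n m :
  rising g (n + m) = (rising g n * rising (fun i => g (n + i)%nat) m)%Z.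
Proof.
  induction m as [|m IH]; [rewrite Nat.add_0_r; simpl; ring|].
  rewrite Nat.add_succ_r. simpl. rewrite IH. ring.
Qed.

Lemma rising_neq0 g n : (forall i, g i <> 0%Z) -> rising g n <> 0%Z.
Proof. intros H. induction n; simpl; [lia|]. specialize (H n). nia. Qed.

Lemma eis2_coef k : eis2 (S k) = - 24 * sig 1 (S k).
Proof. unfold eis2, psub. rewrite qc_mul_coef. unfold qc at 1, cst. q2r. field. Qed.
Lemma eis4_coef k : eis4 (S k) = 240 * sig 3 (S k).
Proof. unfold eis4, padd. rewrite qc_mul_coef. unfold qc at 1, cst. q2r. field. Qed.

(** d + 5 d^3 is a multiple of 3. In the recursion, the 1/12 of the exponent contributes -sigma_1/3
    and the -1/144 of [kone] contributes -5 sigma_3/3. *)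
Lemma sig_mod3 n : isZ ((sig 1 n + 5 * sig 3 n) / 3).
Proof.
  replace ((sig 1 n + 5 * sig 3 n) / 3) with ((cst (/3) * (sig 1 + cst 5 * sig 3))%ps n)
    by (rewrite cst_mul_coef; unfold padd; rewrite cst_mul_coef; field).
  unfold sig. rewrite lam_scal, lam_add, lam_scal. apply zps_lam. intros d _.
  rewrite INR_IZR_INZ, !pow_IZR.
  set (z := Z.of_nat d). simpl Z.of_nat.
  assert (Hz : exists k, (z ^ 1 + 5 * z ^ 3 = 3 * k)%Z).
  { assert (E : (z = 3 * (z / 3) + z mod 3)%Z) by (apply Z.div_mod; lia).
    pose proof (Z.mod_pos_bound z 3) as B.
    set (u := (z / 3)%Z) in *. set (v := (z mod 3)%Z) in *.
    assert (V : (v = 0 \/ v = 1 \/ v = 2)%Z) by lia.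
    destruct V as [V|[V|V]]; rewrite V in E; rewrite E.
    - exists (u + 45 * u ^ 3)%Z. ring.
    - exists (45 * u ^ 3 + 45 * u ^ 2 + 16 * u + 2)%Z. ring.
    - exists (45 * u ^ 3 + 90 * u ^ 2 + 61 * u + 14)%Z. ring. }
  destruct Hz as [k Hk]. exists k. apply (f_equal IZR) in Hk. rewrite plus_IZR, !mult_IZR in Hk.
  simpl (Z.of_nat 1) in *. simpl (Z.of_nat 3) in *. lra.
Qed.

Lemma sig_1 k : sig k 1%nat = 1.
Proof. unfold sig, lam, psum. simpl. rewrite pow1. ring. Qed.

(** The only term not divisible by D comes from 60 r^2 sigma_3: multiplied by D Q it is (60 D / Q)
    P^2 sigma_3, and 60 D / Q = w. *)
Lemma coef_integer (P Qd g D w : Z) (k m : nat) (r := ratio P Qd) :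
  (0 < Qd)%Z -> Qd = (g * D)%Z -> 60%Z = (g * w)%Z ->
  exists z : Z, IZR D * IZR Qd * (eis2 (S k) / 6 * (INR m + (/ 12 + r / 2)) + kone r * eis4 (S k))
    = IZR w * IZR P * IZR P * sig 3 (S k) + IZR D * IZR z.
Proof.
  intros HQ HD Hw.
  destruct (sig_mod3 (S k)) as [t Ht]. destruct (zps_sig 1 (S k)) as [u Hu].
  exists (- Qd * t - u * (4 * Qd * Z.of_nat m + 2 * P))%Z.
  rewrite minus_IZR, !mult_IZR, plus_IZR, !mult_IZR, opp_IZR, <- INR_IZR_INZ, <- Ht, <- Hu.
  rewrite eis2_coef, eis4_coef.
  assert (HQ' : IZR Qd <> 0) by (apply not_0_IZR; lia).
  assert (Ew : IZR w * IZR Qd = 60 * IZR D).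
  { rewrite <- !mult_IZR. f_equal. rewrite HD, Hw. ring. }
  assert (Ew' : IZR w = 60 * IZR D / IZR Qd) by (rewrite <- Ew; field; exact HQ').
  rewrite Ew'. unfold kone, r, ratio. field. exact HQ'.
Qed.

(* The n-th coefficient is B_n / (D^n prod_{i <= n} i (Q i + P)) with integers B_n, and modulo p
   only the term of index n - 1 of the recursion for B_n survives, so that p does not divide B_n. *)
Lemma unbounded_of_prime (P Qd g D w p : Z) :
  (2 <= Qd)%Z -> Z.gcd P Qd = 1%Z -> Qd = (g * D)%Z -> 60%Z = (g * w)%Z -> Z.gcd D w = 1%Z ->
  prime p -> (p | D)%Z -> ~ bsol (ratio P Qd).
Proof.
  intros HQ Hg HD Hw Hgw Hp HpD [a [a0 [[N [HN Hb]] HG]]].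
  assert (Hind := indicial_ratio P Qd HQ Hg).
  set (r := ratio P Qd) in *. rewrite ode0_coef in HG.
  set (f := fun i : nat => ((Z.of_nat i + 1) * (Qd * (Z.of_nat i + 1) + P))%Z).
  assert (HQ' : IZR Qd <> 0) by (apply not_0_IZR; lia).
  assert (HpQ : (p | Qd)%Z) by (rewrite HD; apply Z.divide_mul_r, HpD).
  assert (HpP : ~ (p | P)%Z).
  { intros H. assert (H1 : (p | Z.gcd P Qd)%Z) by (apply Z.gcd_greatest; assumption).
    rewrite Hg in H1. apply Z.divide_1_r_nonneg in H1; [subst p; exact (not_prime_1 Hp)|].
    destruct Hp; lia. }
  assert (Hpw : ~ (p | w)%Z).
  { intros H. assert (H1 : (p | Z.gcd D w)%Z) by (apply Z.gcd_greatest; assumption).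
    rewrite Hgw in H1. apply Z.divide_1_r_nonneg in H1; [subst p; exact (not_prime_1 Hp)|].
    destruct Hp; lia. }
  set (b := fun n : nat => a n * IZR (D ^ Z.of_nat n) * IZR (rising f n)).
  assert (Hf : forall n, IZR (f n) = IZR Qd * (INR (S n) * (INR (S n) + r))).
  { intros n. unfold f. cbv beta. repeat rewrite ?mult_IZR, ?plus_IZR. rewrite <- INR_IZR_INZ, S_INR.
    unfold r, ratio. field. exact HQ'. }
  assert (Hrec : forall n, b (S n) = bsum (fun j =>
     IZR (D ^ Z.of_nat j) * IZR (rising (fun i => f (n - j + i)%nat) j)
     * (IZR D * IZR Qd * (eis2 (S j) / 6 * (INR (n - j) + (/ 12 + r / 2)) + kone r * eis4 (S j)))
     * b (n - j)%nat) (S n)).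
  { intros n. unfold b at 1.
    change (rising f (S n)) with (rising f n * f n)%Z. rewrite mult_IZR, Hf.
    specialize (HG (S n)). unfold r in HG at 1 2 3. fold r in HG. rewrite indicial_value in HG.
    transitivity (IZR (D ^ Z.of_nat (S n)) * IZR (rising f n) * IZR Qd
        * ((INR (S n) * (INR (S n) + r)) * a (S n))); [ring|].
    rewrite HG, <- bsum_scal. apply bsum_ext. intros j Hj.
    replace (S n - S j)%nat with (n - j)%nat by lia. unfold b.
    replace (rising f n) with (rising f (n - j) * rising (fun i => f (n - j + i)%nat) j)%Z
      by (rewrite <- rising_add; f_equal; lia).
    replace (D ^ Z.of_nat (S n))%Z with (D ^ Z.of_nat j * D ^ Z.of_nat (n - j) * D)%Z.
    - rewrite !mult_IZR. ring.
    - rewrite <- Z.pow_add_r by lia. rewrite <- (Z.pow_1_r D) at 2. rewrite <- Z.pow_add_r by lia.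
      f_equal. lia. }
  assert (HB : forall n, exists z : Z, b n = IZR z /\ ~ (p | z)%Z).
  { induction n as [n IH] using (well_founded_induction lt_wf).
    destruct n as [|n].
    - exists 1%Z. split; [unfold b; rewrite a0; simpl; ring|].
      intros H. apply Z.divide_1_r_nonneg in H; [subst p; exact (not_prime_1 Hp)|]. destruct Hp; lia.
    - rewrite Hrec, bsum_S_l. rewrite !Nat.sub_0_r.
      destruct (IH n) as [z [Ez Hz]]; [lia|]. rewrite Ez.
      destruct (coef_integer P Qd g D w 0 n) as [y Hy]; [lia|assumption|assumption|].
      fold r in Hy. rewrite Hy, sig_1.
      (* The later terms of the recursion carry a positive power of D, hence a factor p. *)
      assert (Hrest : exists v : Z, bsum (fun j => IZR (D ^ Z.of_nat (S j)) * IZR (rising (fun i => f (n - S j + i)%nat) (S j))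
         * (IZR D * IZR Qd * (eis2 (S (S j)) / 6 * (INR (n - S j) + (/ 12 + r / 2)) + kone r * eis4 (S (S j))))
         * b (n - S j)%nat) n = IZR D * IZR v).
      { assert (HZ : isZ (bsum (fun j => IZR (D ^ Z.of_nat j) * IZR (rising (fun i => f (n - S j + i)%nat) (S j))
         * (IZR D * IZR Qd * (eis2 (S (S j)) / 6 * (INR (n - S j) + (/ 12 + r / 2)) + kone r * eis4 (S (S j))))
         * b (n - S j)%nat) n)).
        { apply isZ_bsum. intros j Hj.
          destruct (coef_integer P Qd g D w (S j) (n - S j)) as [y' Hy']; [lia|assumption|assumption|].
          fold r in Hy'. rewrite Hy'.
          destruct (IH (n - S j)%nat) as [z' [Ez' _]]; [lia|]. rewrite Ez'.
          repeat apply isZ_mul; try apply isZ_IZR.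
          apply isZ_add; repeat apply isZ_mul; try apply isZ_IZR. apply zps_sig. }
        destruct HZ as [v Hv]. exists v. rewrite <- Hv, <- bsum_scal. apply bsum_ext. intros j Hj.
        rewrite Nat2Z.inj_succ, Z.pow_succ_r, mult_IZR by lia. ring. }
      destruct Hrest as [v Hv]. rewrite Hv. simpl (rising _ 0). simpl (Z.of_nat 0). rewrite Z.pow_0_r.
      exists (w * P * P * z + D * (y * z + v))%Z. split.
      + rewrite plus_IZR, !mult_IZR, plus_IZR, !mult_IZR. ring.
      + intros H. assert (H1 : (p | w * P * P * z)%Z).
        { replace (w * P * P * z)%Z with ((w * P * P * z + D * (y * z + v)) - D * (y * z + v))%Z by ring.
          apply Z.divide_sub_r; [exact H|]. apply Z.divide_mul_l, HpD. }
        apply prime_mult in H1; [|exact Hp]. destruct H1 as [H1|H1]; [|contradiction].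
        apply prime_mult in H1; [|exact Hp]. destruct H1 as [H1|H1]; [|contradiction].
        apply prime_mult in H1; [|exact Hp]. destruct H1; contradiction. }
  apply (pow_divide_all p N); [destruct Hp; lia|exact HN|]. intros n.
  destruct (HB n) as [z [Ez Hz]]. destruct (Hb n) as [y Hy].
  apply (prime_pow_rel p z); [exact Hp|exact Hz|].
  assert (E : (N * z = y * rising f n * D ^ Z.of_nat n)%Z).
  { apply eq_IZR. rewrite !mult_IZR, <- Hy, <- Ez. unfold b. ring. }
  rewrite E. apply Z.divide_mul_r.
  destruct HpD as [c ->]. rewrite Z.pow_mul_l. apply Z.divide_factor_r.
Qed.

Lemma unbounded_not_dvd60 P Qd :
  (2 <= Qd)%Z -> Z.gcd P Qd = 1%Z -> ~ (Qd | 60)%Z -> ~ bsol (ratio P Qd).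
Proof.
  intros HQ Hg Hnd.
  set (g := Z.gcd Qd 60). assert (Hg0 : (0 < g)%Z).
  { assert (0 <= g)%Z by apply Z.gcd_nonneg. assert (g <> 0)%Z by (intros E; apply Z.gcd_eq_0_l in E; lia). lia. }
  destruct (Z.gcd_divide_l Qd 60) as [D HD]. destruct (Z.gcd_divide_r Qd 60) as [w Hw]. fold g in HD, Hw.
  assert (HgDw : Z.gcd D w = 1%Z).
  { assert (E : (g * Z.gcd D w = g)%Z).
    { rewrite Z.gcd_comm, Z.mul_comm, <- Z.gcd_mul_mono_r_nonneg by lia. rewrite <- Hw, <- HD.
      unfold g. apply Z.gcd_comm. }
    nia. }
  assert (HD1 : (1 < D)%Z).
  { assert (D <> 1)%Z; [|nia]. intros ->. apply Hnd. exists w. lia. }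
  destruct (prime_divisor_exists D HD1) as [p [Hp HpD]].
  apply (unbounded_of_prime P Qd g D w p); try assumption; lia.
Qed.

(** * Hypergeometric expansion in 1/j *)

Lemma zps_inverse a b : zps a -> a O = 1 -> (a * b)%ps = qc 1 -> zps b.
Proof.
  intros Ha a0 H n. induction n as [n IH] using (well_founded_induction lt_wf).
  apply (f_equal (fun s => s n)) in H. rewrite pmul_split, a0 in H.
  assert (E : b n = qc 1 n - bsum (fun j => a (S j) * b (n - S j)%nat) n) by lra.
  rewrite E. apply isZ_sub; [apply (zps_qc 1)|].
  apply isZ_bsum. intros j Hj. apply isZ_mul; [apply Ha|apply IH; lia].
Qed.

(** This defines real powers of a series: c times the logarithmic derivative of a is that of a^c. *)
Lemma log_ode_exists (s : ps) : s O = 0 -> exists y : ps, y O = 1 /\ dq y = (s * y)%ps.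
Proof.
  intros s0.
  destruct (@ps_rec 1 (fun n y => bsum (fun j => s (S j) * y (n - S j)%nat) n / INR n)) as [y [y0 Hy]].
  { intros n a b H. f_equal. apply bsum_ext. intros j Hj. rewrite H by lia. reflexivity. }
  exists y. split; [exact y0|]. apply ps_ext. intros n. unfold dq. rewrite pmul_split, s0.
  destruct n as [|n]; [simpl; ring|]. rewrite (Hy (S n)) by lia. field. apply not_0_INR; lia.
Qed.

Lemma log_ode_unique (s x y : ps) :
  s O = 0 -> x O = y O -> dq x = (s * x)%ps -> dq y = (s * y)%ps -> x = y.
Proof.
  intros s0 H0 Hx Hy. apply ps_ext. intros n. induction n as [n IH] using (well_founded_induction lt_wf).
  destruct n as [|n]; [exact H0|].
  apply (f_equal (fun a => a (S n))) in Hx, Hy. unfold dq in Hx, Hy. rewrite pmul_split, s0 in Hx, Hy.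
  apply (Rmult_eq_reg_l (INR (S n))); [|apply not_0_INR; lia]. rewrite Hx, Hy.
  f_equal; [ring|]. apply bsum_ext. intros j Hj. rewrite IH by lia. reflexivity.
Qed.

(** Both sides satisfy q dz/dq = E_2 z, so the n-th coefficient of the difference z satisfies (n -
    1) z_n = 0 once the earlier ones vanish; n = 0 and n = 1 are checked directly. *)
Lemma discriminant :
  exists phi : ps, zps phi /\ phi O = 1 /\ dq phi = ((eis2 - qc 1) * phi)%ps /\
    (eis4 * eis4 * eis4 - eis6 * eis6)%ps = (qc 1728 * (qX * phi))%ps.
Proof.
  destruct (eta_power 24) as [phi [Hz [p0 Hp]]].
  rewrite (cst_Q (24 / 24) 1) in Hp by (q2r; field).
  assert (Hp' : dq phi = ((eis2 - qc 1) * phi)%ps) by (rewrite Hp; ring).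
  exists phi. split; [exact Hz|]. split; [exact p0|]. split; [exact Hp'|].
  set (z := (eis4 * eis4 * eis4 - eis6 * eis6 - qc 1728 * (qX * phi))%ps).
  assert (Hdz : dq z = (eis2 * z)%ps).
  { unfold z. dq_simpl. rewrite ramanujan4, ramanujan6, dq_qX, Hp'. ring. }
  destruct eis_coef1 as [e2 [e4 e6]].
  assert (Z : forall n, z n = 0).
  { induction n as [n IH] using (well_founded_induction lt_wf).
    destruct n as [|[|n]].
    - unfold z, psub. rewrite !pmul_coef0, eis4_0, eis6_0. simpl qX. ring.
    - unfold z, psub. rewrite qc_mul_coef, qX_mul_S, p0. unfold pmul. simpl.
      rewrite eis4_0, eis6_0, e4, e6. unfold Q2R. simpl. field.
    - apply (f_equal (fun a => a (S (S n)))) in Hdz. unfold dq in Hdz.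
      rewrite pmul_coef_low, eis2_0 in Hdz by exact IH.
      assert (2 <= INR (S (S n))) by (rewrite !S_INR; pose proof (pos_INR n); lra). nra. }
  apply ps_eq_sub. apply ps_ext. intros n. fold z. rewrite Z. unfold qc, cst, Q2R. destruct n; simpl; ring.
Qed.

(* t = 1/j, with logarithmic derivative w = E6/E4 *)
Lemma hauptmodul :
  exists tau w : ps, zps tau /\ tau O = 1 /\ w O = 1 /\
    dq tau = ((w - qc 1) * tau)%ps /\
    dq w = (qc (1#6) * eis2 * w - qc (1#2) * eis4 + qc (1#3) * w * w)%ps /\
    (w * w)%ps = (eis4 * (qc 1 - qc 1728 * (qX * tau)))%ps.
Proof.
  destruct discriminant as [phi [Hz [p0 [Hp HD]]]].
  destruct (ps_inv eis4) as [eps Heps]; [rewrite eis4_0; lra|].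
  assert (He0 : eps O = 1).
  { apply (f_equal (fun s => s O)) in Heps. rewrite pmul_coef0, eis4_0 in Heps.
    unfold qc, cst, Q2R in Heps. simpl in Heps. lra. }
  assert (Hze : zps eps) by (apply (zps_inverse eis4); [apply zps_eis4|apply eis4_0|exact Heps]).
  assert (Hde : dq eps = (qc (1#3) * eps * (eis6 * eps - eis2))%ps).
  { apply (pmul_cancel eis4); [rewrite eis4_0; lra|].
    assert (E : dq (eis4 * eps) = qc 0) by (rewrite Heps; apply dq_qc).
    rewrite dq_mul, ramanujan4 in E.
    transitivity ((qc (1 # 3) * (eis2 * eis4 - eis6) * eps + eis4 * dq eps)
       - qc (1#3) * (eis2 * (eis4 * eps) - eis6 * eps))%ps; [ring|]. rewrite E, Heps.
    transitivity (qc (1#3) * (eis4 * eps) * (eis6 * eps - eis2))%ps; [rewrite Heps; ring|ring]. }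
  (* [eps] is 1 / E_4 and q [phi] is the discriminant, so q times the first witness is 1/j. *)
  exists (phi * eps * eps * eps)%ps, (eis6 * eps)%ps.
  split; [repeat apply zps_mul; assumption|].
  split; [rewrite !pmul_coef0, p0, He0; ring|].
  split; [rewrite pmul_coef0, eis6_0, He0; ring|].
  split; [dq_simpl; rewrite Hp, Hde; ring|].
  split.
  - dq_simpl. rewrite ramanujan6, Hde.
    transitivity (qc (1#6) * eis2 * (eis6 * eps) - qc (1#2) * eis4 * (eis4 * eps)
       + qc (1#3) * (eis6 * eps) * (eis6 * eps))%ps; [ring|]. rewrite Heps. ring.
  - transitivity ((eis4 * eis4 * eis4 - qc 1728 * (qX * phi)) * eps * eps)%ps.
    + rewrite <- HD. ring.
    + transitivity (eis4 * (eis4 * eps) * (eis4 * eps) - qc 1728 * (qX * phi) * eps * eps)%ps; [ring|].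
      rewrite Heps.
      transitivity (eis4 * (qc 1 - qc 1728 * (qX * (phi * eps * eps * eps)))
         - qc 1728 * (qX * phi) * eps * eps * (qc 1 - eis4 * eps))%ps; [ring|].
      rewrite Heps. ring.
Qed.

(** * Composition with a series without constant term, and the hypergeometric series *)

Fixpoint hcut (t : ps) (h : nat -> R) (N : nat) : ps :=
  match N with O => (cst (h O))%ps | S m => (hcut t h m + cst (h (S m)) * ppow t (S m))%ps end.

(* the composition h(t), for [t O = 0]: then the coefficient of q^n only involves t^k for k <= n *)
Definition hcomp (t : ps) (h : nat -> R) : ps := fun n => hcut t h n n.

Lemma ppow_low t n : t O = 0 -> forall k, (k < n)%nat -> ppow t n k = 0.
Proof.
  intros t0. induction n as [|n IH]; intros k Hk; [lia|]. simpl.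
  destruct (Nat.eq_dec k n) as [->|Hne].
  - rewrite pmul_coef_low by exact IH. rewrite t0. ring.
  - apply (pmul_low0 t (ppow t n) n IH). lia.
Qed.

Lemma hcut_stable t h N n : t O = 0 -> (n <= N)%nat -> hcut t h N n = hcomp t h n.
Proof.
  intros t0. induction N as [|N IH]; intros Hn; [replace n with O by lia; reflexivity|].
  destruct (Nat.eq_dec n (S N)) as [->|Hne]; [reflexivity|].
  change (hcut t h (S N)) with (hcut t h N + cst (h (S N)) * ppow t (S N))%ps. unfold padd.
  rewrite IH by lia. rewrite cst_mul_coef, ppow_low by (assumption || lia). ring.
Qed.

Lemma hcomp_scal t c h : hcomp t (fun n => c * h n) = (cst c * hcomp t h)%ps.
Proof.
  assert (E : forall N, hcut t (fun n => c * h n) N = (cst c * hcut t h N)%ps).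
  { induction N; simpl; [apply cst_mul|]. rewrite IHN, cst_mul. ring. }
  apply ps_ext. intros n. rewrite cst_mul_coef. unfold hcomp. rewrite E, cst_mul_coef. reflexivity.
Qed.

Lemma hcomp_add t h g : hcomp t (fun n => h n + g n) = (hcomp t h + hcomp t g)%ps.
Proof.
  assert (E : forall N, hcut t (fun n => h n + g n) N = (hcut t h N + hcut t g N)%ps).
  { induction N; simpl; [apply cst_add|]. rewrite IHN, cst_add. ring. }
  apply ps_ext. intros n. unfold hcomp. rewrite E. reflexivity.
Qed.

Lemma dq_ppow t w n : dq t = (w * t)%ps -> dq (ppow t n) = (cst (INR n) * w * ppow t n)%ps.
Proof.
  intros H. induction n as [|n IH].
  - simpl. rewrite dq_qc. rewrite (cst_Q 0 0) by (q2r; field). ring.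
  - simpl ppow. rewrite dq_mul, H, IH, S_INR, cst_add, (cst_Q 1 1) by (q2r; field). ring.
Qed.

Lemma hcomp_dq t w h :
  t O = 0 -> dq t = (w * t)%ps -> dq (hcomp t h) = (w * hcomp t (fun n => (INR n * h n)%R))%ps.
Proof.
  intros t0 H.
  assert (E : forall N, dq (hcut t h N) = (w * hcut t (fun n => INR n * h n)%R N)%ps).
  { induction N.
    - simpl. rewrite dq_cst, Rmult_0_l, (cst_Q 0 0) by (q2r; field). ring.
    - change (hcut t h (S N)) with (hcut t h N + cst (h (S N)) * ppow t (S N))%ps.
      change (hcut t (fun n => INR n * h n)%R (S N)) with
        (hcut t (fun n => INR n * h n)%R N + cst (INR (S N) * h (S N)) * ppow t (S N))%ps.
      rewrite dq_add, dq_mul, IHN, dq_cst, (dq_ppow t w) by exact H. rewrite cst_mul. ring. }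
  apply ps_ext. intros n. transitivity (dq (hcut t h n) n); [reflexivity|]. rewrite E.
  apply pmul_ext_low; [reflexivity|]. intros k Hk. apply hcut_stable; assumption.
Qed.

Lemma hcomp_shift t h :
  t O = 0 -> (t * hcomp t h)%ps = hcomp t (fun n => match n with O => 0 | S m => h m end).
Proof.
  intros t0.
  assert (E : forall N, (t * hcut t h N)%ps = hcut t (fun n => match n with O => 0 | S m => h m end) (S N)).
  { induction N.
    - simpl. rewrite (cst_Q 0 0) by (q2r; field). ring.
    - change (hcut t h (S N)) with (hcut t h N + cst (h (S N)) * ppow t (S N))%ps.
      transitivity (t * hcut t h N + cst (h (S N)) * (t * ppow t (S N)))%ps; [ring|].
      rewrite IHN. reflexivity. }
  apply ps_ext. intros n. rewrite <- (hcut_stable t _ (S n)) by (assumption || lia).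
  rewrite <- E. apply pmul_ext_low; [reflexivity|].
  intros k Hk. symmetry. apply hcut_stable; assumption.
Qed.

Lemma hcomp_ext t h g : (forall n, h n = g n) -> hcomp t h = hcomp t g.
Proof. intros H. f_equal. apply functional_extensionality. exact H. Qed.

(** The coefficients of 2F1(al, al + 1/3; 1 + r; 1728 t) with al = 1/12 + r/2. *)
Fixpoint hyper (r : R) (n : nat) : R :=
  match n with
  | O => 1
  | S m => 1728 * (INR m + (/ 12 + r / 2)) * (INR m + (/ 12 + r / 2) + / 3)
           / (INR (S m) * (INR (S m) + r)) * hyper r m
  end.

Lemma hyper_rec r n :
  indicial r ->
  INR (S n) * (INR (S n) + r) * hyper r (S n)
  = 1728 * (INR n + (/ 12 + r / 2)) * (INR n + (/ 12 + r / 2) + / 3) * hyper r n.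
Proof.
  intros Hr. change (hyper r (S n)) with (1728 * (INR n + (/ 12 + r / 2)) * (INR n + (/ 12 + r / 2) + / 3)
           / (INR (S n) * (INR (S n) + r)) * hyper r n).
  field. split; [apply Hr; lia|apply not_0_INR; lia].
Qed.

(** [beta] is tau^al, so that q^al [beta] = t^al. As q d/dq = w t d/dt and w^2 = E_4 (1 - 1728 t),
    the equation in q is E_4 times the hypergeometric equation in t. *)
Lemma hyper_solution r tau w beta :
  indicial r -> let t := (qX * tau)%ps in
  dq tau = ((w - qc 1) * tau)%ps ->
  dq w = (qc (1#6) * eis2 * w - qc (1#2) * eis4 + qc (1#3) * w * w)%ps ->
  (w * w)%ps = (eis4 * (qc 1 - qc 1728 * t))%ps ->
  dq beta = (cst (/ 12 + r / 2) * (w - qc 1) * beta)%ps ->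
  ode 0 (kone r) (/ 12 + r / 2) (beta * hcomp t (hyper r)).
Proof.
  intros Hr t Htau Hw Hww Hb. set (al := / 12 + r / 2) in *.
  assert (t0 : t O = 0) by apply qX_mul_0.
  assert (Ht : dq t = (w * t)%ps) by (unfold t; rewrite dq_mul, dq_qX, Htau; ring).
  (* [V] and [V2] are t d/dt applied once and twice to t^al h(t), with t^al divided out. *)
  set (U := hcomp t (hyper r)). set (V := hcomp t (fun n => (INR n + al) * hyper r n)).
  set (V2 := hcomp t (fun n => (INR n + al) * ((INR n + al) * hyper r n))).
  assert (HU : forall h, (dq (hcomp t h) = w * hcomp t (fun n => ((INR n + al) * h n)%R) - cst al * w * hcomp t h)%ps).
  { intros h. rewrite (hcomp_dq t w) by assumption.
    replace (hcomp t (fun n => (INR n + al) * h n)) with (hcomp t (fun n => (INR n * h n)%R) + cst al * hcomp t h)%ps.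
    - ring.
    - rewrite <- hcomp_scal, <- hcomp_add. apply hcomp_ext. intros n. ring. }
  assert (HdU : dq U = (w * V - cst al * w * U)%ps) by apply HU.
  assert (HdV : dq V = (w * V2 - cst al * w * V)%ps) by apply HU.
  assert (Hrec : (V2 - qc (1#6) * V - cst (kone r) * U = qc 1728 * t * (V2 + qc (1#3) * V))%ps).
  { transitivity (hcomp t (fun n => INR n * (INR n + r) * hyper r n)).
    - unfold V2, V, U. unfold qc.
      transitivity (hcomp t (fun n => ((INR n + al) * ((INR n + al) * hyper r n))%R)
         + cst (- Q2R (1#6))%R * hcomp t (fun n => ((INR n + al) * hyper r n)%R)
         + cst (- kone r)%R * hcomp t (hyper r))%ps; [rewrite !cst_opp; ring|].
      rewrite <- !hcomp_scal, <- !hcomp_add. apply hcomp_ext. intros n.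
      rewrite <- (indicial_value r n). fold al. q2r. field.
    - transitivity (t * hcomp t (fun n => (1728 * ((INR n + al) * (INR n + al + / 3) * hyper r n))%R))%ps.
      + rewrite hcomp_shift by exact t0. apply hcomp_ext. intros [|n]; [simpl; ring|].
        rewrite hyper_rec by exact Hr. fold al. ring.
      + rewrite hcomp_scal, (cst_Q 1728 1728) by (q2r; field).
        replace (V2 + qc (1#3) * V)%ps with (hcomp t (fun n => ((INR n + al) * (INR n + al + / 3) * hyper r n)%R)).
        * ring.
        * unfold V2, V, qc. rewrite <- hcomp_scal, <- hcomp_add. apply hcomp_ext. intros n. q2r. field. }
  unfold ode, Dk.
  rewrite (cst_Q (0 / 12) 0), (cst_Q ((0 + 2) / 12) (1#6)) by (q2r; field).
  assert (E1 : dqe al (beta * U) = (beta * w * V)%ps).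
  { unfold dqe. rewrite dq_mul, Hb, HdU. ring. }
  replace (dqe al (beta * U) - qc 0 * eis2 * (beta * U))%ps with (beta * w * V)%ps by (rewrite E1; ring).
  transitivity (beta * (w * w * V2 + (qc (1#3) * (w * w) - qc (1#2) * eis4) * V))%ps.
  - unfold dqe. rewrite !dq_mul, Hb, Hw, HdV. ring.
  - rewrite Hww.
    transitivity (beta * eis4 * ((V2 - qc (1#6) * V) - qc 1728 * t * (V2 + qc (1#3) * V)))%ps; [ring|].
    rewrite <- Hrec. ring.
Qed.

(** * p-integrality *)

(** Membership in the localisation of Z at p. *)
Definition pint (p : Z) (x : R) : Prop := exists d : Z, ~ (p | d)%Z /\ isZ (IZR d * x).

Lemma prime_ndiv_mul p a b : prime p -> ~ (p | a)%Z -> ~ (p | b)%Z -> ~ (p | a * b)%Z.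
Proof. intros Hp Ha Hb H. apply prime_mult in H; tauto. Qed.
Lemma prime_ndiv_1 p : prime p -> ~ (p | 1)%Z.
Proof.
  intros Hp H. apply Z.divide_1_r_nonneg in H; [subst p; exact (not_prime_1 Hp)|]. destruct Hp; lia.
Qed.

Lemma pint_isZ p x : prime p -> isZ x -> pint p x.
Proof. intros Hp H. exists 1%Z. split; [apply prime_ndiv_1, Hp|]. rewrite Rmult_1_l. exact H. Qed.
Lemma pint_add p x y : prime p -> pint p x -> pint p y -> pint p (x + y).
Proof.
  intros Hp [d [Hd Hx]] [e [He Hy]]. exists (d * e)%Z. split; [apply prime_ndiv_mul; assumption|].
  replace (IZR (d * e) * (x + y)) with (IZR e * (IZR d * x) + IZR d * (IZR e * y)) by (rewrite mult_IZR; ring).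
  apply isZ_add; apply isZ_mul; auto using isZ_IZR.
Qed.
Lemma pint_mul p x y : prime p -> pint p x -> pint p y -> pint p (x * y).
Proof.
  intros Hp [d [Hd Hx]] [e [He Hy]]. exists (d * e)%Z. split; [apply prime_ndiv_mul; assumption|].
  replace (IZR (d * e) * (x * y)) with ((IZR d * x) * (IZR e * y)) by (rewrite mult_IZR; ring).
  apply isZ_mul; assumption.
Qed.
Lemma pint_sub p x y : prime p -> pint p x -> pint p y -> pint p (x - y).
Proof.
  intros Hp Hx Hy. replace (x - y) with (x + (-1) * y) by ring.
  apply pint_add; [exact Hp|exact Hx|]. apply pint_mul; [exact Hp|apply pint_isZ; [exact Hp|apply (isZ_IZR (-1))]|exact Hy].
Qed.
Lemma pint_bsum p f n : prime p -> (forall i, (i < n)%nat -> pint p (f i)) -> pint p (bsum f n).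
Proof.
  intros Hp H. induction n as [|n IH]; simpl; [apply pint_isZ; [exact Hp|apply (isZ_IZR 0)]|].
  apply pint_add; [exact Hp|apply IH; intros; apply H; lia|apply H; lia].
Qed.
Lemma pint_unit p z x : ~ (p | z)%Z -> prime p -> pint p (IZR z * x) -> pint p x.
Proof.
  intros Hz Hp [d [Hd Hx]]. exists (d * z)%Z. split; [apply prime_ndiv_mul; assumption|].
  rewrite mult_IZR, Rmult_assoc. exact Hx.
Qed.

Definition pps (p : Z) (a : ps) : Prop := forall n, pint p (a n).
Lemma pps_mul p a b : prime p -> pps p a -> pps p b -> pps p (a * b).
Proof. intros Hp Ha Hb n. apply pint_bsum; [exact Hp|]. intros. apply pint_mul; auto. Qed.
Lemma pps_zps p a : prime p -> zps a -> pps p a.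
Proof. intros Hp Ha n. apply pint_isZ; auto. Qed.
Lemma pps_ppow p a n : prime p -> pps p a -> pps p (ppow a n).
Proof.
  intros Hp Ha. induction n; simpl; [apply pps_zps; [exact Hp|apply (zps_qc 1)]|apply pps_mul; assumption].
Qed.

(** Deleting the coefficient y_n changes the n-th coefficient of y^M by exactly M y_n, since y
    starts with 1. The last two conjuncts serve the induction. *)
Lemma ppow_perturb (y z : ps) n M :
  y O = 1 -> (forall k, (k < n)%nat -> z k = y k) -> z n = 0 -> (1 <= n)%nat ->
  ppow y M n = ppow z M n + INR M * y n /\ (forall k, (k < n)%nat -> ppow z M k = ppow y M k)
  /\ ppow y M O = 1.
Proof.
  intros y0 Hz zn Hn. induction M as [|M [IH1 [IH2 IH3]]].
  - simpl. split; [ring|]. split; [reflexivity|]. unfold qc, cst, Q2R. simpl. field.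
  - split; [|split].
    + simpl ppow. rewrite S_INR. destruct n as [|n]; [lia|].
      assert (E : forall a b : ps, (a * b)%ps (S n) = a O * b (S n)
          + bsum (fun j => a (S j) * b (n - j)%nat) n + a (S n) * b O).
      { intros a b. rewrite pmul_split. simpl. rewrite Nat.sub_diag. ring. }
      rewrite !E. rewrite zn, (Hz O) by lia. rewrite y0, IH1, IH3.
      rewrite (bsum_ext (fun j => z (S j) * ppow z M (n - j)%nat) (fun j => y (S j) * ppow y M (n - j)%nat)).
      * ring.
      * intros j Hj. rewrite Hz, IH2 by lia. reflexivity.
    + intros k Hk. simpl. apply pmul_ext_low; intros; [apply Hz|apply IH2]; lia.
    + simpl. rewrite pmul_coef0, y0, IH3. ring.
Qed.

(** By [ppow_perturb], M y_n is a p-integral expression in y^M and the earlier coefficients, and M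
    is a unit at p. *)
Lemma pps_root p (y : ps) (M : nat) :
  prime p -> ~ (p | Z.of_nat M)%Z -> y O = 1 -> pps p (ppow y M) -> pps p y.
Proof.
  intros Hp HM y0 H n. induction n as [n IH] using (well_founded_induction lt_wf).
  destruct n as [|n]; [rewrite y0; apply pint_isZ; [exact Hp|apply (isZ_IZR 1)]|].
  set (z := fun k => if Nat.ltb k (S n) then y k else 0).
  destruct (ppow_perturb y z (S n) M y0) as [E _].
  - intros k Hk. unfold z. replace (Nat.ltb k (S n)) with true by (symmetry; apply Nat.ltb_lt; lia). reflexivity.
  - unfold z. rewrite Nat.ltb_irrefl. reflexivity.
  - lia.
  - apply (pint_unit p (Z.of_nat M)); [exact HM|exact Hp|]. rewrite <- INR_IZR_INZ.
    replace (INR M * y (S n)) with (ppow y M (S n) - ppow z M (S n)) by lra.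
    apply pint_sub; [exact Hp|apply H|]. apply pps_ppow; [exact Hp|].
    intros k. unfold z. destruct (Nat.ltb_spec k (S n)).
    + apply IH. assumption.
    + apply pint_isZ; [exact Hp|apply (isZ_IZR 0)].
Qed.

Lemma ppow_0 a n : a O = 1 -> ppow a n O = 1.
Proof.
  intros H. induction n; simpl; [unfold qc, cst, Q2R; simpl; field|]. rewrite pmul_coef0, H, IHn. ring.
Qed.

(* tau^(A/120) is p-integral: its 120th power is integral, and p does not divide 120 *)
Lemma pps_log_power p (tau s y : ps) (A : Z) :
  prime p -> ~ (p | 120)%Z -> zps tau -> tau O = 1 -> s O = 0 -> dq tau = (s * tau)%ps ->
  y O = 1 -> dq y = (cst (IZR A / 120) * s * y)%ps -> pps p y.
Proof.
  intros Hp H120 Hz t0 s0 Ht y0 Hy.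
  destruct (ps_inv tau) as [sig' Hs]; [lra|].
  assert (sig0 : sig' O = 1).
  { apply (f_equal (fun a => a O)) in Hs. rewrite pmul_coef0, t0 in Hs.
    unfold qc, cst, Q2R in Hs. simpl in Hs. lra. }
  assert (Hdsig : dq sig' = (- (s * sig'))%ps).
  { apply (pmul_cancel tau); [lra|].
    assert (E : dq (tau * sig') = qc 0) by (rewrite Hs; apply dq_qc).
    rewrite dq_mul, Ht in E.
    transitivity (s * tau * sig' + tau * dq sig' - s * (tau * sig'))%ps; [ring|].
    rewrite E. ring. }
  (* The natural number 120 is kept abstract, so that [ppow y M] is never unfolded. *)
  assert (HM : exists M : nat, Z.of_nat M = 120%Z) by (exists (Z.to_nat 120); apply Z2Nat.id; lia).
  destruct HM as [M HM].
  apply (pps_root p y M); [exact Hp|rewrite HM; exact H120|exact y0|].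
  assert (Hpw : forall (a u : ps) n, dq a = (u * a)%ps -> dq (ppow a n) = (cst (INR n) * u * ppow a n)%ps)
    by (intros; apply dq_ppow; assumption).
  assert (HY : dq (ppow y M) = (cst (IZR A) * s * ppow y M)%ps).
  { rewrite (Hpw y (cst (IZR A / 120) * s)%ps) by exact Hy.
    replace (cst (IZR A)) with (cst (INR M) * cst (IZR A / 120))%ps; [ring|].
    rewrite <- cst_mul. f_equal. rewrite INR_IZR_INZ, HM. field. }
  assert (Hs0 : forall c, (cst c * s)%ps O = 0) by (intros c; rewrite pmul_coef0, s0; ring).
  destruct (Z_le_gt_dec 0 A) as [HA|HA].
  - replace (ppow y M) with (ppow tau (Z.to_nat A)); [apply pps_zps; [exact Hp|apply zps_ppow, Hz]|].
    apply (log_ode_unique (cst (IZR A) * s)); [apply Hs0|rewrite !ppow_0 by assumption; reflexivity| |exact HY].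
    rewrite (Hpw tau s) by exact Ht. rewrite INR_IZR_INZ, Z2Nat.id by exact HA. reflexivity.
  - replace (ppow y M) with (ppow sig' (Z.to_nat (- A))).
    + apply pps_zps; [exact Hp|]. apply zps_ppow, (zps_inverse tau); assumption.
    + apply (log_ode_unique (cst (IZR A) * s)); [apply Hs0|rewrite !ppow_0 by assumption; reflexivity| |exact HY].
      rewrite (Hpw sig' (- s)%ps) by (rewrite Hdsig; ring).
      rewrite INR_IZR_INZ, Z2Nat.id by lia. rewrite opp_IZR, cst_opp. ring.
Qed.

Lemma ppow_qX_tau tau n : tau O = 1 -> ppow (qX * tau) n n = 1.
Proof.
  intros t0. induction n as [|n IH]; simpl; [unfold qc, cst, Q2R; simpl; field|].
  replace (qX * tau * ppow (qX * tau) n)%ps with (qX * (tau * ppow (qX * tau) n))%ps by ring.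
  rewrite qX_mul_S, pmul_coef_low, t0, IH; [ring|].
  apply ppow_low, qX_mul_0.
Qed.

(** The n-th power of q tau has integral coefficients and starts with q^n, so the coefficients of h
    are recovered from h(q tau) by a unitriangular integral system. *)
Lemma hcomp_pps_inv p c tau h :
  prime p -> zps tau -> tau O = 1 -> (forall n, pint p (c * hcomp (qX * tau) h n)) ->
  forall n, pint p (c * h n).
Proof.
  intros Hp Hz t0 H n. induction n as [n IH] using (well_founded_induction lt_wf).
  assert (HzX : zps (qX * tau)).
  { apply zps_mul; [intros [|[|m]]; [exists 0%Z|exists 1%Z|exists 0%Z]; reflexivity|exact Hz]. }
  destruct n as [|n].
  - specialize (H O). exact H.
  - specialize (H (S n)). unfold hcomp in H.
    change (hcut (qX * tau) h (S n)) with (hcut (qX * tau) h n + cst (h (S n)) * ppow (qX * tau) (S n))%ps in H.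
    unfold padd in H. rewrite cst_mul_coef, ppow_qX_tau in H by exact t0.
    assert (Hlow : forall N m, (N <= n)%nat -> pint p (c * hcut (qX * tau) h N m)).
    { induction N as [|N IHN]; intros m HN.
      - change (hcut (qX * tau) h 0 m) with (cst (h O) m). destruct m; simpl; [apply IH; lia|].
        rewrite Rmult_0_r. apply pint_isZ; [exact Hp|apply (isZ_IZR 0)].
      - change (hcut (qX * tau) h (S N)) with (hcut (qX * tau) h N + cst (h (S N)) * ppow (qX * tau) (S N))%ps.
        unfold padd. rewrite cst_mul_coef, Rmult_plus_distr_l, <- Rmult_assoc.
        apply pint_add; [exact Hp|apply IHN; lia|]. apply pint_mul; [exact Hp|apply IH; lia|].
        apply pint_isZ; [exact Hp|apply zps_ppow, HzX]. }
    replace (c * h (S n)) with (c * (hcut (qX * tau) h n (S n) + h (S n) * 1) - c * hcut (qX * tau) h n (S n)) by ring.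
    apply pint_sub; [exact Hp|exact H|apply Hlow; lia].
Qed.

(** By uniqueness G = tau^(A/120) h(t). Both tau^(-A/120) and the passage from q to t preserve
    p-integrality, so a denominator bound for G holds for h up to units at p. *)
Lemma bsol_hyper p (A : Z) (r : R) :
  prime p -> ~ (p | 120)%Z -> indicial r -> / 12 + r / 2 = IZR A / 120 -> bsol r ->
  exists N : Z, N <> 0%Z /\ forall n, pint p (IZR N * hyper r n).
Proof.
  intros Hp H120 Hr HA [G [G0 [[N [HN Hb]] HG]]].
  destruct hauptmodul as [tau [w [Hz [t0 [w0 [Htau [Hw Hww]]]]]]].
  set (s := (w - qc 1)%ps).
  assert (s0 : s O = 0) by (unfold s, psub; rewrite w0; unfold qc, cst, Q2R; simpl; field).
  assert (Hs0 : forall c, (cst c * s)%ps O = 0) by (intros c; rewrite pmul_coef0, s0; ring).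
  destruct (log_ode_exists (cst (IZR A / 120) * s) (Hs0 _)) as [be [b0 Hbe]].
  destruct (log_ode_exists (cst (IZR (- A) / 120) * s) (Hs0 _)) as [ga [g0 Hga]].
  assert (Hbg : (ga * be)%ps = qc 1).
  { apply (log_ode_unique (qc 0)).
    - unfold qc, cst, Q2R. simpl. ring.
    - rewrite pmul_coef0, b0, g0. unfold qc, cst, Q2R. simpl. field.
    - rewrite dq_mul, Hbe, Hga. rewrite opp_IZR. replace (- IZR A / 120) with (- (IZR A / 120)) by field.
      rewrite cst_opp. ring.
    - rewrite dq_qc. ring. }
  pose proof (pps_log_power p tau s ga (- A) Hp H120 Hz t0 s0 Htau g0 Hga) as Hpg.
  exists N. split; [exact HN|].
  apply (hcomp_pps_inv p (IZR N) tau); [exact Hp|exact Hz|exact t0|].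
  assert (E : G = (be * hcomp (qX * tau) (hyper r))%ps).
  { pose proof (hyper_solution r tau w be Hr Htau Hw Hww) as HS. rewrite HA in HS. specialize (HS Hbe).
    rewrite <- HA in HS.
    apply ps_ext. intros n.
    assert (H0 : (be * hcomp (qX * tau) (hyper r))%ps O = 1).
    { rewrite pmul_coef0, b0. unfold hcomp. simpl. ring. }
    rewrite (frobenius_unique r _ G Hr HS HG); rewrite H0; [|lra]. rewrite G0. field. }
  intros n.
  replace (hcomp (qX * tau) (hyper r)) with (ga * G)%ps.
  - replace (IZR N * (ga * G)%ps n) with ((ga * (cst (IZR N) * G))%ps n).
    + apply pps_mul; [exact Hp|exact Hpg|]. intros m. rewrite cst_mul_coef. apply pint_isZ; [exact Hp|apply Hb].
    + replace (ga * (cst (IZR N) * G))%ps with (cst (IZR N) * (ga * G))%ps by ring. apply cst_mul_coef.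
  - rewrite E. transitivity (ga * be * hcomp (qX * tau) (hyper r))%ps; [ring|]. rewrite Hbg. ring.
Qed.

(** * Powers of a prime in hypergeometric coefficients *)

(* 120^n times the rising factorial of X/120 *)
Definition poch (X : Z) (n : nat) : Z := rising (fun i => (X + 120 * Z.of_nat i)%Z) n.

(** p divides X + 120 j exactly when j = i + p k, and then the factor is p (X' + 120 k); [e] counts
    these j below m. *)
Lemma poch_dwork (p : nat) (X X' : Z) (i : nat) :
  prime (Z.of_nat p) -> ~ (Z.of_nat p | 120)%Z -> (i < p)%nat ->
  (Z.of_nat p * X' = X + 120 * Z.of_nat i)%Z ->
  forall m, let e := ((m + p - 1 - i) / p)%nat in
    exists u, ~ (Z.of_nat p | u)%Z /\ (poch X m = Z.of_nat p ^ Z.of_nat e * u * poch X' e)%Z.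
Proof.
  intros Hp H120 Hi HX. set (pz := Z.of_nat p) in *.
  assert (Hp2 : (2 <= p)%nat) by (destruct Hp; unfold pz in *; lia).
  induction m as [|m [u [Hu IH]]].
  - exists 1%Z. split; [apply prime_ndiv_1, Hp|].
    rewrite Nat.div_small by lia. reflexivity.
  - change (poch X (S m)) with (poch X m * (X + 120 * Z.of_nat m))%Z. rewrite IH.
    set (e := ((m + p - 1 - i) / p)%nat) in *.
    pose proof (Nat.div_mod_eq (m + p - 1 - i) p) as E. fold e in E.
    pose proof (Nat.mod_upper_bound (m + p - 1 - i) p) as B.
    set (v := ((m + p - 1 - i) mod p)%nat) in *.
    destruct (Nat.eq_dec v (p - 1)) as [Hv|Hv].
    + assert (Em : (m = i + p * e)%nat) by lia.
      replace ((S m + p - 1 - i) / p)%nat with (S e).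
      2: { apply (Nat.div_unique _ _ _ 0); [lia|nia]. }
      exists u. split; [exact Hu|].
      change (poch X' (S e)) with (poch X' e * (X' + 120 * Z.of_nat e))%Z.
      rewrite Nat2Z.inj_succ, Z.pow_succ_r by lia.
      replace (X + 120 * Z.of_nat m)%Z with (pz * (X' + 120 * Z.of_nat e))%Z.
      * ring.
      * rewrite Em, Nat2Z.inj_add, Nat2Z.inj_mul. fold pz. rewrite Z.mul_add_distr_l, HX. ring.
    + replace ((S m + p - 1 - i) / p)%nat with e.
      2: { apply (Nat.div_unique _ _ _ (S v)); lia. }
      exists (u * (X + 120 * Z.of_nat m))%Z. split; [|ring].
      apply prime_ndiv_mul; [exact Hp|exact Hu|]. intros Hd.
      assert (H1 : (pz | 120 * (Z.of_nat m - Z.of_nat i))%Z).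
      { replace (120 * (Z.of_nat m - Z.of_nat i))%Z with ((X + 120 * Z.of_nat m) - pz * X')%Z by (rewrite HX; ring).
        apply Z.divide_sub_r; [exact Hd|apply Z.divide_factor_l]. }
      apply prime_mult in H1; [|exact Hp]. destruct H1 as [H1|H1]; [contradiction|].
      apply Hv. destruct H1 as [c Hc].
      assert (E2 : Z.of_nat v = (Z.of_nat m + pz - 1 - Z.of_nat i - pz * Z.of_nat e)%Z) by (unfold pz; nia).
      assert (E3 : (Z.of_nat v = pz * (c + 1 - Z.of_nat e) - 1)%Z) by nia.
      assert (0 <= Z.of_nat v < pz)%Z by (unfold pz; lia).
      assert (c + 1 - Z.of_nat e = 1)%Z by nia. unfold pz in *. nia.
Qed.

(** In the incomplete block of length d, one further factor is divisible by p exactly when i < d. *)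
Lemma poch_block (p : nat) (X X' : Z) (i n d : nat) :
  prime (Z.of_nat p) -> ~ (Z.of_nat p | 120)%Z -> (i < p)%nat ->
  (Z.of_nat p * X' = X + 120 * Z.of_nat i)%Z -> (d < p)%nat ->
  exists u, ~ (Z.of_nat p | u)%Z /\
    let e := if Nat.ltb i d then S n else n in
    (poch X (p * n + d) = Z.of_nat p ^ Z.of_nat e * u * poch X' e)%Z.
Proof.
  intros Hp H120 Hi HX Hd.
  destruct (poch_dwork p X X' i Hp H120 Hi HX (p * n + d)) as [u [Hu E]].
  exists u. split; [exact Hu|]. cbv zeta.
  replace ((p * n + d + p - 1 - i) / p)%nat with (if Nat.ltb i d then S n else n) in E; [exact E|].
  destruct (Nat.ltb_spec i d).
  - apply (Nat.div_unique _ _ _ (d - 1 - i)); lia.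
  - apply (Nat.div_unique _ _ _ (d + p - 1 - i)); lia.
Qed.

Definition triple := (Z * Z * Z)%type.

(* p^k divides the denominator of some coefficient of the hypergeometric series
   with parameters A/120, B/120; C/120 *)
Definition deep (p : nat) (T : triple) (k : nat) : Prop :=
  let '(A, B, C) := T in
  exists (n : nat) (u v : Z), ~ (Z.of_nat p | u)%Z /\
    (u * (poch C n * poch 120 n) = Z.of_nat p ^ Z.of_nat k * v * (poch A n * poch B n))%Z.

(** The lowest p-adic digit of -X/120. The value p stands for a failed search and is ruled out by
    [valid]. *)
Definition digit (p : nat) (X : Z) : nat :=
  match find (fun i => (X + 120 * Z.of_nat i) mod Z.of_nat p =? 0)%Z (seq 0 p) with
  | Some i => i | None => p end.
(** Dwork's map on the numerator of X/120. *)
Definition dwork (p : nat) (X : Z) : Z := ((X + 120 * Z.of_nat (digit p X)) / Z.of_nat p)%Z.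
Definition dworkT (p : nat) (T : triple) : triple :=
  let '(A, B, C) := T in (dwork p A, dwork p B, dwork p C).
Definition valid (p : nat) (T : triple) : bool :=
  let '(A, B, C) := T in
  (Nat.ltb (digit p A) p && Nat.ltb (digit p B) p && Nat.ltb (digit p C) p)%bool.
Definition gains (p : nat) (T : triple) : bool :=
  let '(A, B, C) := T in
  (Nat.ltb (digit p C) (digit p A) && Nat.ltb (digit p C) (digit p B))%bool.

Lemma dwork_spec p X :
  (1 <= p)%nat -> (digit p X < p)%nat -> (Z.of_nat p * dwork p X = X + 120 * Z.of_nat (digit p X))%Z.
Proof.
  intros Hp H. unfold dwork.
  assert (E : ((X + 120 * Z.of_nat (digit p X)) mod Z.of_nat p = 0)%Z).
  { unfold digit in *. destruct (find _ (seq 0 p)) eqn:F; [|lia].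
    apply find_some in F. destruct F as [_ F]. apply Z.eqb_eq in F. exact F. }
  pose proof (Z.div_mod (X + 120 * Z.of_nat (digit p X)) (Z.of_nat p)). lia.
Qed.

(** The parameter 120/120 = 1 is fixed by Dwork's map and has digit p - 1, so no further factor
    occurs for d < p. *)
Lemma poch_block_120 (p n d : nat) :
  prime (Z.of_nat p) -> ~ (Z.of_nat p | 120)%Z -> (d < p)%nat ->
  exists u, ~ (Z.of_nat p | u)%Z /\ (poch 120 (p * n + d) = Z.of_nat p ^ Z.of_nat n * u * poch 120 n)%Z.
Proof.
  intros Hp H120 Hd.
  destruct (poch_block p 120 120 (p - 1) n d Hp H120) as [u [Hu E]]; [lia|lia|exact Hd|].
  exists u. split; [exact Hu|]. cbv zeta in E.
  replace (Nat.ltb (p - 1) d) with false in E by (symmetry; apply Nat.ltb_ge; lia). exact E.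
Qed.

(** At the index p n all four Pochhammer symbols acquire the same power p^n, which cancels. *)
Lemma deep_step (p : nat) (T : triple) (k : nat) :
  prime (Z.of_nat p) -> ~ (Z.of_nat p | 120)%Z -> valid p T = true ->
  deep p (dworkT p T) k -> deep p T k.
Proof.
  intros Hp H120 Hv. destruct T as [[A B] C]. unfold valid in Hv.
  rewrite !Bool.andb_true_iff, !Nat.ltb_lt in Hv. destruct Hv as [[HA HB] HC].
  intros [n [u [v [Hu E]]]].
  assert (Hp1 : (1 <= p)%nat) by (destruct Hp; lia).
  destruct (poch_block p A _ _ n 0 Hp H120 HA (dwork_spec p A Hp1 HA)) as [uA [HuA EA]]; [lia|].
  destruct (poch_block p B _ _ n 0 Hp H120 HB (dwork_spec p B Hp1 HB)) as [uB [HuB EB]]; [lia|].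
  destruct (poch_block p C _ _ n 0 Hp H120 HC (dwork_spec p C Hp1 HC)) as [uC [HuC EC]]; [lia|].
  destruct (poch_block_120 p n 0 Hp H120) as [u1 [Hu1 E1]]; [lia|].
  assert (L0 : forall i, Nat.ltb i 0 = false) by (intros; apply Nat.ltb_ge; lia).
  cbv zeta in EA, EB, EC. rewrite L0 in EA, EB, EC.
  exists (p * n + 0)%nat, (u * (uA * uB))%Z, (v * (uC * u1))%Z.
  split; [apply prime_ndiv_mul; [exact Hp|exact Hu|apply prime_ndiv_mul; assumption]|].
  rewrite EA, EB, EC, E1. set (q0 := (Z.of_nat p ^ Z.of_nat n)%Z).
  transitivity (q0 * q0 * uA * uB * uC * u1 * (u * (poch (dwork p C) n * poch 120 n)))%Z; [ring|].
  rewrite E. ring.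
Qed.

(** At the index p n + [digit p C] + 1 the symbol of C contains one more factor divisible by p, and
    those of A, B and 120 do not yet. *)
Lemma deep_gain (p : nat) (T : triple) (k : nat) :
  prime (Z.of_nat p) -> ~ (Z.of_nat p | 120)%Z -> valid p T = true -> gains p T = true ->
  deep p (dworkT p T) k -> deep p T (S k).
Proof.
  intros Hp H120 Hv Hg. destruct T as [[A B] C]. unfold valid in Hv. unfold gains in Hg.
  rewrite !Bool.andb_true_iff, !Nat.ltb_lt in Hv. destruct Hv as [[HA HB] HC].
  rewrite !Bool.andb_true_iff, !Nat.ltb_lt in Hg. destruct Hg as [HCA HCB].
  intros [n [u [v [Hu E]]]].
  assert (Hp1 : (1 <= p)%nat) by (destruct Hp; lia).
  set (d := S (digit p C)).
  assert (Hd : (d < p)%nat) by (unfold d; lia).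
  destruct (poch_block p A _ _ n d Hp H120 HA (dwork_spec p A Hp1 HA) Hd) as [uA [HuA EA]].
  destruct (poch_block p B _ _ n d Hp H120 HB (dwork_spec p B Hp1 HB) Hd) as [uB [HuB EB]].
  destruct (poch_block p C _ _ n d Hp H120 HC (dwork_spec p C Hp1 HC) Hd) as [uC [HuC EC]].
  destruct (poch_block_120 p n d Hp H120 Hd) as [u1 [Hu1 E1]].
  cbv zeta in EA, EB, EC.
  replace (Nat.ltb (digit p A) d) with false in EA by (symmetry; apply Nat.ltb_ge; unfold d; lia).
  replace (Nat.ltb (digit p B) d) with false in EB by (symmetry; apply Nat.ltb_ge; unfold d; lia).
  replace (Nat.ltb (digit p C) d) with true in EC by (symmetry; apply Nat.ltb_lt; unfold d; lia).
  change (poch (dwork p C) (S n)) with (poch (dwork p C) n * (dwork p C + 120 * Z.of_nat n))%Z in EC.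
  exists (p * n + d)%nat, (u * (uA * uB))%Z, (v * (uC * u1) * (dwork p C + 120 * Z.of_nat n))%Z.
  split; [apply prime_ndiv_mul; [exact Hp|exact Hu|apply prime_ndiv_mul; assumption]|].
  rewrite EA, EB, EC, E1, !Nat2Z.inj_succ, !Z.pow_succ_r by lia. set (q0 := (Z.of_nat p ^ Z.of_nat n)%Z).
  set (c := (dwork p C + 120 * Z.of_nat n)%Z).
  transitivity (Z.of_nat p * q0 * q0 * uA * uB * uC * u1 * c * (u * (poch (dwork p C) n * poch 120 n)))%Z; [ring|].
  rewrite E. ring.
Qed.

Definition iterT (p : nat) (m : nat) (T : triple) : triple := Nat.iter m (dworkT p) T.

Lemma deep_iter p T m k :
  prime (Z.of_nat p) -> ~ (Z.of_nat p | 120)%Z ->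
  (forall i, (i < m)%nat -> valid p (iterT p i T) = true) ->
  deep p (iterT p m T) k -> deep p T k.
Proof.
  intros Hp H120. induction m as [|m IH]; intros Hv H; [exact H|].
  apply IH; [intros; apply Hv; lia|]. apply deep_step; [exact Hp|exact H120|apply Hv; lia|exact H].
Qed.

Definition triple_eqb (T U : triple) : bool :=
  let '(A, B, C) := T in let '(A', B', C') := U in ((A =? A') && (B =? B') && (C =? C'))%bool%Z.

(* From step 4 on, the sequence of triples is periodic, and one step of each period gains. *)
Definition periodic_gain (p : nat) (T : triple) : bool :=
  (below 8 (fun i => valid p (iterT p i T)) && triple_eqb (iterT p 4 T) (iterT p 8 T)
   && existsb (fun j => gains p (iterT p (4 + j) T)) (seq 0 4))%bool.

Lemma iterT_add p a b T : iterT p a (iterT p b T) = iterT p (a + b) T.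
Proof. unfold iterT. symmetry. apply Nat.iter_add. Qed.

Lemma deep_all p T :
  prime (Z.of_nat p) -> ~ (Z.of_nat p | 120)%Z -> periodic_gain p T = true -> forall k, deep p T k.
Proof.
  intros Hp H120 H. unfold periodic_gain in H. rewrite !Bool.andb_true_iff in H.
  destruct H as [[Hv He] Hg].
  assert (Hvalid : forall i, (i < 8)%nat -> valid p (iterT p i T) = true).
  { intros i Hi. apply (below_spec 8 (fun i => valid p (iterT p i T)) Hv i Hi). }
  (* Dwork's map divides by p modulo 120, and 4 is the exponent of the unit group modulo 120; the
     first four steps bring the numerators into a bounded range. *)
  assert (E : iterT p 4 T = iterT p 8 T).
  { unfold triple_eqb in He. destruct (iterT p 4 T) as [[A B] C], (iterT p 8 T) as [[A' B'] C'].
    rewrite !Bool.andb_true_iff, !Z.eqb_eq in He. destruct He as [[-> ->] ->]. reflexivity. }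
  apply existsb_exists in Hg. destruct Hg as [j [Hj Hg]]. apply in_seq in Hj.
  intros k. apply (deep_iter p T 4); [exact Hp|exact H120|intros; apply Hvalid; lia|].
  induction k as [|k IH].
  - destruct (iterT p 4 T) as [[A B] C]. exists O, 1%Z, 1%Z. split; [apply prime_ndiv_1, Hp|reflexivity].
  - apply (deep_iter p (iterT p 4 T) j); [exact Hp|exact H120| |].
    { intros i Hi. rewrite iterT_add. apply Hvalid. lia. }
    rewrite iterT_add, (Nat.add_comm j 4). apply deep_gain; [exact Hp|exact H120|apply Hvalid; lia|exact Hg|].
    apply (deep_iter p _ (3 - j)); [exact Hp|exact H120| |].
    { intros i Hi. change (dworkT p (iterT p (4 + j) T)) with (iterT p 1 (iterT p (4 + j) T)).
      rewrite !iterT_add. apply Hvalid. lia. }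
    change (dworkT p (iterT p (4 + j) T)) with (iterT p 1 (iterT p (4 + j) T)). rewrite !iterT_add.
    match goal with |- deep p (iterT p ?m T) k => replace m with 8%nat by lia end.
    rewrite <- E. exact IH.
Qed.

(** For r = R0/60, the parameters 1/12 + r/2, 5/12 + r/2 and 1 + r over the denominator 120. *)
Definition start (R0 : Z) : triple := (10 + R0, 50 + R0, 120 + 2 * R0)%Z.

Lemma hyper_poch r R0 n :
  indicial r -> r = IZR R0 / 60 ->
  hyper r n * IZR (poch (120 + 2 * R0) n * poch 120 n) = 1728 ^ n * IZR (poch (10 + R0) n * poch (50 + R0) n).
Proof.
  intros Hr HR. induction n as [|n IH]; [simpl; ring|].
  pose proof (hyper_rec r n Hr) as H.
  change (poch (120 + 2 * R0) (S n)) with (poch (120 + 2 * R0) n * (120 + 2 * R0 + 120 * Z.of_nat n))%Z.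
  change (poch 120 (S n)) with (poch 120 n * (120 + 120 * Z.of_nat n))%Z.
  change (poch (10 + R0) (S n)) with (poch (10 + R0) n * (10 + R0 + 120 * Z.of_nat n))%Z.
  change (poch (50 + R0) (S n)) with (poch (50 + R0) n * (50 + R0 + 120 * Z.of_nat n))%Z.
  rewrite !mult_IZR in IH |- *. repeat rewrite ?plus_IZR, ?mult_IZR. rewrite <- INR_IZR_INZ.
  assert (E1 : 120 + 2 * IZR R0 + 120 * INR n = 120 * (INR (S n) + r)) by (rewrite HR, S_INR; field).
  assert (E2 : 120 + 120 * INR n = 120 * INR (S n)) by (rewrite S_INR; ring).
  assert (E3 : 10 + IZR R0 + 120 * INR n = 120 * (INR n + (/ 12 + r / 2))) by (rewrite HR; field).
  assert (E4 : 50 + IZR R0 + 120 * INR n = 120 * (INR n + (/ 12 + r / 2) + / 3)) by (rewrite HR; field).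
  rewrite E1, E2, E3, E4. simpl pow.
  transitivity (120 * 120 * (INR (S n) * (INR (S n) + r) * hyper r (S n))
     * (IZR (poch (120 + 2 * R0) n) * IZR (poch 120 n))); [ring|].
  rewrite H.
  transitivity (120 * 120 * 1728 * (INR n + (/ 12 + r / 2)) * (INR n + (/ 12 + r / 2) + / 3)
     * (hyper r n * (IZR (poch (120 + 2 * R0) n) * IZR (poch 120 n)))); [ring|].
  rewrite IH. ring.
Qed.

(** A bound N would be divisible by every power of p. The two hypotheses of nonvanishing keep the
    series from terminating, so the upper Pochhammer symbols can be cancelled; p does not divide
    1728, which has the prime divisors of 12. *)
Lemma unbounded_of_periodic_gain (p : nat) (R0 : Z) (r : R) :
  prime (Z.of_nat p) -> ~ (Z.of_nat p | 120)%Z -> indicial r -> r = IZR R0 / 60 ->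
  (forall i : nat, (10 + R0 + 120 * Z.of_nat i <> 0)%Z) ->
  (forall i : nat, (50 + R0 + 120 * Z.of_nat i <> 0)%Z) ->
  periodic_gain p (start R0) = true -> ~ bsol r.
Proof.
  intros Hp H120 Hr HR HA HB Hg Hs.
  destruct (bsol_hyper (Z.of_nat p) (10 + R0) r Hp H120 Hr) as [N [HN Hh]]; [|exact Hs|].
  { rewrite HR, plus_IZR. field. }
  apply (pow_divide_all (Z.of_nat p) N); [destruct Hp; lia|exact HN|]. intros k.
  pose proof (deep_all p _ Hp H120 Hg k) as HD. unfold start, deep in HD.
  destruct HD as [n [u [v [Hu E]]]].
  destruct (Hh n) as [d [Hd [z Hz]]].
  pose proof (hyper_poch r R0 n Hr HR) as Hpo.
  apply (prime_pow_rel (Z.of_nat p) (d * (1728 ^ Z.of_nat n * u))); [exact Hp| |].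
  - apply prime_ndiv_mul; [exact Hp|exact Hd|]. apply prime_ndiv_mul; [exact Hp| |exact Hu].
    intros H. apply H120. clear - Hp H.
    induction n as [|n IH]; [exfalso; exact (prime_ndiv_1 _ Hp H)|].
    rewrite Nat2Z.inj_succ, Z.pow_succ_r in H by lia. apply prime_mult in H; [|exact Hp].
    destruct H as [H|H]; [|exact (IH H)].
    assert (H2 : (Z.of_nat p | 12 * 12 * 12)%Z) by exact H.
    apply prime_mult in H2; [|exact Hp].
    assert (H3 : (Z.of_nat p | 12)%Z).
    { destruct H2 as [H2|H2]; [|exact H2]. apply prime_mult in H2; [|exact Hp]. tauto. }
    change 120%Z with (12 * 10)%Z. apply Z.divide_mul_l, H3.
  - exists (z * v)%Z.
    assert (HAB : (poch (10 + R0) n * poch (50 + R0) n <> 0)%Z).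
    { unfold poch. apply Z.neq_mul_0. split; apply rising_neq0; assumption. }
    apply (Z.mul_reg_r _ _ _ HAB). apply eq_IZR.
    transitivity (IZR N * IZR d * IZR u * (1728 ^ n * IZR (poch (10 + R0) n * poch (50 + R0) n))).
    + rewrite !mult_IZR, <- !pow_IZR. ring.
    + rewrite <- Hpo.
      transitivity (IZR d * (IZR N * hyper r n) * (IZR u * IZR (poch (120 + 2 * R0) n * poch 120 n))); [ring|].
      rewrite Hz, <- mult_IZR, E, <- mult_IZR. f_equal. ring.
Qed.

(** * The finite search for a prime, and the criterion for bounded denominators *)

Definition primes_list : list nat := [7; 11; 13; 17; 19; 23]%nat.

Definition prime_check (p : nat) : bool :=
  (Nat.ltb 1 p && forallb (fun d => negb (Z.of_nat p mod Z.of_nat d =? 0)%Z) (seq 2 (p - 2)))%bool.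

Lemma prime_check_spec p : prime_check p = true -> prime (Z.of_nat p).
Proof.
  unfold prime_check. rewrite Bool.andb_true_iff, Nat.ltb_lt, forallb_forall. intros [H1 H].
  apply prime_alt. split; [lia|]. intros d Hd Hdiv.
  specialize (H (Z.to_nat d)). rewrite Z2Nat.id in H by lia.
  assert (Hin : In (Z.to_nat d) (seq 2 (p - 2))) by (apply in_seq; lia).
  specialize (H Hin). apply Z.mod_divide in Hdiv; [|lia]. rewrite Hdiv in H. discriminate.
Qed.

Definition search_prime (R0 : Z) : bool :=
  existsb (fun p => (periodic_gain p (start R0) || periodic_gain p (start (- R0)))%bool) primes_list.

(** R0/60 has the denominator 60 / gcd(60, R0), so the first alternative skips the cases Q < 6. *)
Lemma search_all :
  forallb (fun i => let R0 := Z.of_nat i in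
    ((60 <? 6 * Z.gcd 60 R0)%Z || search_prime R0)%bool) (seq 61 59) = true.
Proof. vm_compute. reflexivity. Qed.

(** In this range 10 - R0 + 120 i and 50 - R0 + 120 i never vanish; R0 = 10 and R0 = 50 would be
    exceptions, with a terminating series for -r. *)
Lemma unbounded_sixty (R0 : Z) (r : R) :
  (60 < R0 < 120)%Z -> (6 * Z.gcd 60 R0 <= 60)%Z -> indicial r -> indicial (- r) -> r = IZR R0 / 60 ->
  ~ bpair r.
Proof.
  intros HR Hg Hr Hr' Er [Hs Hs'].
  pose proof search_all as H. rewrite forallb_forall in H.
  specialize (H (Z.to_nat R0)). rewrite Z2Nat.id in H by lia.
  assert (Hin : In (Z.to_nat R0) (seq 61 59)) by (apply in_seq; lia).
  specialize (H Hin). cbv zeta in H. apply Bool.orb_true_iff in H.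
  destruct H as [H|H]; [apply Z.ltb_lt in H; lia|].
  unfold search_prime in H. apply existsb_exists in H. destruct H as [p [Hp H]].
  assert (Hpp : prime (Z.of_nat p) /\ ~ (Z.of_nat p | 120)%Z).
  { assert (Hc : forall x, In x primes_list -> prime_check x = true /\ (120 mod Z.of_nat x <> 0)%Z).
    { intros x Hx. simpl in Hx. repeat (destruct Hx as [<-|Hx]; [split; [vm_compute; reflexivity|vm_compute; discriminate]|]). destruct Hx. }
    destruct (Hc p Hp) as [H1 H2]. split; [apply prime_check_spec, H1|].
    intros Hd. apply H2. apply Z.mod_divide; [|exact Hd].
    apply prime_check_spec in H1. destruct H1; lia. }
  destruct Hpp as [Hpr H120]. apply Bool.orb_true_iff in H. destruct H as [H|H].
  - apply (unbounded_of_periodic_gain p R0 r Hpr H120 Hr Er); try assumption; intros; lia.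
  - apply (unbounded_of_periodic_gain p (- R0) (- r) Hpr H120 Hr'); try assumption.
    + rewrite Er, opp_IZR. field.
    + intros; lia.
    + intros; lia.
Qed.

(* Shifting by integers brings r = P/Q into (1, 2). *)
Lemma bpair_reduce (P Qd : Z) :
  (2 <= Qd)%Z -> Z.gcd P Qd = 1%Z -> bpair (ratio P Qd) ->
  exists P', (Qd < P' < 2 * Qd)%Z /\ Z.gcd P' Qd = 1%Z /\ bpair (ratio P' Qd).
Proof.
  intros HQ.
  assert (Hgcd : forall P, Z.gcd (P + Qd) Qd = Z.gcd P Qd).
  { intros P0. rewrite Z.gcd_comm, Z.gcd_add_diag_r. apply Z.gcd_comm. }
  assert (Hpos : forall P, (0 < P)%Z -> Z.gcd P Qd = 1%Z -> bpair (ratio P Qd) ->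
     exists P', (Qd < P' < 2 * Qd)%Z /\ Z.gcd P' Qd = 1%Z /\ bpair (ratio P' Qd)).
  { intros P0 HP0. assert (H0 : (0 <= P0)%Z) by lia. revert HP0. pattern P0.
    apply Zlt_0_ind; [|exact H0]. clear P0 H0. intros P0 IH _ HP0 Hg H.
    assert (Hne : forall c, (P0 <> c * Qd)%Z).
    { intros c ->. rewrite <- (Z.mul_1_l Qd) in Hg at 2.
      rewrite Z.gcd_mul_mono_r, Z.gcd_1_r in Hg. lia. }
    pose proof (Hne 1%Z) as N1. pose proof (Hne 2%Z) as N2.
    destruct (Z_lt_le_dec P0 Qd) as [H1|H1].
    - exists (P0 + Qd)%Z. split; [lia|]. split; [rewrite Hgcd; exact Hg|].
      apply bpair_shift_ratio; try lia. exact H.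
    - destruct (Z_lt_le_dec P0 (2 * Qd)) as [H2|H2]; [exists P0; split; [lia|]; split; assumption|].
      apply (IH (P0 - Qd)%Z); [lia|lia| |].
      + rewrite <- Hg. rewrite <- (Hgcd (P0 - Qd)%Z). f_equal. ring.
      (* A shift down from r is a shift up from -r. *)
      + replace (P0 - Qd)%Z with (- (- P0 + Qd))%Z by ring. rewrite <- ratio_opp. apply bpair_opp.
        apply bpair_shift_ratio; try lia. rewrite <- ratio_opp. apply bpair_opp, H. }
  intros Hg H. destruct (Z.lt_trichotomy P 0) as [H0|[->|H0]].
  - apply (Hpos (- P)%Z); [lia|rewrite Z.gcd_opp_l; exact Hg|]. rewrite <- ratio_opp. apply bpair_opp, H.
  - rewrite Z.gcd_0_l in Hg. lia.
  - apply (Hpos P); assumption.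
Qed.

Lemma bpair_iff (P Qd : Z) :
  (2 <= Qd)%Z -> Z.gcd P Qd = 1%Z -> (bpair (ratio P Qd) <-> (Qd <= 5)%Z).
Proof.
  intros HQ Hg. split; [|intros; apply bpair_small; [lia|exact Hg]].
  intros H. destruct (Z_le_gt_dec Qd 5) as [H5|H5]; [exact H5|exfalso].
  destruct (Zdivide_dec Qd 60) as [Hd|Hd].
  - destruct (bpair_reduce P Qd HQ Hg H) as [P' [HP' [Hg' H']]].
    destruct Hd as [c Hc].
    assert (Hc0 : (0 < c)%Z) by nia.
    apply (unbounded_sixty (c * P') (ratio P' Qd)); try assumption.
    + nia.
    + rewrite Hc, Z.gcd_mul_mono_l_nonneg by lia. rewrite Z.gcd_comm, Hg'. nia.
    + apply indicial_ratio; assumption.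
    + rewrite ratio_opp. apply indicial_ratio; [exact HQ|rewrite Z.gcd_opp_l; exact Hg'].
    + unfold ratio. rewrite mult_IZR. replace 60 with (IZR c * IZR Qd) by (rewrite <- mult_IZR, <- Hc; reflexivity).
      field. split; apply not_0_IZR; lia.
  - apply (unbounded_not_dvd60 P Qd HQ Hg Hd). apply H.
Qed.

(** * Convergence in the unit disc *)

(** Radius of convergence at least 1, in a form that can be proved directly from recursions. *)
Definition conv (a : ps) : Prop :=
  forall rho, 0 < rho < 1 -> exists M, forall n, Rabs (a n) * rho ^ n <= M.

(** Bernoulli's inequality for 1/x = 1 + y. *)
Lemma linear_geometric_bounded x : 0 < x < 1 -> exists K, forall n, (INR n + 1) * x ^ n <= K.
Proof.
  intros Hx. set (y := / x - 1).
  assert (Hy : 0 < y).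
  { unfold y. assert (1 < / x) by (rewrite <- Rinv_1; apply Rinv_lt_contravar; lra). lra. }
  exists (/ y + 1). intros n.
  assert (Hn : INR n * x ^ n <= / y).
  { pose proof (poly n y Hy) as H. replace (1 + y) with (/ x) in H by (unfold y; ring).
    rewrite pow_inv in H.
    assert (Hxn : 0 < x ^ n) by (apply pow_lt; lra).
    apply (Rmult_le_reg_r y); [exact Hy|]. rewrite Rinv_l by lra.
    apply (Rmult_le_compat_r (x ^ n)) in H; [|lra]. rewrite Rinv_l in H by lra. nra. }
  assert (x ^ n <= 1) by (rewrite <- (pow1 n); apply pow_incr; lra). lra.
Qed.

(** Linear growth at a radius between rho and 1 is absorbed by the geometric factor at rho. *)
Lemma conv_linear (a : ps) :
  (forall rho, 0 < rho < 1 -> exists M, forall n, Rabs (a n) * rho ^ n <= M * (INR n + 1)) -> conv a.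
Proof.
  intros H rho Hr. set (rho' := (1 + rho) / 2).
  assert (Hr' : 0 < rho' < 1) by (unfold rho'; lra).
  destruct (H rho' Hr') as [M HM].
  assert (Hx : 0 < rho / rho' < 1).
  { split; [apply Rdiv_lt_0_compat; lra|]. apply (Rmult_lt_reg_r rho'); [lra|].
    unfold Rdiv. rewrite Rmult_assoc, Rinv_l by lra. unfold rho'. lra. }
  destruct (linear_geometric_bounded _ Hx) as [K HK].
  exists (Rabs M * K). intros n.
  replace (rho ^ n) with (rho' ^ n * (rho / rho') ^ n) by (rewrite <- Rpow_mult_distr; f_equal; field; lra).
  rewrite <- Rmult_assoc.
  assert (Hp : 0 <= (rho / rho') ^ n) by (apply pow_le; lra).
  apply Rle_trans with (M * (INR n + 1) * (rho / rho') ^ n); [apply Rmult_le_compat_r; auto|].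
  rewrite Rmult_assoc.
  assert (H0 : 0 <= (INR n + 1) * (rho / rho') ^ n).
  { apply Rmult_le_pos; [pose proof (pos_INR n); lra|exact Hp]. }
  apply Rle_trans with (Rabs M * ((INR n + 1) * (rho / rho') ^ n)).
  - apply Rmult_le_compat_r; [exact H0|apply Rle_abs].
  - apply Rmult_le_compat_l; [apply Rabs_pos|apply HK].
Qed.

Lemma conv_le (a b : ps) : (forall n, Rabs (a n) <= Rabs (b n)) -> conv b -> conv a.
Proof.
  intros H Hb rho Hr. destruct (Hb rho Hr) as [M HM]. exists M. intros n.
  eapply Rle_trans; [|apply HM]. apply Rmult_le_compat_r; [apply pow_le; lra|apply H].
Qed.

Lemma conv_ones : conv ones.
Proof.
  intros rho Hr. exists 1. intros n. unfold ones. rewrite Rabs_R1, Rmult_1_l.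
  rewrite <- (pow1 n). apply pow_incr. lra.
Qed.

Lemma conv_add a b : conv a -> conv b -> conv (a + b)%ps.
Proof.
  intros Ha Hb rho Hr. destruct (Ha rho Hr) as [M HM]. destruct (Hb rho Hr) as [M' HM'].
  exists (M + M'). intros n. specialize (HM n). specialize (HM' n). unfold padd.
  assert (0 <= rho ^ n) by (apply pow_le; lra).
  pose proof (Rabs_triang (a n) (b n)). nra.
Qed.

Lemma conv_dq a : conv a -> conv (dq a).
Proof.
  intros Ha. apply conv_linear. intros rho Hr. destruct (Ha rho Hr) as [M HM]. exists M. intros n.
  unfold dq. rewrite Rabs_mult, (Rabs_pos_eq (INR n)) by apply pos_INR.
  specialize (HM n). pose proof (pos_INR n).
  assert (0 <= Rabs (a n) * rho ^ n) by (apply Rmult_le_pos; [apply Rabs_pos|apply pow_le; lra]). nra.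
Qed.

Lemma conv_mul a b : conv a -> conv b -> conv (a * b)%ps.
Proof.
  intros Ha Hb. apply conv_linear. intros rho Hr.
  destruct (Ha rho Hr) as [M HM]. destruct (Hb rho Hr) as [M' HM']. exists (M * M'). intros n.
  unfold pmul.
  apply Rle_trans with (bsum (fun _ => M * M') (S n)).
  - apply Rle_trans with (bsum (fun k => Rabs (a k * b (n - k)%nat)) (S n) * rho ^ n).
    + apply Rmult_le_compat_r; [apply pow_le; lra|apply bsum_Rabs].
    + rewrite <- bsum_scal_r. apply bsum_le. intros k Hk.
      replace (rho ^ n) with (rho ^ k * rho ^ (n - k)) by (rewrite <- pow_add; f_equal; lia).
      rewrite Rabs_mult.
      replace (Rabs (a k) * Rabs (b (n - k)%nat) * (rho ^ k * rho ^ (n - k)))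
        with ((Rabs (a k) * rho ^ k) * (Rabs (b (n - k)%nat) * rho ^ (n - k))) by ring.
      apply Rmult_le_compat; auto; apply Rmult_le_pos; try apply Rabs_pos; apply pow_le; lra.
  - assert (E : forall m, bsum (fun _ => M * M') m = M * M' * INR m).
    { induction m; [simpl; ring|]. rewrite bsum_S, IHm, S_INR. ring. }
    rewrite E, S_INR. lra.
Qed.

Lemma conv_cst c : conv (cst c).
Proof.
  intros rho Hr. exists (Rabs c). intros [|n]; simpl.
  - lra.
  - rewrite Rabs_R0, Rmult_0_l. apply Rabs_pos.
Qed.
Lemma conv_sub a b : conv a -> conv b -> conv (a - b)%ps.
Proof.
  intros Ha Hb. replace (a - b)%ps with (a + cst (-1) * b)%ps.
  - apply conv_add; [exact Ha|apply conv_mul; [apply conv_cst|exact Hb]].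
  - rewrite (cst_Q (-1) (-1)) by (q2r; field). ring.
Qed.

(** sigma_k(n) is at most n^(k+1), the coefficient of (q d/dq)^(k+1) applied to the geometric
    series. *)
Lemma conv_sig k : conv (sig k).
Proof.
  assert (H : forall j, conv (Nat.iter j dq ones)).
  { induction j; simpl; [apply conv_ones|apply conv_dq, IHj]. }
  assert (Hv : forall j n, Nat.iter j dq ones n = INR n ^ j).
  { induction j; intros n; simpl; [reflexivity|]. unfold dq at 1. rewrite IHj. reflexivity. }
  apply (conv_le _ (Nat.iter (S k) dq ones)); [|apply H].
  intros n. rewrite Hv. rewrite (Rabs_pos_eq (INR n ^ S k)) by (apply pow_le, pos_INR).
  unfold sig. rewrite lam_divisor. eapply Rle_trans; [apply bsum_Rabs|].
  apply Rle_trans with (bsum (fun _ => INR n ^ k) n).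
  - apply bsum_le. intros i Hi. unfold iv.
    assert (0 <= INR (S i) ^ k) by (apply pow_le, pos_INR).
    assert (INR (S i) ^ k <= INR n ^ k) by (apply pow_incr; split; [apply pos_INR|apply le_INR; lia]).
    destruct (Nat.eqb _ _); [rewrite Rabs_pos_eq; lra|rewrite Rabs_R0; lra].
  - assert (E : forall c m, bsum (fun _ => c) m = c * INR m).
    { intros c m. induction m; [simpl; ring|]. rewrite bsum_S, IHm, S_INR. ring. }
    rewrite E. simpl. lra.
Qed.

Lemma conv_eis2 : conv eis2.
Proof. apply conv_sub; [apply conv_cst|apply conv_mul; [apply conv_cst|apply conv_sig]]. Qed.
Lemma conv_eis4 : conv eis4.
Proof. apply conv_add; [apply conv_cst|apply conv_mul; [apply conv_cst|apply conv_sig]]. Qed.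

Lemma conv_partial_sums (c : ps) rho :
  conv c -> 0 < rho < 1 -> exists B, forall n, bsum (fun j => Rabs (c j) * rho ^ j) n <= B.
Proof.
  intros Hc Hr. set (rho' := (1 + rho) / 2).
  assert (Hr' : 0 < rho' < 1) by (unfold rho'; lra).
  destruct (Hc rho' Hr') as [M HM]. set (x := rho / rho').
  assert (Hx : 0 < x < 1).
  { unfold x. split; [apply Rdiv_lt_0_compat; lra|]. apply (Rmult_lt_reg_r rho'); [lra|].
    unfold Rdiv. rewrite Rmult_assoc, Rinv_l by lra. unfold rho'. lra. }
  assert (HM0 : 0 <= M).
  { specialize (HM O). simpl in HM. pose proof (Rabs_pos (c O)). lra. }
  exists (M / (1 - x)). intros n.
  apply Rle_trans with (bsum (fun j => M * x ^ j) n).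
  - apply bsum_le. intros j Hj.
    replace (rho ^ j) with (rho' ^ j * x ^ j) by (unfold x; rewrite <- Rpow_mult_distr; f_equal; field; lra).
    rewrite <- Rmult_assoc. apply Rmult_le_compat_r; [apply pow_le; lra|apply HM].
  - rewrite bsum_scal. apply Rmult_le_compat_l; [exact HM0|].
    assert (E : forall m, bsum (fun j => x ^ j) m * (1 - x) = 1 - x ^ m).
    { induction m as [|m IH]; [simpl; ring|].
      transitivity (bsum (fun j => x ^ j) m * (1 - x) + x ^ m * (1 - x)); [simpl; ring|].
      rewrite IH. simpl. ring. }
    apply (Rmult_le_reg_r (1 - x)); [lra|]. rewrite E, Rinv_l by lra.
    pose proof (pow_le x n). lra.
Qed.

Lemma bounded_initial (u : nat -> R) N : exists M, 0 <= M /\ forall n, (n <= N)%nat -> u n <= M.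
Proof.
  induction N as [|N [M [HM0 HM]]].
  - exists (Rabs (u O)). split; [apply Rabs_pos|]. intros n Hn. replace n with O by lia. apply Rle_abs.
  - exists (Rmax M (u (S N))). split; [eapply Rle_trans; [exact HM0|apply Rmax_l]|].
    intros n Hn. destruct (Nat.eq_dec n (S N)) as [->|]; [apply Rmax_r|].
    eapply Rle_trans; [apply HM; lia|apply Rmax_l].
Qed.

(* Once n exceeds sum |c_j| rho^j, the recursion cannot increase |a_n| rho^n. *)
Lemma conv_recursion (a c : ps) :
  conv c ->
  (forall n, (1 <= n)%nat -> INR n * Rabs (a n) <= bsum (fun j => Rabs (c (S j)) * Rabs (a (n - S j)%nat)) n) ->
  conv a.
Proof.
  intros Hc H rho Hr. destruct (conv_partial_sums c rho Hc Hr) as [B HB].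
  set (N := Z.to_nat (up (Rabs B))).
  assert (HN : B <= INR N).
  { unfold N. pose proof (archimed (Rabs B)) as [Hu _]. pose proof (Rabs_pos B). pose proof (Rle_abs B).
    rewrite INR_IZR_INZ, Z2Nat.id; [lra|]. apply le_IZR. lra. }
  destruct (bounded_initial (fun n => Rabs (a n) * rho ^ n) N) as [M [HM0 HM]].
  exists M. intros n. induction n as [n IH] using (well_founded_induction lt_wf).
  destruct (le_lt_dec n N) as [Hn|Hn]; [apply HM, Hn|].
  assert (Hn1 : (1 <= n)%nat) by lia.
  assert (HnR : 0 < INR n) by (apply lt_0_INR; lia).
  apply (Rmult_le_reg_l (INR n)); [exact HnR|].
  assert (Hpn : 0 <= rho ^ n) by (apply pow_le; lra).
  apply Rle_trans with (bsum (fun j => Rabs (c (S j)) * Rabs (a (n - S j)%nat)) n * rho ^ n).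
  { rewrite <- Rmult_assoc. apply Rmult_le_compat_r; [exact Hpn|apply H, Hn1]. }
  apply Rle_trans with (bsum (fun j => Rabs (c (S j)) * rho ^ S j) n * M).
  { rewrite <- !bsum_scal_r. apply bsum_le. intros j Hj.
    replace (rho ^ n) with (rho ^ S j * rho ^ (n - S j)) by (rewrite <- pow_add; f_equal; lia).
    replace (Rabs (c (S j)) * Rabs (a (n - S j)%nat) * (rho ^ S j * rho ^ (n - S j)))
      with (Rabs (c (S j)) * rho ^ S j * (Rabs (a (n - S j)%nat) * rho ^ (n - S j))) by ring.
    apply Rmult_le_compat_l; [|apply IH; lia].
    apply Rmult_le_pos; [apply Rabs_pos|apply pow_le; lra]. }
  apply Rmult_le_compat_r; [exact HM0|].
  specialize (HB (S n)). rewrite bsum_S_l in HB. simpl in HB.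
  pose proof (Rabs_pos (c O)).
  assert (INR N <= INR n) by (apply le_INR; lia).
  simpl. lra.
Qed.

Lemma conv_log (s y : ps) : s O = 0 -> conv s -> dq y = (s * y)%ps -> conv y.
Proof.
  intros s0 Hs Hy. apply (conv_recursion y s Hs). intros n Hn.
  apply (f_equal (fun a => a n)) in Hy. unfold dq in Hy. rewrite pmul_split, s0, Rmult_0_l, Rplus_0_l in Hy.
  replace (INR n * Rabs (y n)) with (Rabs (INR n * y n))
    by (rewrite Rabs_mult, (Rabs_pos_eq (INR n)) by apply pos_INR; reflexivity).
  rewrite Hy. eapply Rle_trans; [apply bsum_Rabs|]. apply bsum_le. intros j Hj. rewrite Rabs_mult. lra.
Qed.

(** For n >= 2|r| the triangle inequality suffices; for the finitely many smaller n, n + P/Q is a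
    nonzero multiple of 1/Q. *)
Lemma indicial_lower_bound P Qd :
  (2 <= Qd)%Z -> Z.gcd P Qd = 1%Z ->
  exists del, 0 < del /\ forall n, (1 <= n)%nat -> del * INR n <= Rabs (INR n + ratio P Qd).
Proof.
  intros HQ Hg. set (r := ratio P Qd).
  assert (HQr : 2 <= IZR Qd) by (apply IZR_le; lia).
  set (del := / (IZR Qd * (2 * Rabs r + 1))).
  pose proof (Rabs_pos r) as Hr0.
  assert (Hdel : 0 < del) by (apply Rinv_0_lt_compat; nra).
  assert (Hdel2 : del <= / 2) by (apply Rinv_le_contravar; nra).
  exists del. split; [exact Hdel|]. intros n Hn.
  assert (HnR : 1 <= INR n) by (apply (le_INR 1); lia).
  destruct (Rle_lt_dec (2 * Rabs r) (INR n)) as [H|H].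
  - assert (H1 : INR n - Rabs r <= Rabs (INR n + r)).
    { pose proof (Rabs_triang_inv (INR n) (- r)) as T. rewrite Rabs_Ropp, (Rabs_pos_eq (INR n)) in T by lra.
      replace (INR n - - r) with (INR n + r) in T by ring. exact T. }
    nra.
  - assert (H1 : / IZR Qd <= Rabs (INR n + r)).
    { assert (E : INR n + r = IZR (Z.of_nat n * Qd + P) / IZR Qd).
      { rewrite plus_IZR, mult_IZR, <- INR_IZR_INZ. unfold r, ratio. field. lra. }
      assert (Hne : (Z.of_nat n * Qd + P <> 0)%Z).
      { intros E0. apply (indicial_ratio P Qd HQ Hg n Hn). fold r. rewrite E, E0. field. lra. }
      rewrite E. unfold Rdiv. rewrite Rabs_mult, (Rabs_pos_eq (/ IZR Qd)) by (left; apply Rinv_0_lt_compat; lra).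
      rewrite <- abs_IZR.
      assert (1 <= IZR (Z.abs (Z.of_nat n * Qd + P))) by (apply IZR_le; lia).
      assert (0 < / IZR Qd) by (apply Rinv_0_lt_compat; lra). nra. }
    apply Rle_trans with (/ IZR Qd); [|exact H1].
    unfold del. rewrite Rinv_mult.
    assert (H2 : / (2 * Rabs r + 1) * INR n <= 1).
    { apply (Rmult_le_reg_l (2 * Rabs r + 1)); [lra|]. rewrite <- Rmult_assoc, Rinv_r by lra. lra. }
    assert (0 < / IZR Qd) by (apply Rinv_0_lt_compat; lra).
    rewrite Rmult_assoc. nra.
Qed.

(** The coefficients of the recursion grow linearly in n, while n + r is at least [del] n in
    absolute value; division leaves the inequality of [conv_recursion] with [c] built from E_2 and
    E_4. *)
Lemma conv_frobenius P Qd G :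
  (2 <= Qd)%Z -> Z.gcd P Qd = 1%Z ->
  ode 0 (kone (ratio P Qd)) (/ 12 + ratio P Qd / 2) G -> conv G.
Proof.
  intros HQ Hg HG. destruct (indicial_lower_bound P Qd HQ Hg) as [del [Hdel Hlow]].
  set (r := ratio P Qd) in *. set (al := / 12 + r / 2) in *. set (kap := kone r) in *.
  set (K := (1 + Rabs al + Rabs kap) / del).
  assert (HK : 0 <= K).
  { unfold K. apply Rmult_le_pos; [|left; apply Rinv_0_lt_compat, Hdel].
    pose proof (Rabs_pos al). pose proof (Rabs_pos kap). lra. }
  set (c := fun n => K * (Rabs (eis2 n) + Rabs (eis4 n))).
  assert (Hc : conv c).
  { assert (Habs : forall a, conv a -> conv (fun n => Rabs (a n))).
    { intros a Ha. apply (conv_le _ a); [|exact Ha]. intros n. rewrite Rabs_Rabsolu. lra. }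
    apply (conv_le _ (cst K * ((fun n => Rabs (eis2 n)) + (fun n => Rabs (eis4 n))))%ps).
    - intros n. rewrite cst_mul_coef. unfold c, padd. lra.
    - apply conv_mul; [apply conv_cst|]. apply conv_add; apply Habs; [apply conv_eis2|apply conv_eis4]. }
  apply (conv_recursion G c Hc). intros n Hn.
  rewrite ode0_coef in HG. specialize (HG n). unfold al, kap in HG. rewrite indicial_value in HG.
  fold al kap in HG. apply (f_equal Rabs) in HG. rewrite !Rabs_mult in HG.
  assert (HnR : 1 <= INR n) by (apply (le_INR 1); lia).
  rewrite (Rabs_pos_eq (INR n)) in HG by lra.
  apply (Rmult_le_reg_l (del * INR n)); [nra|].
  apply Rle_trans with (INR n * Rabs (INR n + r) * Rabs (G n)).
  - pose proof (Hlow n Hn) as HL. pose proof (Rabs_pos (G n)).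
    replace (del * INR n * (INR n * Rabs (G n))) with ((del * INR n) * (INR n * Rabs (G n))) by ring.
    replace (INR n * Rabs (INR n + r) * Rabs (G n)) with (Rabs (INR n + r) * (INR n * Rabs (G n))) by ring.
    apply Rmult_le_compat_r; [nra|exact HL].
  - rewrite HG. eapply Rle_trans; [apply bsum_Rabs|]. rewrite <- bsum_scal. apply bsum_le. intros j Hj.
    rewrite Rabs_mult, <- Rmult_assoc. apply Rmult_le_compat_r; [apply Rabs_pos|].
    unfold c. rewrite (Rabs_pos_eq (K * _)).
    2: { apply Rmult_le_pos; [exact HK|]. pose proof (Rabs_pos (eis2 (S j))). pose proof (Rabs_pos (eis4 (S j))). lra. }
    replace (del * INR n * (K * (Rabs (eis2 (S j)) + Rabs (eis4 (S j)))))
      with (INR n * (1 + Rabs al + Rabs kap) * (Rabs (eis2 (S j)) + Rabs (eis4 (S j))))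
      by (unfold K; field; lra).
    eapply Rle_trans; [apply Rabs_triang|]. rewrite !Rabs_mult.
    assert (H1 : Rabs (INR (n - S j) + al) <= INR n + Rabs al).
    { eapply Rle_trans; [apply Rabs_triang|]. rewrite (Rabs_pos_eq (INR _)) by apply pos_INR.
      assert (INR (n - S j) <= INR n) by (apply le_INR; lia). lra. }
    assert (H2 : Rabs (eis2 (S j) / 6) <= Rabs (eis2 (S j))).
    { unfold Rdiv. rewrite Rabs_mult, (Rabs_pos_eq (/ 6)) by lra. pose proof (Rabs_pos (eis2 (S j))). lra. }
    pose proof (Rabs_pos (eis2 (S j))) as p2. pose proof (Rabs_pos (eis4 (S j))) as p4.
    pose proof (Rabs_pos al) as pa. pose proof (Rabs_pos kap) as pk.
    apply Rle_trans with (Rabs (eis2 (S j)) * (INR n + Rabs al) + Rabs kap * Rabs (eis4 (S j))).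
    + apply Rplus_le_compat_r. apply Rmult_le_compat; try apply Rabs_pos; assumption.
    + assert (INR n + Rabs al <= INR n * (1 + Rabs al + Rabs kap)) by nra.
      assert (Rabs kap <= INR n * (1 + Rabs al + Rabs kap)) by nra.
      nra.
Qed.

Lemma isQ_frobenius r G :
  isQ r -> indicial r -> G O = 1 -> ode 0 (kone r) (/ 12 + r / 2) G -> forall n, isQ (G n).
Proof.
  intros Hq Hr G0 HG. rewrite ode0_coef in HG.
  assert (Hsum : forall f m, (forall j, (j < m)%nat -> isQ (f j)) -> isQ (bsum f m)).
  { intros f m. induction m as [|m IH]; intros Hf; [apply (isQ_IZR 0)|].
    rewrite bsum_S. apply isQ_add; [apply IH; intros; apply Hf; lia|apply Hf; lia]. }
  assert (Hn : forall n, isQ (INR n)) by (intros; apply isQ_isZ, isZ_INR).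
  assert (Hal : isQ (/ 12 + r / 2)) by apply isQ_exponent, Hq.
  assert (Hk : isQ (kone r)).
  { unfold kone. apply isQ_div; [|apply (isQ_IZR 144)]. apply isQ_sub; [|apply (isQ_IZR 1)].
    apply isQ_mul; [apply (isQ_IZR 36)|]. simpl. apply isQ_mul; [exact Hq|]. apply isQ_mul; [exact Hq|apply (isQ_IZR 1)]. }
  induction n as [n IH] using (well_founded_induction lt_wf).
  destruct n as [|n]; [rewrite G0; apply (isQ_IZR 1)|].
  specialize (HG (S n)). rewrite indicial_value in HG.
  assert (Hne : INR (S n) * (INR (S n) + r) <> 0).
  { apply Rmult_integral_contrapositive_currified; [apply not_0_INR; lia|apply Hr; lia]. }
  replace (G (S n)) with (INR (S n) * (INR (S n) + r) * G (S n) / (INR (S n) * (INR (S n) + r)))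
    by (field; split; [apply Hr; lia|apply not_0_INR; lia]).
  rewrite HG. apply isQ_div.
  - apply Hsum. intros j Hj. apply isQ_mul; [|apply IH; lia]. apply isQ_add.
    + apply isQ_mul; [|apply isQ_add; [apply Hn|exact Hal]].
      apply isQ_div; [apply isQ_isZ, zps_eis2|apply (isQ_IZR 6)].
    + apply isQ_mul; [exact Hk|apply isQ_isZ, zps_eis4].
  - apply isQ_mul; [apply Hn|]. apply isQ_add; [apply Hn|exact Hq].
Qed.

(** * Complex power series *)

(** Componentwise, to match [CSeries]; [isC_series] compares it with convergence in C. *)
Definition isC (u : nat -> C) (l : C) : Prop :=
  is_series (fun n => Re (u n)) (Re l) /\ is_series (fun n => Im (u n)) (Im l).

Lemma isC_unique u l : isC u l -> CSeries u = l.
Proof.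
  intros [H1 H2]. unfold CSeries. apply is_series_unique in H1, H2. rewrite H1, H2.
  destruct l; reflexivity.
Qed.

Lemma isC_plus u v l m : isC u l -> isC v m -> isC (fun n => u n + v n)%C (l + m)%C.
Proof.
  intros [H1 H2] [H3 H4]. split.
  - apply (is_series_plus _ _ _ _ H1 H3).
  - apply (is_series_plus _ _ _ _ H2 H4).
Qed.

Lemma isC_scal c u l : isC u l -> isC (fun n => c * u n)%C (c * l)%C.
Proof.
  intros [H1 H2]. split.
  - apply (is_series_ext (fun n => plus (scal (Re c) (Re (u n))) (opp (scal (Im c) (Im (u n)))))).
    + intros n. reflexivity.
    + apply (is_series_minus (fun n => scal (Re c) (Re (u n))) (fun n => scal (Im c) (Im (u n)))
               (Re c * Re l) (Im c * Im l)); apply (is_series_scal (V := R_NormedModule)); assumption.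
  - apply (is_series_ext (fun n => plus (scal (Re c) (Im (u n))) (scal (Im c) (Re (u n))))).
    + intros n. reflexivity.
    + apply (is_series_plus (fun n => scal (Re c) (Im (u n))) (fun n => scal (Im c) (Re (u n)))
               (Re c * Im l) (Im c * Re l)); apply (is_series_scal (V := R_NormedModule)); assumption.
Qed.

Lemma isC_ext u v l : (forall n, u n = v n) -> isC u l -> isC v l.
Proof.
  intros H [H1 H2]. split; [apply (is_series_ext (fun n => Re (u n)))|apply (is_series_ext (fun n => Im (u n)))];
    try assumption; intros n; rewrite H; reflexivity.
Qed.

Lemma isC_minus u v l m : isC u l -> isC v m -> isC (fun n => u n - v n)%C (l - m)%C.
Proof.
  intros H1 H2. replace (l - m)%C with (l + (-1) * m)%C by ring.
  apply (isC_ext (fun n => u n + (-1) * v n)%C); [intros; ring|].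
  apply isC_plus; [exact H1|apply isC_scal, H2].
Qed.

Lemma sum_n_Re u N : Re (@sum_n C_AbelianMonoid u N) = sum_n (fun n => Re (u n)) N.
Proof.
  induction N as [|N IH]; [rewrite !sum_O; reflexivity|]. rewrite !sum_Sn, <- IH. reflexivity.
Qed.
Lemma sum_n_Im u N : Im (@sum_n C_AbelianMonoid u N) = sum_n (fun n => Im (u n)) N.
Proof.
  induction N as [|N IH]; [rewrite !sum_O; reflexivity|]. rewrite !sum_Sn, <- IH. reflexivity.
Qed.

Lemma isC_series u l : isC u l <-> @is_series C_AbsRing C_NormedModule u l.
Proof.
  unfold isC, is_series. split.
  - intros [H1 H2]. apply filterlim_locally. intros eps.
    pose proof (proj1 (filterlim_locally _ _) H1 eps) as E1.
    pose proof (proj1 (filterlim_locally _ _) H2 eps) as E2.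
    generalize (filter_and _ _ E1 E2). apply filter_imp. intros N [B1 B2]. split.
    + change (ball (Re l) eps (Re (@sum_n C_AbelianMonoid u N))). rewrite sum_n_Re. exact B1.
    + change (ball (Im l) eps (Im (@sum_n C_AbelianMonoid u N))). rewrite sum_n_Im. exact B2.
  - intros H. split; apply filterlim_locally; intros eps;
    pose proof (proj1 (filterlim_locally _ _) H eps) as E; revert E; apply filter_imp; intros N [B1 B2].
    + rewrite <- sum_n_Re. exact B1.
    + rewrite <- sum_n_Im. exact B2.
Qed.

Lemma im_le_Cmod (c : C) : Rabs (Im c) <= Cmod c.
Proof. eapply Rle_trans; [apply Rmax_r|apply Rmax_Cmod]. Qed.

Lemma Cmod_le_sum (c : C) : Cmod c <= Rabs (Re c) + Rabs (Im c).
Proof.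
  replace c with ((RtoC (Re c)) + Ci * RtoC (Im c))%C at 1.
  - eapply Rle_trans; [apply Cmod_triangle|]. rewrite Cmod_mult, !Cmod_R.
    replace (Cmod Ci) with 1; [lra|]. unfold Cmod, Ci. simpl.
    replace (0 * (0 * 1) + 1 * (1 * 1)) with 1 by ring. symmetry. apply sqrt_1.
  - destruct c as [x y]. unfold Cplus, Cmult, RtoC, Ci. simpl. f_equal; ring.
Qed.

Lemma is_series_abs_le (u b : nat -> R) l :
  is_series u l -> (forall n, Rabs (u n) <= b n) -> ex_series b -> Rabs l <= Series b.
Proof.
  intros Hu Hb He. apply is_series_unique in Hu. rewrite <- Hu.
  assert (Hea : ex_series (fun n => Rabs (u n))).
  { apply (ex_series_le (V := R_CompleteNormedModule) _ b); [|exact He].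
    intros n. unfold norm. simpl. unfold abs. simpl. rewrite Rabs_Rabsolu. apply Hb. }
  eapply Rle_trans; [apply Series_Rabs, Hea|]. apply Series_le; [|exact He].
  intros n. split; [apply Rabs_pos|apply Hb].
Qed.

Lemma isC_bound u l b :
  isC u l -> (forall n, Cmod (u n) <= b n) -> ex_series b -> Cmod l <= 2 * Series b.
Proof.
  intros [H1 H2] Hb He.
  assert (A1 : Rabs (Re l) <= Series b).
  { apply (is_series_abs_le _ b _ H1); [|exact He]. intros n. eapply Rle_trans; [apply re_le_Cmod|apply Hb]. }
  assert (A2 : Rabs (Im l) <= Series b).
  { apply (is_series_abs_le _ b _ H2); [|exact He]. intros n. eapply Rle_trans; [apply im_le_Cmod|apply Hb]. }
  pose proof (Cmod_le_sum l). lra.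
Qed.

Definition CS (a : ps) (z : C) : C := CSeries (fun n => RtoC (a n) * z ^ n)%C.

Lemma ex_series_Rabs_le (u b : nat -> R) :
  (forall n, Rabs (u n) <= b n) -> ex_series b -> ex_series u.
Proof. intros H. apply (ex_series_le (V := R_CompleteNormedModule)). exact H. Qed.

Lemma conv_abs (a : ps) x : conv a -> 0 <= x < 1 -> ex_series (fun n => Rabs (a n) * x ^ n).
Proof.
  intros Ha Hx. set (rho := (1 + x) / 2).
  assert (Hr : 0 < rho < 1) by (unfold rho; lra).
  destruct (Ha rho Hr) as [M HM]. set (t := x / rho).
  assert (Ht : 0 <= t < 1).
  { unfold t. split; [apply Rmult_le_pos; [lra|left; apply Rinv_0_lt_compat; lra]|].
    apply (Rmult_lt_reg_r rho); [lra|]. unfold Rdiv. rewrite Rmult_assoc, Rinv_l by lra. unfold rho. lra. }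
  apply (ex_series_Rabs_le _ (fun n => M * t ^ n)).
  - intros n. rewrite Rabs_mult, Rabs_Rabsolu, (Rabs_pos_eq (x ^ n)) by (apply pow_le; lra).
    replace (x ^ n) with (rho ^ n * t ^ n) by (unfold t; rewrite <- Rpow_mult_distr; f_equal; field; lra).
    rewrite <- Rmult_assoc. apply Rmult_le_compat_r; [apply pow_le; lra|apply HM].
  - apply (ex_series_scal (V := R_NormedModule) M). apply ex_series_geom. rewrite Rabs_pos_eq; lra.
Qed.

Lemma Cmod_term (a : ps) z n : Cmod (RtoC (a n) * z ^ n)%C = Rabs (a n) * Cmod z ^ n.
Proof. rewrite Cmod_mult, Cmod_R, Cmod_pow. reflexivity. Qed.

Lemma isC_of_abs u b : (forall n, Cmod (u n) <= b n) -> ex_series b -> isC u (CSeries u).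
Proof.
  intros H Hb. split; apply Series_correct; apply (ex_series_Rabs_le _ b); try exact Hb; intros n.
  - eapply Rle_trans; [apply re_le_Cmod|apply H].
  - eapply Rle_trans; [apply im_le_Cmod|apply H].
Qed.

Lemma CS_correct a z : conv a -> Cmod z < 1 -> isC (fun n => RtoC (a n) * z ^ n)%C (CS a z).
Proof.
  intros Ha Hz. apply (isC_of_abs _ (fun n => Rabs (a n) * Cmod z ^ n)).
  - intros n. rewrite Cmod_term. lra.
  - apply conv_abs; [exact Ha|]. split; [apply Cmod_ge_0|exact Hz].
Qed.

Lemma CS_unique a z l : isC (fun n => RtoC (a n) * z ^ n)%C l -> CS a z = l.
Proof. apply isC_unique. Qed.

Lemma CS_add a b z : conv a -> conv b -> Cmod z < 1 -> CS (a + b)%ps z = (CS a z + CS b z)%C.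
Proof.
  intros Ha Hb Hz. apply CS_unique.
  apply (isC_ext (fun n => RtoC (a n) * z ^ n + RtoC (b n) * z ^ n)%C).
  - intros n. unfold padd. rewrite RtoC_plus. ring.
  - apply isC_plus; apply CS_correct; assumption.
Qed.
Lemma CS_sub a b z : conv a -> conv b -> Cmod z < 1 -> CS (a - b)%ps z = (CS a z - CS b z)%C.
Proof.
  intros Ha Hb Hz. apply CS_unique.
  apply (isC_ext (fun n => RtoC (a n) * z ^ n - RtoC (b n) * z ^ n)%C).
  - intros n. unfold psub. rewrite RtoC_minus. ring.
  - apply isC_minus; apply CS_correct; assumption.
Qed.
Lemma CS_scal c a z : conv a -> Cmod z < 1 -> CS (cst c * a)%ps z = (RtoC c * CS a z)%C.
Proof.
  intros Ha Hz. apply CS_unique.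
  apply (isC_ext (fun n => RtoC c * (RtoC (a n) * z ^ n))%C).
  - intros n. rewrite cst_mul_coef, RtoC_mult. ring.
  - apply isC_scal. apply CS_correct; assumption.
Qed.

Lemma bsum_sum_f f n : sum_f_R0 f n = bsum f (S n).
Proof. induction n as [|n IH]; [simpl; ring|]. simpl sum_f_R0. rewrite IH. reflexivity. Qed.

Lemma Re_term a z n : Re (RtoC (a n) * z ^ n)%C = (a : ps) n * Re (z ^ n)%C.
Proof. unfold Cmult, RtoC, Re. simpl. ring. Qed.
Lemma Im_term a z n : Im (RtoC (a n) * z ^ n)%C = (a : ps) n * Im (z ^ n)%C.
Proof. unfold Cmult, RtoC, Im. simpl. ring. Qed.

(** Four Cauchy products of the real and imaginary parts, all absolutely convergent. *)
Lemma CS_mul a b z : conv a -> conv b -> Cmod z < 1 -> CS (a * b)%ps z = (CS a z * CS b z)%C.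
Proof.
  intros Ha Hb Hz. apply CS_unique.
  pose proof (CS_correct a z Ha Hz) as [A1 A2]. pose proof (CS_correct b z Hb Hz) as [B1 B2].
  assert (Hz' : 0 <= Cmod z < 1) by (split; [apply Cmod_ge_0|exact Hz]).
  assert (Eabs : forall c : ps, conv c ->
     ex_series (fun n => Rabs (Re (RtoC (c n) * z ^ n)%C)) /\ ex_series (fun n => Rabs (Im (RtoC (c n) * z ^ n)%C))).
  { intros c Hc. pose proof (conv_abs c _ Hc Hz') as E.
    split; apply (ex_series_Rabs_le _ (fun n => Rabs (c n) * Cmod z ^ n)); try exact E;
      intros n; rewrite Rabs_Rabsolu, <- Cmod_term; [apply re_le_Cmod|apply im_le_Cmod]. }
  destruct (Eabs a Ha) as [Ea1 Ea2]. destruct (Eabs b Hb) as [Eb1 Eb2].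
  split.
  - pose proof (is_series_minus _ _ _ _ (is_series_mult _ _ _ _ A1 B1 Ea1 Eb1) (is_series_mult _ _ _ _ A2 B2 Ea2 Eb2)) as H.
    refine (is_series_ext _ _ _ _ H). intros n. rewrite Re_term.
    change (sum_f_R0 (fun k => Re (RtoC (a k) * z ^ k)%C * Re (RtoC (b (n - k)%nat) * z ^ (n - k))%C) n
        - sum_f_R0 (fun k => Im (RtoC (a k) * z ^ k)%C * Im (RtoC (b (n - k)%nat) * z ^ (n - k))%C) n
        = (a * b)%ps n * Re (z ^ n)%C).
    rewrite !bsum_sum_f, <- bsum_minus. unfold pmul. rewrite <- bsum_scal_r. apply bsum_ext. intros k Hk.
    rewrite !Re_term, !Im_term. replace (z ^ n)%C with (z ^ k * z ^ (n - k))%C.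
    + unfold Cmult, Re, Im. simpl. ring.
    + rewrite <- Cpow_add_r. f_equal. lia.
  - pose proof (is_series_plus _ _ _ _ (is_series_mult _ _ _ _ A1 B2 Ea1 Eb2) (is_series_mult _ _ _ _ A2 B1 Ea2 Eb1)) as H.
    refine (is_series_ext _ _ _ _ H). intros n. rewrite Im_term.
    change (sum_f_R0 (fun k => Re (RtoC (a k) * z ^ k)%C * Im (RtoC (b (n - k)%nat) * z ^ (n - k))%C) n
        + sum_f_R0 (fun k => Im (RtoC (a k) * z ^ k)%C * Re (RtoC (b (n - k)%nat) * z ^ (n - k))%C) n
        = (a * b)%ps n * Im (z ^ n)%C).
    rewrite !bsum_sum_f, <- bsum_plus. unfold pmul. rewrite <- bsum_scal_r. apply bsum_ext. intros k Hk.
    rewrite !Re_term, !Im_term. replace (z ^ n)%C with (z ^ k * z ^ (n - k))%C.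
    + unfold Cmult, Re, Im. simpl. ring.
    + rewrite <- Cpow_add_r. f_equal. lia.
Qed.

(** * Complex derivatives *)

Notation is_derive_C := (@is_derive C_AbsRing C_NormedModule).

(** The derivatives of power series, of [Cexp] and of linear maps below all come from explicit
    quadratic remainders. *)
Lemma is_derive_quadratic (f : C -> C) (z l : C) (K del : R) :
  0 < del ->
  (forall w, Cmod (w - z)%C < del -> Cmod (f w - f z - l * (w - z))%C <= K * Cmod (w - z)%C ^ 2) ->
  is_derive_C f z l.
Proof.
  intros Hdel H. split; [apply is_linear_scal_l|].
  intros x Hx.
  assert (E : z = x) by exact (@is_filter_lim_locally_unique C_AbsRing (AbsRing_NormedModule C_AbsRing) z x Hx).
  subst x.
  intros eps. set (d := Rmin del (eps / (Rabs K + 1))).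
  assert (HK : 0 < Rabs K + 1) by (pose proof (Rabs_pos K); lra).
  assert (Hd : 0 < d).
  { apply Rmin_glb_lt; [exact Hdel|]. apply Rdiv_lt_0_compat; [apply cond_pos|exact HK]. }
  exists (mkposreal d Hd). intros w Hw. change (Cmod (w - z)%C < d) in Hw.
  change (Cmod ((f w - f z) - (w - z) * l)%C <= eps * Cmod (w - z)%C).
  replace ((f w - f z) - (w - z) * l)%C with (f w - f z - l * (w - z))%C by ring.
  eapply Rle_trans; [apply H; eapply Rlt_le_trans; [exact Hw|apply Rmin_l]|].
  assert (H2 : Cmod (w - z)%C <= eps / (Rabs K + 1)).
  { left. eapply Rlt_le_trans; [exact Hw|apply Rmin_r]. }
  pose proof (Cmod_ge_0 (w - z)%C) as H0. simpl. rewrite Rmult_1_r, <- Rmult_assoc.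
  apply Rmult_le_compat_r; [exact H0|].
  apply Rle_trans with ((Rabs K + 1) * Cmod (w - z)%C).
  - apply Rmult_le_compat_r; [exact H0|]. pose proof (Rle_abs K). lra.
  - apply (Rmult_le_compat_l (Rabs K + 1)) in H2; [|lra].
    replace ((Rabs K + 1) * (eps / (Rabs K + 1))) with (pos eps) in H2 by (field; lra). exact H2.
Qed.

Definition dpow (n : nat) (z : C) : C :=
  match n with O => 0%C | S m => (RtoC (INR (S m)) * z ^ m)%C end.

(** The factor R0^2 on the left avoids the exponent n - 2; the n^2 on the right makes the sum over n
    a value of the series [dq (dq a)]. *)
Lemma pow_taylor_bound (w z : C) (R0 : R) n :
  0 < R0 -> Cmod w <= R0 -> Cmod z <= R0 ->
  Cmod (w ^ n - z ^ n - dpow n z * (w - z))%C * R0 ^ 2 <= INR n ^ 2 * R0 ^ n * Cmod (w - z)%C ^ 2.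
Proof.
  intros HR Hw Hz. induction n as [|n IH].
  - replace (w ^ 0 - z ^ 0 - dpow 0 z * (w - z))%C with (RtoC 0) by (simpl; ring). rewrite Cmod_0. simpl. lra.
  - assert (E : (w ^ S n - z ^ S n - dpow (S n) z * (w - z)
       = w * (w ^ n - z ^ n - dpow n z * (w - z)) + dpow n z * (w - z) * (w - z))%C).
    { destruct n as [|n].
      - simpl. ring.
      - unfold dpow. rewrite (S_INR (S n)), RtoC_plus. simpl Cpow. ring. }
    rewrite E.
    set (D1 := Cmod (w - z)%C) in *.
    assert (HD1 : 0 <= D1) by apply Cmod_ge_0.
    assert (Hd : Cmod (dpow n z) * R0 <= INR n * R0 ^ n).
    { destruct n as [|n]; [simpl; rewrite Cmod_0; lra|]. unfold dpow.
      rewrite Cmod_mult, Cmod_R, Cmod_pow, Rabs_pos_eq by apply pos_INR.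
      change (R0 ^ S n) with (R0 * R0 ^ n). rewrite Rmult_assoc.
      apply Rmult_le_compat_l; [apply pos_INR|]. rewrite Rmult_comm.
      apply Rmult_le_compat_l; [lra|]. apply pow_incr. split; [apply Cmod_ge_0|exact Hz]. }
    apply Rle_trans with ((R0 * Cmod (w ^ n - z ^ n - dpow n z * (w - z))%C + Cmod (dpow n z) * D1 * D1) * R0 ^ 2).
    + apply Rmult_le_compat_r; [apply pow_le; lra|].
      eapply Rle_trans; [apply Cmod_triangle|]. rewrite !Cmod_mult. apply Rplus_le_compat; [|unfold D1; lra].
      apply Rmult_le_compat_r; [apply Cmod_ge_0|exact Hw].
    + rewrite Rmult_plus_distr_r.
      assert (A : R0 * Cmod (w ^ n - z ^ n - dpow n z * (w - z))%C * R0 ^ 2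
                  <= INR n ^ 2 * R0 ^ S n * D1 ^ 2).
      { rewrite Rmult_assoc. apply (Rmult_le_compat_l R0) in IH; [|lra]. simpl in IH |- *. nra. }
      assert (B : Cmod (dpow n z) * D1 * D1 * R0 ^ 2 <= INR n * R0 ^ S n * D1 ^ 2).
      { apply (Rmult_le_compat_r (R0 * D1 ^ 2)) in Hd; [|apply Rmult_le_pos; [lra|apply pow_le, HD1]].
        simpl in Hd |- *. nra. }
      rewrite S_INR. assert (0 <= R0 ^ S n * D1 ^ 2) by (apply Rmult_le_pos; apply pow_le; lra).
      pose proof (pos_INR n). nra.
Qed.

Lemma isC_decr (u : nat -> C) (l : C) : isC (fun n => u (S n)) l -> isC u (u O + l)%C.
Proof.
  intros [H1 H2]. split.
  - apply (is_series_decr_1 (fun n => Re (u n))).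
    apply (eq_ind (Re l) (is_series (fun k => Re (u (S k))))); [exact H1|].
    change (Re l = Re (u O) + Re l + - Re (u O)). ring.
  - apply (is_series_decr_1 (fun n => Im (u n))).
    apply (eq_ind (Im l) (is_series (fun k => Im (u (S k))))); [exact H2|].
    change (Im l = Im (u O) + Im l + - Im (u O)). ring.
Qed.

Lemma isC_0 : isC (fun _ => 0%C) 0%C.
Proof.
  assert (H : is_series (fun _ => 0) 0); [|split; exact H].
  apply (filterlim_ext (fun _ => 0)); [|apply filterlim_const].
  intros n. rewrite sum_n_const. ring.
Qed.

Lemma CS_cst c z : CS (cst c) z = RtoC c.
Proof.
  apply CS_unique. replace (RtoC c) with (RtoC (cst c O) * z ^ O + 0)%C by (simpl; ring).
  apply (isC_decr (fun n => RtoC (cst c n) * z ^ n)%C).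
  apply (isC_ext (fun _ => 0%C)); [|apply isC_0]. intros n. simpl cst. ring.
Qed.

Definition dps (a : ps) : ps := fun n => INR (S n) * a (S n).

Lemma conv_shift a : conv a -> conv (fun n => a (S n)).
Proof.
  intros Ha rho Hr. destruct (Ha rho Hr) as [M HM]. exists (M / rho). intros n.
  apply (Rmult_le_reg_r rho); [lra|]. unfold Rdiv. rewrite (Rmult_assoc M), Rinv_l, Rmult_1_r by lra.
  specialize (HM (S n)). simpl in HM. lra.
Qed.

Lemma conv_dps a : conv a -> conv (dps a).
Proof. intros Ha. apply (conv_shift (dq a)), conv_dq, Ha. Qed.

Lemma CS_dps a z : conv a -> Cmod z < 1 -> isC (fun n => RtoC (a n) * dpow n z)%C (CS (dps a) z).
Proof.
  intros Ha Hz. replace (CS (dps a) z) with (RtoC (a O) * dpow O z + CS (dps a) z)%C by (simpl; ring).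
  apply (isC_decr (fun n => RtoC (a n) * dpow n z)%C).
  apply (isC_ext (fun n => RtoC (dps a n) * z ^ n)%C).
  - intros n. unfold dps, dpow. rewrite RtoC_mult. ring.
  - apply CS_correct; [apply conv_dps, Ha|exact Hz].
Qed.

Lemma CS_dq a z : conv a -> Cmod z < 1 -> CS (dq a) z = (z * CS (dps a) z)%C.
Proof.
  intros Ha Hz. apply CS_unique.
  apply (isC_ext (fun n => z * (RtoC (a n) * dpow n z))%C).
  - intros [|n]; unfold dq, dpow; [simpl; rewrite Rmult_0_l; ring|]. rewrite RtoC_mult. simpl Cpow. ring.
  - apply isC_scal, CS_dps; assumption.
Qed.

(** The bounds of [pow_taylor_bound] are summed at a radius strictly between |z| and 1. *)
Lemma is_derive_CS a z : conv a -> Cmod z < 1 -> is_derive_C (CS a) z (CS (dps a) z).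
Proof.
  intros Ha Hz. set (R0 := (1 + Cmod z) / 2).
  pose proof (Cmod_ge_0 z) as Hz0.
  assert (HR : 0 < R0 < 1) by (unfold R0; lra).
  assert (He : ex_series (fun n => Rabs (dq (dq a) n) * R0 ^ n)).
  { apply conv_abs; [apply conv_dq, conv_dq, Ha|lra]. }
  apply (is_derive_quadratic _ _ _ (2 * Series (fun n => Rabs (dq (dq a) n) * R0 ^ n) / R0 ^ 2) (1 - R0)); [lra|].
  intros w Hw.
  assert (HwR : Cmod w <= R0).
  { replace w with (z + (w - z))%C by ring. eapply Rle_trans; [apply Cmod_triangle|]. unfold R0 in *. lra. }
  assert (HzR : Cmod z <= R0) by (unfold R0; lra).
  assert (H : isC (fun n => RtoC (a n) * (w ^ n - z ^ n - dpow n z * (w - z)))%C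
               (CS a w - CS a z - CS (dps a) z * (w - z))%C).
  { apply (isC_ext (fun n => RtoC (a n) * w ^ n - RtoC (a n) * z ^ n - (w - z) * (RtoC (a n) * dpow n z))%C).
    - intros n. ring.
    - replace (CS (dps a) z * (w - z))%C with ((w - z) * CS (dps a) z)%C by ring.
      apply isC_minus; [apply isC_minus; apply CS_correct; try exact Ha; lra|].
      apply isC_scal, CS_dps; assumption. }
  set (D2 := Cmod (w - z)%C ^ 2).
  assert (HR2 : 0 < R0 ^ 2) by (apply pow_lt; lra).
  assert (Hb : forall n, Cmod (RtoC (a n) * (w ^ n - z ^ n - dpow n z * (w - z)))%C
                <= D2 / R0 ^ 2 * (Rabs (dq (dq a) n) * R0 ^ n)).
  { intros n. rewrite Cmod_mult, Cmod_R. unfold dq. rewrite !Rabs_mult, (Rabs_pos_eq (INR n)) by apply pos_INR.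
    pose proof (pow_taylor_bound w z R0 n (proj1 HR) HwR HzR) as T. fold D2 in T.
    apply (Rmult_le_reg_r (R0 ^ 2)); [exact HR2|].
    replace (D2 / R0 ^ 2 * (INR n * (INR n * Rabs (a n)) * R0 ^ n) * R0 ^ 2)
      with (Rabs (a n) * (INR n ^ 2 * R0 ^ n * D2)) by (field; lra).
    rewrite Rmult_assoc. apply Rmult_le_compat_l; [apply Rabs_pos|exact T]. }
  eapply Rle_trans; [apply (isC_bound _ _ _ H Hb)|].
  - apply (ex_series_scal (V := R_NormedModule) (D2 / R0 ^ 2)), He.
  - rewrite Series_scal_l. right. field. lra.
Qed.

Lemma Rabs_sin_le t : Rabs (sin t) <= Rabs t.
Proof.
  destruct (MVT_gen sin 0 t cos) as [xi [_ E]].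
  - intros x _. apply is_derive_Reals, derivable_pt_lim_sin.
  - intros x _. apply derivable_continuous_pt, derivable_pt_sin.
  - rewrite sin_0, !Rminus_0_r in E. rewrite E, Rabs_mult.
    assert (Rabs (cos xi) <= 1) by (apply Rabs_le; apply COS_bound).
    pose proof (Rabs_pos t). nra.
Qed.

Lemma cos_quadratic t : Rabs (cos t - 1) <= t ^ 2 / 2.
Proof.
  replace t with (2 * (t / 2)) at 1 by field. rewrite cos_2a_sin.
  replace (1 - 2 * sin (t / 2) * sin (t / 2) - 1) with (- (2 * (sin (t / 2) * sin (t / 2)))) by ring.
  rewrite Rabs_Ropp, Rabs_mult, (Rabs_pos_eq 2), Rabs_mult by lra.
  pose proof (Rabs_sin_le (t / 2)) as H. pose proof (Rabs_pos (sin (t / 2))).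
  assert (E : Rabs (t / 2) * Rabs (t / 2) = t ^ 2 / 4).
  { rewrite <- Rabs_mult, Rabs_pos_eq by nra. field. }
  nra.
Qed.

Lemma sin_quadratic t : Rabs t <= 1 -> Rabs (sin t - t) <= t ^ 2.
Proof.
  intros Ht. destruct (MVT_gen (fun x => sin x - x) 0 t (fun x => cos x - 1)) as [xi [Hxi E]].
  - intros x _. apply is_derive_Reals. apply (derivable_pt_lim_minus sin id); [apply derivable_pt_lim_sin|apply derivable_pt_lim_id].
  - intros x _. apply derivable_continuous_pt. apply derivable_pt_minus; [apply derivable_pt_sin|apply derivable_pt_id].
  - rewrite sin_0, !Rminus_0_r in E. rewrite E, Rabs_mult.
    pose proof (cos_quadratic xi) as H.
    assert (Hx : xi ^ 2 <= Rabs t).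
    { assert (Rabs xi <= Rabs t).
      { unfold Rmin, Rmax in Hxi. destruct (Rle_dec 0 t).
        - rewrite !Rabs_pos_eq by lra. lra.
        - rewrite !Rabs_left1 by lra. lra. }
      rewrite <- (pow2_abs xi). pose proof (Rabs_pos xi). nra. }
    rewrite <- (pow2_abs t). pose proof (Rabs_pos t). pose proof (Rabs_pos (cos xi - 1)). nra.
Qed.

Lemma exp_quadratic x : Rabs x <= / 2 -> Rabs (exp x - 1 - x) <= 2 * x ^ 2.
Proof.
  intros Hx. apply Rabs_le_between in Hx.
  assert (H1 : 1 + x <= exp x).
  { destruct (Req_dec x 0) as [->|Hne]; [rewrite exp_0; lra|]. left. apply exp_ineq1. exact Hne. }
  assert (H2 : exp x * (1 - x) <= 1).
  { assert (1 - x <= exp (- x)).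
    { destruct (Req_dec x 0) as [->|Hne]; [rewrite Ropp_0, exp_0; lra|]. left.
      replace (1 - x) with (1 + - x) by ring. apply exp_ineq1. lra. }
    assert (exp x * exp (- x) = 1) by (rewrite <- exp_plus, Rplus_opp_r; apply exp_0).
    pose proof (exp_pos x). nra. }
  rewrite Rabs_pos_eq by lra. nra.
Qed.

Lemma Cexp_plus z w : Cexp (z + w)%C = (Cexp z * Cexp w)%C.
Proof.
  destruct z as [x y], w as [x' y']. unfold Cexp, Cmult, Cplus, Re, Im. simpl.
  rewrite exp_plus, cos_plus, sin_plus. f_equal; ring.
Qed.

Lemma Cexp_quadratic h : Cmod h <= / 2 -> Cmod (Cexp h - 1 - h)%C <= 12 * Cmod h ^ 2.
Proof.
  intros Hh. destruct h as [x y]. set (m := Cmod (x, y)) in *.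
  assert (Hx : Rabs x <= m) by (apply (re_le_Cmod (x, y))).
  assert (Hy : Rabs y <= m) by (apply (im_le_Cmod (x, y))).
  assert (Hm : 0 <= m) by apply Cmod_ge_0.
  pose proof (exp_quadratic x ltac:(lra)) as He. pose proof (cos_quadratic y) as Hc.
  pose proof (sin_quadratic y ltac:(lra)) as Hs.
  assert (Hx2 : x ^ 2 <= m ^ 2) by (rewrite <- (pow2_abs x); pose proof (Rabs_pos x); nra).
  assert (Hy2 : y ^ 2 <= m ^ 2) by (rewrite <- (pow2_abs y); pose proof (Rabs_pos y); nra).
  set (e := exp x - 1 - x) in *. set (c := cos y - 1) in *. set (s := sin y - y) in *.
  eapply Rle_trans; [apply Cmod_le_sum|]. unfold Cexp. simpl.
  replace (exp x * cos y + - (1) + - x) with (e + c * (1 + x + e)) by (unfold e, c; ring).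
  replace (exp x * sin y + - 0 + - y) with (s * (1 + x + e) + (x + e) * y) by (unfold e, s; ring).
  assert (Hm2 : m ^ 2 <= m / 2) by nra.
  assert (Hxe : Rabs (x + e) <= 2 * m).
  { eapply Rle_trans; [apply Rabs_triang|]. lra. }
  assert (H1xe : Rabs (1 + x + e) <= 2).
  { replace (1 + x + e) with (1 + (x + e)) by ring. eapply Rle_trans; [apply Rabs_triang|]. rewrite Rabs_R1. lra. }
  assert (A : Rabs (e + c * (1 + x + e)) <= 3 * m ^ 2).
  { eapply Rle_trans; [apply Rabs_triang|]. rewrite Rabs_mult.
    pose proof (Rabs_pos c). pose proof (Rabs_pos (1 + x + e)). nra. }
  assert (B : Rabs (s * (1 + x + e) + (x + e) * y) <= 4 * m ^ 2).
  { eapply Rle_trans; [apply Rabs_triang|]. rewrite !Rabs_mult.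
    pose proof (Rabs_pos s). pose proof (Rabs_pos (1 + x + e)). pose proof (Rabs_pos (x + e)). pose proof (Rabs_pos y). nra. }
  assert (0 <= m ^ 2) by (apply pow_le; lra). lra.
Qed.

Lemma is_derive_Cexp z : is_derive_C Cexp z (Cexp z).
Proof.
  apply (is_derive_quadratic _ _ _ (12 * Cmod (Cexp z)) (/ 2)); [lra|]. intros w Hw.
  replace (Cexp w - Cexp z - Cexp z * (w - z))%C with (Cexp z * (Cexp (w - z) - 1 - (w - z)))%C.
  - rewrite Cmod_mult. pose proof (Cexp_quadratic (w - z)%C ltac:(lra)). pose proof (Cmod_ge_0 (Cexp z)). nra.
  - replace w with (z + (w - z))%C at 3 by ring. rewrite Cexp_plus. ring.
Qed.

(** * Functions on the upper half-plane *)

Lemma sigma_sig k n : INR (sigma k n) = sig k n.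
Proof.
  unfold sig. rewrite (lam_divisor (fun d => INR d ^ k)). unfold sigma, psum.
  assert (H : forall m, INR (list_sum (map (fun d => Nat.pow d k)
                 (filter (fun d => Nat.eqb (Nat.modulo n d) 0) (seq 1 m))))
            = bsum (fun i => iv (Nat.eqb (n mod S i) 0) (INR (S i) ^ k)) m).
  { induction m as [|m IH]; [reflexivity|].
    rewrite seq_S, filter_app, map_app, list_sum_app, plus_INR, IH, bsum_S. f_equal.
    cbn [filter]. unfold iv. change (1 + m)%nat with (S m).
    destruct (Nat.eqb (n mod S m) 0); [|reflexivity].
    change (INR (Nat.pow (S m) k + 0) = INR (S m) ^ k).
    rewrite Nat.add_0_r. apply pow_INR. }
  apply H.
Qed.

Lemma qpow_plus h1 h2 tau : qpow (h1 + h2) tau = (qpow h1 tau * qpow h2 tau)%C.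
Proof.
  unfold qpow. rewrite <- Cexp_plus. f_equal.
  rewrite Rmult_plus_distr_l, RtoC_plus. ring.
Qed.

Lemma Cexp_0 : Cexp 0 = 1%C.
Proof. unfold Cexp. simpl. rewrite exp_0, cos_0, sin_0. unfold RtoC. f_equal; ring. Qed.

Lemma qpow_0 tau : qpow 0 tau = 1%C.
Proof.
  unfold qpow. rewrite Rmult_0_r. replace (RtoC 0 * Ci * tau)%C with (RtoC 0) by ring. apply Cexp_0.
Qed.

Lemma qpow_nat n tau : qpow (INR n) tau = (q tau ^ n)%C.
Proof.
  induction n as [|n IH]; [apply qpow_0|].
  rewrite S_INR, qpow_plus, IH. unfold q. simpl. ring.
Qed.

Lemma Cmod_Cexp z : Cmod (Cexp z) = exp (Re z).
Proof.
  unfold Cmod, Cexp. simpl fst; simpl snd.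
  replace ((exp (Re z) * cos (Im z)) ^ 2 + (exp (Re z) * sin (Im z)) ^ 2) with (exp (Re z) ^ 2).
  - apply sqrt_pow2. left. apply exp_pos.
  - pose proof (sin2_cos2 (Im z)) as H. unfold Rsqr in H.
    transitivity (exp (Re z) ^ 2 * (sin (Im z) * sin (Im z) + cos (Im z) * cos (Im z))); [rewrite H|]; ring.
Qed.

Lemma Cmod_qpow h tau : Cmod (qpow h tau) = exp (- (2 * PI * h * Im tau)).
Proof.
  unfold qpow. rewrite Cmod_Cexp. f_equal. destruct tau. unfold Cmult, RtoC, Ci, Re, Im. simpl. ring.
Qed.

Lemma qpow_neq_0 h tau : qpow h tau <> 0%C.
Proof.
  intros H. apply (f_equal Cmod) in H. rewrite Cmod_qpow, Cmod_0 in H.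
  pose proof (exp_pos (- (2 * PI * h * Im tau))). lra.
Qed.

Lemma Cmod_q tau : upper tau -> Cmod (q tau) < 1.
Proof.
  intros H. unfold q. rewrite Cmod_qpow. apply Rlt_le_trans with (exp 0); [|rewrite exp_0; lra].
  apply exp_increasing.
  unfold upper in H. pose proof PI_RGT_0. nra.
Qed.

Lemma upper_open tau : upper tau -> locally (tau : AbsRing_UniformSpace C_AbsRing) upper.
Proof.
  intros H. exists (mkposreal _ H). intros w Hw. unfold upper in *.
  change (Cmod (w - tau)%C < Im tau) in Hw.
  pose proof (im_le_Cmod (w - tau)%C) as Hi. destruct w as [x y], tau as [x' y']. simpl in *.
  assert (Ha : Rabs (y + - y') < y') by lra. apply Rabs_def2 in Ha. lra.
Qed.

(** The composition and product rules regard C as a module over itself through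
    [AbsRing_NormedModule], a structure distinct from [C_NormedModule]; the two notions of
    derivative have the same content. *)
Lemma is_derive_C_AbsRing f z l :
  is_derive_C f z l <-> @is_derive C_AbsRing (AbsRing_NormedModule C_AbsRing) f z l.
Proof.
  split; intros [[A B C0] H]; (split; [split; [exact A|exact B|exact C0]|exact H]).
Qed.

Lemma is_derive_qpow h tau : is_derive_C (qpow h) tau (RtoC (2 * PI * h) * Ci * qpow h tau)%C.
Proof.
  unfold qpow. set (c := (RtoC (2 * PI * h) * Ci)%C).
  apply (is_derive_comp (K := C_AbsRing) (V := C_NormedModule) Cexp (fun t => c * t)%C tau _ c).
  - apply is_derive_Cexp.
  - apply is_derive_C_AbsRing, (is_derive_quadratic _ _ _ 0 1); [lra|]. intros w _.
    replace (c * w - c * tau - c * (w - tau))%C with (RtoC 0) by ring. rewrite Cmod_0. lra.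
Qed.

Definition qser (h : R) (a : ps) (tau : C) : C := (qpow h tau * CS a (q tau))%C.

Lemma two_pi_i_neq_0 : (RtoC (2 * PI) * Ci)%C <> 0%C.
Proof.
  intros H. apply (f_equal snd) in H. simpl in H. pose proof PI_RGT_0. lra.
Qed.

Lemma is_derive_qser h a tau :
  conv a -> upper tau -> is_derive_C (qser h a) tau (RtoC (2 * PI) * Ci * qser h (dqe h a) tau)%C.
Proof.
  intros Ha Ht. pose proof (Cmod_q tau Ht) as Hq.
  assert (Hc : is_derive_C (fun t => CS a (q t)) tau
     ((RtoC (2 * PI * 1) * Ci * q tau) * CS (dps a) (q tau))%C).
  { apply (is_derive_comp (K := C_AbsRing) (V := C_NormedModule) (CS a) q tau).
    - apply is_derive_CS; assumption.
    - apply is_derive_C_AbsRing, is_derive_qpow. }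
  apply is_derive_C_AbsRing in Hc.
  pose proof (is_derive_mult (K := C_AbsRing) _ _ _ _ _
    (proj1 (is_derive_C_AbsRing _ _ _) (is_derive_qpow h tau)) Hc Cmult_comm) as H.
  apply is_derive_C_AbsRing. unfold qser.
  replace (RtoC (2 * PI) * Ci * (qpow h tau * CS (dqe h a) (q tau)))%C
    with (@plus C_AbsRing (mult (RtoC (2 * PI * h) * Ci * qpow h tau)%C (CS a (q tau)))
             (mult (qpow h tau) (RtoC (2 * PI * 1) * Ci * q tau * CS (dps a) (q tau))%C)); [exact H|].
  unfold dqe. rewrite CS_add, CS_scal, CS_dq; try assumption.
  - change (RtoC (2 * PI * h) * Ci * qpow h tau * CS a (q tau)
       + qpow h tau * (RtoC (2 * PI * 1) * Ci * q tau * CS (dps a) (q tau))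
     = RtoC (2 * PI) * Ci * (qpow h tau * (q tau * CS (dps a) (q tau) + RtoC h * CS a (q tau))))%C.
    rewrite Rmult_1_r, (RtoC_mult (2 * PI) h). ring.
  - apply conv_dq, Ha.
  - apply conv_mul; [apply conv_cst|exact Ha].
Qed.

Lemma conv_dqe h a : conv a -> conv (dqe h a).
Proof. intros Ha. apply conv_add; [apply conv_dq, Ha|apply conv_mul; [apply conv_cst|exact Ha]]. Qed.

Lemma conv_Dk k h a : conv a -> conv (Dk k h a).
Proof.
  intros Ha. apply conv_sub; [apply conv_dqe, Ha|].
  apply conv_mul; [apply conv_mul; [apply conv_cst|apply conv_eis2]|exact Ha].
Qed.

Definition agrees (f : C -> C) (h : R) (a : ps) : Prop := forall tau, upper tau -> f tau = qser h a tau.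

Lemma agrees_derive f h a tau :
  conv a -> agrees f h a -> upper tau ->
  is_derive_C f tau (RtoC (2 * PI) * Ci * qser h (dqe h a) tau)%C.
Proof.
  intros Ha Hf Ht. apply (is_derive_ext_loc (K := C_AbsRing) (qser h a)).
  - generalize (upper_open tau Ht). apply filter_imp. intros w Hw. symmetry. apply Hf, Hw.
  - apply is_derive_qser; assumption.
Qed.

Lemma agrees_theta f h a : conv a -> agrees f h a -> agrees (theta f) h (dqe h a).
Proof.
  intros Ha Hf tau Ht. unfold theta.
  rewrite (is_C_derive_unique _ _ _ (agrees_derive f h a tau Ha Hf Ht)). field.
  pose proof two_pi_i_neq_0 as H. split; intros E; apply H; rewrite E; ring.
Qed.

Lemma CS_eisenstein (c : R) (e : ps) (k : nat) z :
  Cmod z < 1 -> e O = 1 -> (forall n, e (S n) = c * sig k (S n)) ->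
  CS e z = (1 + RtoC c * CSeries (fun n => RtoC (INR (sigma k (S n))) * z ^ S n))%C.
Proof.
  intros Hz e0 Hs. set (s := CSeries (fun n => RtoC (INR (sigma k (S n))) * z ^ S n)%C).
  assert (H : isC (fun n => RtoC (INR (sigma k (S n))) * z ^ S n)%C s).
  { apply (isC_of_abs _ (fun n => Rabs (sig k (S n)) * Cmod z ^ S n)).
    - intros n. rewrite sigma_sig, Cmod_mult, Cmod_R, Cmod_pow. lra.
    - apply (ex_series_incr_1 (fun n => Rabs (sig k n) * Cmod z ^ n)).
      apply conv_abs; [apply conv_sig|]. split; [apply Cmod_ge_0|exact Hz]. }
  apply CS_unique. replace (RtoC 1) with (RtoC (e O) * z ^ O)%C by (rewrite e0; simpl; ring).
  apply (isC_decr (fun n => RtoC (e n) * z ^ n)%C).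
  apply (isC_ext (fun n => RtoC c * (RtoC (INR (sigma k (S n))) * z ^ S n))%C).
  - intros n. rewrite Hs, sigma_sig, RtoC_mult. ring.
  - apply isC_scal, H.
Qed.

Lemma E2_CS tau : upper tau -> E2 tau = CS eis2 (q tau).
Proof.
  intros Ht. rewrite (CS_eisenstein (-24) eis2 1); [|apply Cmod_q, Ht|apply eis2_0|intros n; rewrite eis2_coef; ring].
  unfold E2. replace (RtoC (-24)) with (- RtoC 24)%C by (rewrite <- RtoC_opp; reflexivity). ring.
Qed.
Lemma E4_CS tau : upper tau -> E4 tau = CS eis4 (q tau).
Proof.
  intros Ht. rewrite (CS_eisenstein 240 eis4 3); [|apply Cmod_q, Ht|apply eis4_0|apply eis4_coef].
  reflexivity.
Qed.

Lemma agrees_D k f h a : conv a -> agrees f h a -> agrees (D k f) h (Dk (IZR k) h a).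
Proof.
  intros Ha Hf tau Ht. unfold D. pose proof (Cmod_q tau Ht) as Hq.
  rewrite (agrees_theta f h a Ha Hf tau Ht), (E2_CS tau Ht), (Hf tau Ht). unfold qser, Dk.
  assert (H2 : conv (cst (IZR k / 12) * eis2)%ps) by (apply conv_mul; [apply conv_cst|apply conv_eis2]).
  rewrite CS_sub, (CS_mul (cst (IZR k / 12) * eis2)%ps), CS_scal; try assumption;
    [ring|apply conv_eis2|apply conv_dqe, Ha|apply conv_mul; assumption].
Qed.

(** * The identity theorem for q-expansions and the passage from functions to series *)

Lemma q_arbitrarily_small (e : R) : 0 < e -> exists tau, upper tau /\ Cmod (q tau) < e.
Proof.
  intros He. set (y := Rabs (ln e) + 1). pose proof (Rabs_pos (ln e)) as H0.
  exists ((0, y) : C). split; [unfold upper; simpl; unfold y; lra|].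
  unfold q. rewrite Cmod_qpow. simpl Im. rewrite <- (exp_ln e) at 1 by exact He. apply exp_increasing.
  pose proof (Rle_abs (- ln e)) as H1. rewrite Rabs_Ropp in H1. pose proof PI2_3_2. unfold PI2 in *. unfold y. nra.
Qed.

(** b(z) = b_0 + z t with t bounded for |z| <= 1/2. *)
Lemma CS_small_neq_0 b : conv b -> b O <> 0 -> exists e, 0 < e /\ forall z, Cmod z < e -> CS b z <> 0%C.
Proof.
  intros Hb b0. set (B := Series (fun n => Rabs (b (S n)) * (/ 2) ^ n)).
  assert (He : ex_series (fun n => Rabs (b (S n)) * (/ 2) ^ n)).
  { apply (conv_abs (fun n => b (S n))); [apply conv_shift, Hb|lra]. }
  assert (Hbound : forall z, Cmod z <= / 2 -> exists t, CS b z = (RtoC (b O) + z * t)%C /\ Cmod t <= 2 * B).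
  { intros z Hz. exists (CS (fun n => b (S n)) z).
    assert (H : isC (fun n => RtoC (b (S n)) * z ^ n)%C (CS (fun n => b (S n)) z)).
    { apply CS_correct; [apply conv_shift, Hb|lra]. }
    split.
    - apply CS_unique. replace (RtoC (b O)) with (RtoC (b O) * z ^ 0)%C by (simpl; ring).
      apply (isC_decr (fun n => RtoC (b n) * z ^ n)%C).
      apply (isC_ext (fun n => z * (RtoC (b (S n)) * z ^ n))%C); [intros n; simpl; ring|]. apply isC_scal, H.
    - apply (isC_bound _ _ (fun n => Rabs (b (S n)) * (/ 2) ^ n) H); [|exact He].
      intros n. rewrite Cmod_mult, Cmod_R, Cmod_pow. apply Rmult_le_compat_l; [apply Rabs_pos|].
      apply pow_incr. split; [apply Cmod_ge_0|exact Hz]. }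
  assert (HB : 0 <= B).
  { destruct (Hbound 0%C) as [t [_ Ht]]; [rewrite Cmod_0; lra|]. pose proof (Cmod_ge_0 t). lra. }
  assert (Hb0 : 0 < Rabs (b O)) by (apply Rabs_pos_lt, b0).
  set (d := Rabs (b O) / (2 * B + 1)).
  assert (Hd : 0 < d) by (apply Rdiv_lt_0_compat; lra).
  exists (Rmin (/ 2) d). split; [apply Rmin_glb_lt; lra|]. intros z Hz E.
  assert (Hz1 : Cmod z < / 2) by (eapply Rlt_le_trans; [exact Hz|apply Rmin_l]).
  assert (Hz2 : Cmod z < d) by (eapply Rlt_le_trans; [exact Hz|apply Rmin_r]).
  destruct (Hbound z) as [t [E' Ht]]; [lra|]. rewrite E in E'.
  assert (Em : RtoC (b O) = (- (z * t))%C).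
  { replace (RtoC (b O)) with ((RtoC (b O) + z * t) - z * t)%C by ring. rewrite <- E'. ring. }
  apply (f_equal Cmod) in Em. rewrite Cmod_opp, Cmod_mult, Cmod_R in Em.
  assert (Hd2 : d * (2 * B + 1) = Rabs (b O)) by (unfold d; field; lra).
  pose proof (Cmod_ge_0 z). pose proof (Cmod_ge_0 t). nra.
Qed.

Lemma first_nonzero (a : ps) :
  (forall n, a n = 0) \/ exists n, a n <> 0 /\ forall i, (i < n)%nat -> a i = 0.
Proof.
  destruct (classic (forall n, a n = 0)) as [H|H]; [left; exact H|right].
  apply not_all_ex_not in H. destruct H as [n Hn].
  induction n as [n IH] using (well_founded_induction lt_wf).
  destruct (classic (exists i, (i < n)%nat /\ a i <> 0)) as [[i [Hi Hai]]|Hno]; [exact (IH i Hi Hai)|].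
  exists n. split; [exact Hn|]. intros i Hi. apply NNPP. intros Hai. apply Hno. exists i. split; assumption.
Qed.

Definition tail (n : nat) (a : ps) : ps := fun i => a (n + i)%nat.

Lemma conv_tail n a : conv a -> conv (tail n a).
Proof.
  intros Ha. induction n as [|n IH]; [exact Ha|]. unfold tail in *.
  apply (conv_le _ (fun i => a (n + S i)%nat)); [|apply (conv_shift _ IH)].
  intros i. rewrite Nat.add_succ_comm. lra.
Qed.

Lemma qser_tail n h a tau :
  conv a -> (forall i, (i < n)%nat -> a i = 0) -> upper tau -> qser h a tau = qser (h + INR n) (tail n a) tau.
Proof.
  intros Ha Hn Ht. unfold qser. rewrite qpow_plus, qpow_nat, <- Cmult_assoc. f_equal.
  apply CS_unique. revert a Ha Hn. induction n as [|n IH]; intros a Ha Hn.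
  - replace (q tau ^ 0 * CS (tail 0 a) (q tau))%C with (CS a (q tau)) by (change (tail 0 a) with a; cbn [Cpow]; ring).
    apply CS_correct; [exact Ha|apply Cmod_q, Ht].
  - replace (q tau ^ S n * CS (tail (S n) a) (q tau))%C
      with (RtoC (a O) * q tau ^ 0 + q tau * (q tau ^ n * CS (tail n (fun i => a (S i))) (q tau)))%C.
    + apply (isC_decr (fun i => RtoC (a i) * q tau ^ i)%C).
      apply (isC_ext (fun i => q tau * (RtoC (a (S i)) * q tau ^ i))%C); [intros i; simpl; ring|].
      apply isC_scal, IH; [apply conv_shift, Ha|]. intros i Hi. apply Hn. lia.
    + rewrite (Hn O) by lia. change (tail n (fun i => a (S i))) with (tail (S n) a). cbn [Cpow]. ring.
Qed.

Lemma qser_zero h a : conv a -> (forall tau, upper tau -> qser h a tau = 0%C) -> forall n, a n = 0.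
Proof.
  intros Ha H. destruct (first_nonzero a) as [H0|[n [Hn Hlow]]]; [exact H0|exfalso].
  destruct (CS_small_neq_0 (tail n a)) as [e [He Hne]]; [apply conv_tail, Ha|unfold tail; rewrite Nat.add_0_r; exact Hn|].
  destruct (q_arbitrarily_small e He) as [tau [Ht Hq]].
  specialize (H tau Ht). rewrite (qser_tail n) in H by assumption.
  exact (Cmult_neq_0 _ _ (qpow_neq_0 _ _) (Hne _ Hq) H).
Qed.

Lemma qser_inj h a b :
  conv a -> conv b -> (forall tau, upper tau -> qser h a tau = qser h b tau) -> a = b.
Proof.
  intros Ha Hb H. apply ps_ext. intros n. apply Rminus_diag_uniq.
  apply (qser_zero h (a - b)%ps); [apply conv_sub; assumption|].
  intros tau Ht. unfold qser in *. rewrite CS_sub by (try assumption; apply Cmod_q, Ht).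
  specialize (H tau Ht).
  transitivity (qpow h tau * CS a (q tau) - qpow h tau * CS b (q tau))%C; [|rewrite H]; ring.
Qed.

Lemma is_solution_ode k0 k1 f h a :
  conv a -> agrees f h a -> (is_solution k0 k1 f <-> ode (IZR k0) (Q2R k1) h a).
Proof.
  intros Ha Hf.
  assert (HD : agrees (D (k0 + 2) (D k0 f)) h (Dk (IZR k0 + 2) h (Dk (IZR k0) h a))).
  { rewrite <- (plus_IZR k0 2). apply agrees_D; [apply conv_Dk, Ha|]. apply agrees_D; assumption. }
  assert (HE : forall tau, upper tau ->
      (RtoC (Q2R k1) * E4 tau * f tau)%C = qser h (cst (Q2R k1) * eis4 * a)%ps tau).
  { intros tau Ht. pose proof (Cmod_q tau Ht). rewrite (E4_CS tau Ht), (Hf tau Ht). unfold qser.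
    assert (H4 : conv (cst (Q2R k1) * eis4)%ps) by (apply conv_mul; [apply conv_cst|apply conv_eis4]).
    rewrite CS_mul, CS_scal by (try assumption; apply conv_eis4). ring. }
  split.
  - intros [_ H]. unfold ode. apply (qser_inj h).
    + apply conv_Dk, conv_Dk, Ha.
    + apply conv_mul; [apply conv_mul; [apply conv_cst|apply conv_eis4]|exact Ha].
    + intros tau Ht. rewrite <- HE, <- HD by exact Ht. specialize (H tau Ht).
      rewrite <- (Cplus_0_r (_ * f tau)%C), <- H. ring.
  - intros H. split.
    + intros tau Ht. eexists. apply (agrees_derive f h a tau Ha Hf Ht).
    + intros tau Ht. rewrite (HD tau Ht), (HE tau Ht). unfold ode in H. rewrite H. ring.
Qed.

Lemma pow_n_Cpow (z : C) n : @pow_n C_Ring z n = (z ^ n)%C.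
Proof. induction n as [|n IH]; [reflexivity|]. simpl. rewrite IH. reflexivity. Qed.

Lemma isC_pseries (a : ps) z l :
  isC (fun n => RtoC (a n) * z ^ n)%C l
  <-> @is_pseries C_AbsRing C_NormedModule (fun n => RtoC (a n)) z l.
Proof.
  unfold is_pseries. rewrite isC_series.
  assert (E : forall n, scal (pow_n (K := C_Ring) z n) (RtoC (a n) : C_NormedModule) = (RtoC (a n) * z ^ n)%C).
  { intros n. rewrite pow_n_Cpow. apply Cmult_comm. }
  split; apply is_series_ext; intros n; [symmetry|]; apply E.
Qed.

Lemma q_modulus rho : 0 < rho < 1 -> exists tau, upper tau /\ Cmod (q tau) = rho.
Proof.
  intros Hr. pose proof PI_RGT_0. exists ((0, - ln rho / (2 * PI)) : C).
  assert (Hl : ln rho < 0) by (rewrite <- ln_1; apply ln_increasing; lra). split.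
  - unfold upper. simpl. apply Rdiv_lt_0_compat; lra.
  - unfold q. rewrite Cmod_qpow. simpl Im.
    replace (- (2 * PI * 1 * (- ln rho / (2 * PI)))) with (ln rho) by (field; lra).
    apply exp_ln. lra.
Qed.

(** Convergence at q bounds the terms of the series there, and every rho in (0, 1) is the modulus of
    some q(tau); this yields [conv]. *)
Lemma has_rational_qexp_iff f h a :
  has_rational_qexp f h a <-> conv (fun n => Q2R (a n)) /\ agrees f h (fun n => Q2R (a n)).
Proof.
  split.
  - intros H. split.
    + intros rho Hr. destruct (q_modulus rho Hr) as [tau [Ht Hq]]. destruct (H tau Ht) as [s [Hs _]].
      apply isC_pseries in Hs. destruct Hs as [H1 H2].
      assert (B : forall u : nat -> R, ex_series u -> exists M, 0 < M /\ forall n, Rabs (u n) <= M).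
      { intros u Hu. apply maj_by_pos. exists 0. apply is_lim_seq_Reals, ex_series_lim_0, Hu. }
      destruct (B _ (ex_intro _ _ H1)) as [M1 [_ HM1]]. destruct (B _ (ex_intro _ _ H2)) as [M2 [_ HM2]].
      exists (M1 + M2). intros n. rewrite <- Hq, <- (Cmod_term (fun n => Q2R (a n))).
      eapply Rle_trans; [apply Cmod_le_sum|]. specialize (HM1 n). specialize (HM2 n). lra.
    + intros tau Ht. destruct (H tau Ht) as [s [Hs ->]]. apply isC_pseries in Hs.
      unfold qser. rewrite (CS_unique _ _ _ Hs). reflexivity.
  - intros [Hc Hf] tau Ht. exists (CS (fun n => Q2R (a n)) (q tau)). split; [|apply Hf, Ht].
    apply (isC_pseries (fun n => Q2R (a n))), CS_correct; [exact Hc|apply Cmod_q, Ht].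
Qed.

Lemma bounded_denominators_bdd a : bounded_denominators a <-> bdd (fun n => Q2R (a n)).
Proof.
  split.
  - intros [N [HN H]]. exists N. split; [lia|]. intros n. destruct (H n) as [z Hz]. exists z.
    apply Qeq_eqR in Hz. rewrite Q2R_mult in Hz. unfold Q2R in Hz at 1 3. simpl in Hz. lra.
  - intros [N [HN H]]. exists (Z.abs N). split; [lia|]. intros n. destruct (H n) as [z Hz].
    exists (Z.sgn N * z)%Z. apply eqR_Qeq. rewrite Q2R_mult. unfold Q2R at 1 3. simpl.
    rewrite !Rinv_1, !Rmult_1_r, mult_IZR, <- Hz, <- Rmult_assoc, <- mult_IZR. f_equal. f_equal. lia.
Qed.

(** * Solutions of the equation in weight k0 *)

Lemma eta_power_inverse (s : Z) :
  exists phi psi : ps, zps phi /\ zps psi /\ phi O = 1 /\ psi O = 1 /\ (psi * phi = qc 1)%ps /\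
    dq phi = (cst (IZR s / 24) * (eis2 - qc 1) * phi)%ps /\
    dq psi = (cst (IZR (- s) / 24) * (eis2 - qc 1) * psi)%ps.
Proof.
  destruct (eta_power s) as [phi [H1 [H2 H3]]]. destruct (eta_power (- s)) as [psi [H4 [H5 H6]]].
  exists phi, psi. repeat (split; [assumption|]). split; [|split; assumption].
  assert (E : dq (psi * phi) = qc 0).
  { rewrite dq_mul, H3, H6. rewrite opp_IZR.
    replace (- IZR s / 24) with ((-1) * (IZR s / 24)) by field.
    rewrite cst_mul, (cst_Q (-1) (-1)) by (q2r; field). ring. }
  apply ps_ext. intros [|n].
  - rewrite pmul_coef0, H2, H5. unfold qc, cst. q2r. field.
  - apply (f_equal (fun a => a (S n))) in E. unfold dq, qc, cst in E. unfold qc, cst.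
    apply Rmult_integral in E. destruct E as [E|E]; [|exact E]. exfalso. apply (not_0_INR (S n)); [lia|exact E].
Qed.

Lemma conv_eta_power c phi : dq phi = (cst c * (eis2 - qc 1) * phi)%ps -> conv phi.
Proof.
  apply conv_log.
  - rewrite cst_mul_coef. unfold psub. rewrite eis2_0. unfold qc, cst. q2r. field.
  - apply conv_mul; [apply conv_cst|]. apply conv_sub; [apply conv_eis2|apply conv_cst].
Qed.

Lemma zps_isQ a n : zps a -> isQ (a n).
Proof. intros H. apply isQ_isZ, H. Qed.

Lemma isQ_mul_coef (a b : ps) : (forall n, isQ (a n)) -> (forall n, isQ (b n)) -> forall n, isQ ((a * b)%ps n).
Proof.
  intros Ha Hb n. unfold pmul. generalize (S n) as m.
  induction m as [|m IH]; [apply (isQ_IZR 0)|]. rewrite bsum_S. apply isQ_add; [exact IH|].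
  apply isQ_mul; [apply Ha|apply Hb].
Qed.

(** The Frobenius series times eta^(2 k0). In the theorem k0 + 1 = 6 (m_1 + m_2), so the exponent is
    m_1 for r = m_1 - m_2 and m_2 for -r. *)
Lemma qser_solution P Qd k0 k1 :
  (2 <= Qd)%Z -> Z.gcd P Qd = 1%Z -> Q2R k1 = kone (ratio P Qd) ->
  exists (h : R) (a : nat -> Q), h = (IZR k0 + 1) / 12 + ratio P Qd / 2 /\
    Q2R (a O) = 1 /\ conv (fun n => Q2R (a n)) /\
    is_solution k0 k1 (qser h (fun n => Q2R (a n))) /\
    has_rational_qexp (qser h (fun n => Q2R (a n))) h a.
Proof.
  intros HQ Hg Hk. set (r := ratio P Qd) in *.
  assert (Hi : indicial r) by (apply indicial_ratio; assumption).
  destruct (frobenius_exists r Hi) as [G [G0 HG]].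
  destruct (eta_power (2 * k0)) as [phi [Hz [phi0 Hphi]]].
  assert (HGc : conv G) by (apply (conv_frobenius P Qd); assumption).
  assert (HGq : forall n, isQ (G n)) by (apply (isQ_frobenius r); try assumption; apply isQ_ratio).
  assert (Hq : forall n, exists y : Q, (G * phi)%ps n = Q2R y).
  { intros n. apply isQ_eq, isQ_mul_coef; [exact HGq|]. intros m. apply zps_isQ, Hz. }
  apply choice in Hq. destruct Hq as [a Ha].
  assert (Ea : (fun n => Q2R (a n)) = (G * phi)%ps) by (apply ps_ext; intros n; symmetry; apply Ha).
  assert (Hc : conv (G * phi)%ps) by (apply conv_mul; [exact HGc|apply (conv_eta_power _ _ Hphi)]).
  exists ((IZR k0 + 1) / 12 + r / 2), a. rewrite Ea. split; [reflexivity|]. split.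
  { rewrite <- Ha, pmul_coef0, G0, phi0. ring. }
  split; [exact Hc|].
  assert (Hagr : agrees (qser ((IZR k0 + 1) / 12 + r / 2) (G * phi)) ((IZR k0 + 1) / 12 + r / 2) (G * phi))
    by (intros tau _; reflexivity).
  split.
  - apply (is_solution_ode _ _ _ _ _ Hc Hagr). rewrite Hk.
    pose proof (weight_shift 0 (kone r) (/ 12 + r / 2) (IZR (2 * k0)) G phi HG Hphi) as H.
    rewrite mult_IZR in H.
    replace (0 + 2 * IZR k0 / 2) with (IZR k0) in H by field.
    replace (/ 12 + r / 2 + 2 * IZR k0 / 24) with ((IZR k0 + 1) / 12 + r / 2) in H by field. exact H.
  - apply has_rational_qexp_iff. rewrite Ea. split; [exact Hc|exact Hagr].
Qed.

Definition root_of_unity (h : R) : C := Cexp (RtoC (2 * PI * h) * Ci)%C.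

Lemma qpow_translate h tau : qpow h (tau + 1)%C = (root_of_unity h * qpow h tau)%C.
Proof. unfold qpow, root_of_unity. rewrite <- Cexp_plus. f_equal. ring. Qed.

Lemma root_of_unity_eq h : root_of_unity h = (cos (2 * PI * h), sin (2 * PI * h)).
Proof.
  unfold root_of_unity, Cexp, Cmult, RtoC, Ci, Re, Im. simpl.
  replace (2 * PI * h * 0 - 0 * 1) with 0 by ring. replace (2 * PI * h * 1 + 0 * 0) with (2 * PI * h) by ring.
  rewrite exp_0, !Rmult_1_l. reflexivity.
Qed.

Lemma qser_translate h a tau : qser h a (tau + 1)%C = (root_of_unity h * qser h a tau)%C.
Proof.
  unfold qser, q. rewrite !qpow_translate, (root_of_unity_eq 1), Rmult_1_r, cos_2PI, sin_2PI.
  change (1, 0) with (RtoC 1). rewrite Cmult_1_l. symmetry. apply Cmult_assoc.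
Qed.

Lemma root_of_unity_plus h1 h2 : root_of_unity (h1 + h2) = (root_of_unity h1 * root_of_unity h2)%C.
Proof. unfold root_of_unity. rewrite <- Cexp_plus. f_equal. rewrite Rmult_plus_distr_l, RtoC_plus. ring. Qed.

Lemma root_of_unity_trivial h : root_of_unity h = 1%C -> exists k, h = IZR k.
Proof.
  rewrite root_of_unity_eq. intros E. apply (f_equal fst) in E. simpl in E.
  replace (2 * PI * h) with (2 * (PI * h)) in E by ring. rewrite cos_2a_sin in E.
  assert (H : sin (PI * h) = 0) by nra. apply sin_eq_0_0 in H. destruct H as [k Hk]. exists k.
  pose proof PI_RGT_0. nra.
Qed.

(* The translation of tau by 1 multiplies the two functions by different constants. *)
Lemma qser_lin_indep h1 h2 a b :
  conv a -> conv b -> a O <> 0 -> b O <> 0 -> (forall k, h1 - h2 <> IZR k) ->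
  lin_indep (qser h1 a) (qser h2 b).
Proof.
  intros Ha Hb a0 b0 Hh c1 c2 H.
  assert (Hne : forall h c, conv c -> c O <> 0 -> exists tau, upper tau /\ qser h c tau <> 0%C).
  { intros h c Hc c0. apply NNPP. intros Hn. apply c0. apply (qser_zero h c Hc). intros tau Ht.
    apply NNPP. intros Ht0. apply Hn. exists tau. split; assumption. }
  assert (Hc : forall c t : C, (c * t)%C = 0%C -> t <> 0%C -> c = 0%C).
  { intros c t E Ht. apply NNPP. intros E0. exact (Cmult_neq_0 _ _ E0 Ht E). }
  assert (Hd : (root_of_unity h1 - root_of_unity h2)%C <> 0%C).
  { intros E. destruct (root_of_unity_trivial (h1 - h2)) as [k Hk]; [|exact (Hh k Hk)].
    assert (E2 : (root_of_unity (h1 - h2) - 1)%C = 0%C).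
    { apply (Hc _ (root_of_unity h2)).
      - rewrite <- E. replace h1 with ((h1 - h2) + h2) at 2 by ring. rewrite root_of_unity_plus. ring.
      - unfold root_of_unity. intros E0. apply (f_equal Cmod) in E0. rewrite Cmod_Cexp, Cmod_0 in E0.
        pose proof (exp_pos (Re (RtoC (2 * PI * h2) * Ci)%C)). lra. }
    replace (root_of_unity (h1 - h2)) with ((root_of_unity (h1 - h2) - 1) + 1)%C by ring. rewrite E2. ring. }
  assert (Hc1 : c1 = 0%C).
  { destruct (Hne h1 a Ha a0) as [tau [Ht Hnz]].
    assert (Ht1 : upper (tau + 1)%C).
    { unfold upper in *. destruct tau as [x y]. simpl in *. lra. }
    pose proof (H tau Ht) as E1. pose proof (H _ Ht1) as E2. rewrite !qser_translate in E2.
    apply (Hc _ ((root_of_unity h1 - root_of_unity h2) * qser h1 a tau)%C).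
    - transitivity ((c1 * (root_of_unity h1 * qser h1 a tau) + c2 * (root_of_unity h2 * qser h2 b tau))
         - root_of_unity h2 * (c1 * qser h1 a tau + c2 * qser h2 b tau))%C; [ring|]. rewrite E1, E2. ring.
    - apply Cmult_neq_0; assumption. }
  split; [exact Hc1|].
  destruct (Hne h2 b Hb b0) as [tau [Ht Hnz]]. specialize (H tau Ht). rewrite Hc1 in H.
  apply (Hc _ (qser h2 b tau)); [|exact Hnz]. rewrite <- H. ring.
Qed.

Lemma ode_tail n k kap h a :
  (forall i, (i < n)%nat -> a i = 0) -> ode k kap h a -> ode k kap (h + INR n) (tail n a).
Proof.
  revert h a. induction n as [|n IH]; intros h a Hn H; [simpl; rewrite Rplus_0_r; exact H|].
  rewrite S_INR. replace (h + (INR n + 1)) with ((h + 1) + INR n) by ring.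
  change (tail (S n) a) with (tail n (fun i => a (S i))). apply IH.
  - intros i Hi. apply Hn. lia.
  - apply ode_qX. rewrite <- qX_div; [exact H|]. apply Hn. lia.
Qed.

Lemma bdd_tail_iff n a : (forall i, (i < n)%nat -> a i = 0) -> (bdd (tail n a) <-> bdd a).
Proof.
  intros Hn. split; intros [N [HN H]]; exists N; (split; [exact HN|]); intros i.
  - destruct (le_lt_dec n i) as [Hi|Hi].
    + specialize (H (i - n)%nat). unfold tail in H. replace (n + (i - n))%nat with i in H by lia. exact H.
    + rewrite Hn, Rmult_0_r by exact Hi. apply (isZ_IZR 0).
  - apply H.
Qed.

(* Stripping the leading power of q and an eta power leaves a weight 0 solution [g]. *)
Lemma normal_form k0 k1 r f h a phi psi :
  Q2R k1 = kone r -> zps phi -> zps psi -> phi O = 1 -> psi O = 1 -> (psi * phi = qc 1)%ps ->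
  dq psi = (cst (IZR (- (2 * k0)) / 24) * (eis2 - qc 1) * psi)%ps ->
  is_solution k0 k1 f -> has_rational_qexp f h a -> ~ (forall tau, upper tau -> f tau = 0%C) ->
  exists r' g, (r' = r \/ r' = - r) /\ g O <> 0 /\ isQ (g O) /\
    ode 0 (kone r') (/ 12 + r' / 2) g /\ conv (g * phi)%ps /\
    agrees f ((IZR k0 + 1) / 12 + r' / 2) (g * phi)%ps /\
    (bounded_denominators a <-> bdd g).
Proof.
  intros Hk Hzphi Hzpsi phi0 psi0 Hinv Hpsi Hsol Hqe Hf0.
  apply has_rational_qexp_iff in Hqe. destruct Hqe as [Hc Hf]. set (A := fun n => Q2R (a n)) in *.
  apply (is_solution_ode _ _ _ _ _ Hc Hf) in Hsol.
  destruct (first_nonzero A) as [H0|[n [HAn Hlow]]].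
  { exfalso. apply Hf0. intros tau Ht. rewrite (Hf tau Ht). unfold qser.
    replace A with (cst 0).
    - rewrite CS_cst. ring.
    - apply ps_ext. intros i. rewrite H0. destruct i; reflexivity. }
  apply (ode_tail n) in Hsol; [|exact Hlow]. rewrite Hk in Hsol.
  pose proof (weight_shift _ _ _ _ _ _ Hsol Hpsi) as Hg.
  rewrite opp_IZR, mult_IZR in Hg.
  replace (IZR k0 + - (2 * IZR k0) / 2) with 0 in Hg by field.
  set (al := h + INR n + - (2 * IZR k0) / 24) in *.
  set (g := (tail n A * psi)%ps) in *.
  assert (Eg : (g * phi)%ps = tail n A).
  { unfold g. replace (tail n A * psi * phi)%ps with (tail n A * (psi * phi))%ps by ring. rewrite Hinv. ring. }
  assert (Eg0 : g O = A n).
  { unfold g. rewrite pmul_coef0, psi0. unfold tail. rewrite Nat.add_0_r. ring. }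
  (* The exponent h of the given expansion is an arbitrary real number; the indicial equation at the
     first nonzero coefficient identifies it up to the integer n. *)
  assert (Hal : al = / 12 + r / 2 \/ al = / 12 + - r / 2).
  { rewrite ode0_coef in Hg. specialize (Hg O). simpl bsum in Hg. rewrite Eg0 in Hg.
    apply Rmult_integral in Hg. destruct Hg as [Hg|Hg]; [|contradiction].
    assert (E : (al - (/ 12 + r / 2)) * (al - (/ 12 + - r / 2)) = 0) by (rewrite <- Hg; unfold kone; simpl; field).
    apply Rmult_integral in E. destruct E; [left|right]; lra. }
  assert (Hb : bounded_denominators a <-> bdd g).
  { rewrite bounded_denominators_bdd. fold A. rewrite <- (bdd_tail_iff n A Hlow), <- Eg. split; intros H.
    - rewrite Eg in H. unfold g. apply bdd_mul; [exact H|apply zps_bdd, Hzpsi].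
    - apply bdd_mul; [exact H|apply zps_bdd, Hzphi]. }
  assert (Hr : exists r', (r' = r \/ r' = - r) /\ al = / 12 + r' / 2).
  { destruct Hal; [exists r|exists (- r)]; (split; [auto|assumption]). }
  destruct Hr as [r' [Hr' Er']]. exists r', g.
  split; [exact Hr'|]. split; [rewrite Eg0; exact HAn|]. split; [rewrite Eg0; apply isQ_Q2R|].
  split.
  { rewrite <- Er'. replace (kone r') with (kone r); [exact Hg|]. destruct Hr' as [->| ->]; unfold kone; field. }
  rewrite Eg. split; [apply conv_tail, Hc|]. split; [|exact Hb].
  intros tau Ht. rewrite (Hf tau Ht), (qser_tail n) by assumption. f_equal. unfold al in Er'. lra.
Qed.

(** Independence forces the normal forms of f1 and f2 to have the exponents of r and -r in some
    order: with equal exponents they would be multiples of one Frobenius series. *)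
Lemma independent_rational_solutions_bounded P Qd k0 k1 f1 f2 h1 h2 a1 a2 :
  (2 <= Qd)%Z -> Z.gcd P Qd = 1%Z -> Q2R k1 = kone (ratio P Qd) ->
  independent_rational_solutions k0 k1 f1 f2 h1 h2 a1 a2 ->
  (bounded_denominators a1 /\ bounded_denominators a2 <-> bpair (ratio P Qd)).
Proof.
  intros HQ Hg Hk (Hs1 & Hs2 & Hind & Hq1 & Hq2). set (r := ratio P Qd) in *.
  assert (Hi : indicial r) by (apply indicial_ratio; assumption).
  assert (Hi' : indicial (- r)).
  { unfold r. rewrite ratio_opp. apply indicial_ratio; [exact HQ|]. rewrite Z.gcd_opp_l. exact Hg. }
  destruct (eta_power_inverse (2 * k0)) as (phi & psi & Hzphi & Hzpsi & phi0 & psi0 & Hinv & Hphi & Hpsi).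
  destruct (normal_form k0 k1 r f1 h1 a1 phi psi) as (r1 & g1 & Hr1 & g10 & Hg1q & Ho1 & Hc1 & Hf1 & Hb1);
    try assumption.
  { intros E. destruct (Hind 1%C 0%C) as [E1 _]; [intros tau Ht; rewrite (E tau Ht); ring|].
    apply RtoC_inj in E1. lra. }
  destruct (normal_form k0 k1 r f2 h2 a2 phi psi) as (r2 & g2 & Hr2 & g20 & Hg2q & Ho2 & Hc2 & Hf2 & Hb2);
    try assumption.
  { intros E. destruct (Hind 0%C 1%C) as [_ E1]; [intros tau Ht; rewrite (E tau Ht); ring|].
    apply RtoC_inj in E1. lra. }
  assert (Hi1 : indicial r1) by (destruct Hr1 as [-> | ->]; assumption).
  assert (Hi2 : indicial r2) by (destruct Hr2 as [-> | ->]; assumption).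
  assert (Hne : r1 <> r2).
  { intros <-. set (c := g2 O / g1 O).
    assert (E : g2 = (cst c * g1)%ps).
    { apply ps_ext. intros n. rewrite cst_mul_coef. apply (frobenius_unique r1); assumption. }
    destruct (Hind (RtoC c) (RtoC (-1))) as [_ E1]; [|apply RtoC_inj in E1; lra].
    intros tau Ht. rewrite (Hf1 tau Ht), (Hf2 tau Ht), E. unfold qser.
    rewrite <- pmul_assoc, CS_scal by (try exact Hc1; apply Cmod_q, Ht).
    replace (RtoC (-1)) with (- RtoC 1)%C by (rewrite <- RtoC_opp; reflexivity). ring. }
  assert (Hs : forall r' g, indicial r' -> g O <> 0 -> isQ (g O) ->
             ode 0 (kone r') (/ 12 + r' / 2) g -> (bdd g <-> bsol r')).
  { intros r' g Hi0 g0 Hgq Ho. split; intros H; [apply (bsol_intro r' g)|apply (bsol_elim r' g)]; assumption. }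
  rewrite Hb1, Hb2, (Hs r1 g1), (Hs r2 g2) by assumption.
  unfold bpair. destruct Hr1 as [-> | ->], Hr2 as [-> | ->]; try tauto; exfalso; apply Hne; reflexivity.
Qed.

Theorem theorem1 :
  forall (m1 m2 : Q) (P Qd : Z) (k0 : Z) (k1 : Q),
    (m1 - m2 == inject_Z P / inject_Z Qd)%Q ->
    Z.gcd P Qd = 1%Z ->
    (2 <= Qd)%Z ->
    (inject_Z k0 == 6 * (m1 + m2) - 1)%Q ->
    (k1 == (36 * (m1 - m2) ^ 2 - 1) / 144)%Q ->
    (exists (f1 f2 : C -> C) (h1 h2 : R) (a1 a2 : nat -> Q),
       independent_rational_solutions k0 k1 f1 f2 h1 h2 a1 a2) /\
    (forall (f1 f2 : C -> C) (h1 h2 : R) (a1 a2 : nat -> Q),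
       independent_rational_solutions k0 k1 f1 f2 h1 h2 a1 a2 ->
       exactly_one
         (unbounded_denominators a1 \/ unbounded_denominators a2)
         (Qd <= 5)%Z).
Proof.
  intros m1 m2 P Qd k0 k1 Hr Hg HQ _ Hk1.
  assert (Hk : Q2R k1 = kone (ratio P Qd)).
  { assert (E : (k1 == (36 * (inject_Z P / inject_Z Qd) ^ 2 - 1) / 144)%Q) by (rewrite Hk1, Hr; reflexivity).
    assert (HQ0 : ~ (inject_Z Qd == 0)%Q) by (unfold Qeq; simpl; lia).
    rewrite (Qeq_eqR _ _ E). unfold kone, ratio. simpl Qpower.
    unfold Qdiv, Qminus.
    rewrite Q2R_mult, Q2R_plus, !Q2R_mult, Q2R_opp, !Q2R_inv by (try exact HQ0; discriminate).
    unfold inject_Z. q2r. assert (IZR Qd <> 0) by (apply not_0_IZR; lia). field. assumption. }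
  split.
  - destruct (qser_solution P Qd k0 k1 HQ Hg Hk) as (h1 & a1 & E1 & a10 & Hc1 & Hs1 & Hq1).
    assert (Hg' : Z.gcd (- P) Qd = 1%Z) by (rewrite Z.gcd_opp_l; exact Hg).
    assert (Hk' : Q2R k1 = kone (ratio (- P) Qd)) by (rewrite Hk, <- ratio_opp; unfold kone; field).
    destruct (qser_solution (- P) Qd k0 k1 HQ Hg' Hk') as (h2 & a2 & E2 & a20 & Hc2 & Hs2 & Hq2).
    exists (qser h1 (fun n => Q2R (a1 n))), (qser h2 (fun n => Q2R (a2 n))), h1, h2, a1, a2.
    split; [exact Hs1|]. split; [exact Hs2|]. split; [|split; assumption].
    apply qser_lin_indep; try assumption; try (cbv beta; lra).
    intros k E. apply (ratio_lin_neq 1 (- k) P Qd); [lia| |].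
    + intros E0. assert (HP : P = (k * Qd)%Z) by lia.
      assert (Hd : (Qd | 1)%Z) by (rewrite <- Hg; apply Z.gcd_greatest; [exists k; exact HP|apply Z.divide_refl]).
      apply Z.divide_1_r_nonneg in Hd; lia.
    + rewrite opp_IZR, Rmult_1_l, <- E, E1, E2, <- ratio_opp. field.
  - intros f1 f2 h1 h2 a1 a2 H.
    pose proof (independent_rational_solutions_bounded P Qd k0 k1 f1 f2 h1 h2 a1 a2 HQ Hg Hk H) as Hb.
    rewrite (bpair_iff P Qd HQ Hg) in Hb. unfold exactly_one, unbounded_denominators.
    destruct (classic (bounded_denominators a1)), (classic (bounded_denominators a2)); tauto.
Qed.
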